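(* Let $\{R^{(k)}:k\ge 0\}$ be the opinion process on the random graph $G_n$ and let $\{\mathcal{R}^{(k)}:k\ge 0\}$ be the approximating process, both as defined in the context, with $i$th rows $\mathbf{R}_i^{(k)}$ and $\boldsymbol{\mathcal{R}}_i^{(k)}$ respectively. (1) Suppose $\theta_n \ge (6H\Lambda_n)^2\,\Delta_n\log n$. Then there exists a constant $\Gamma<\infty$ such that $$\sup_{k\ge 0}\ \mathbb{E}_n\left[\left\|R^{(k)}-\mathcal{R}^{(k)}\right\|_\infty\right]\ \le\ \Gamma\left(\sqrt{\frac{\log n}{\theta_n}}+\mathcal{E}_n\right),\qquad \text{where } \mathcal{E}_n:=\max_{1\le r,s\le K}\left|\frac{\pi_s^{(n)}\pi_r-\pi_s\pi_r^{(n)}}{\pi_r^{(n)}\pi_s}\right|.$$ (2) For any sequence $\theta_n$ satisfying $\theta_n\to\infty$ as $n\to\infty$, $$\sup_{k\ge 0}\ \max_{i\in V_n}\ \mathbb{E}_n\left[\left\|\mathbf{R}_i^{(k)}-\boldsymbol{\mathcal{R}}_i^{(k)}\right\|_1\right]\ \xrightarrow{P}\ 0\qquad\text{as } n\to\infty.$$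
   Context: Parameters. Fix integers $K,\ell\ge 1$ (communities, topics), $c,d\in[0,1]$ with $0<c+d\le 1$ and $d>0$, a finite constant $H>0$, a nonnegative kernel $\kappa:\{1,\dots,K\}^2\to[0,\infty)$, distributions $F_r$ on $[-1,1]^\ell$ ($1\le r\le K$), distributions $G_{r,s}$ on $[0,H]$ ($1\le r,s\le K$), and a family of distributions $\nu(\mathbf{a})$, $\mathbf{a}\in\{1,\dots,K\}\times[-1,1]^\ell$. Let $\theta_n>0$ be a density parameter with $\limsup_{n\to\infty}\max_{1\le r,s\le K}\kappa(r,s)\theta_n/n\le 1$. All random objects live on one probability space $(\Omega,\mathcal{F},P)$. Random graph. For each $n$, $G_n=(V_n,E_n)$ is a directed random graph with $|V_n|=n$. Vertex $i$ has community label $J_i\in\{1,\dots,K\}$; $\mathscr{J}_n=\{J_i:i\in V_n\}$, $\mathbb{E}_n[\cdot]=E[\cdot\mid\mathscr{J}_n]$, and $\mathbb{P}_n$ is the corresponding conditional probability. Given $\mathscr{J}_n$, the edge $(i,j)$ (written $i\to j$: $j$ listens to $i$) is present with probability $p_{ij}^{(n)}=\frac{\kappa(J_i,J_j)\theta_n}{n}\wedge 1$, independently of everything else. Assume $\pi_r^{(n)}:=\frac1n\sum_{i=1}^n 1(J_i=r)\xrightarrow{P}\pi_r$ for every $r$, where $(\pi_1,\dots,\pi_K)$ is a probability vector with all $\pi_r>0$. Internal beliefs $\mathbf{Q}_i\in[-1,1]^\ell$ are sampled from $F_{J_i}$; the attribute of $i$ is $\mathbf{A}_i=(J_i,\mathbf{Q}_i)$.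 Unnormalized weights $\{B_{ij}\}$ are conditionally independent given the labels, with $B_{ij}\sim G_{J_i,J_j}$. Normalized weights: $$C_{ij}=\frac{B_{ij}1(j\to i)}{\sum_{l\in V_n}B_{il}1(l\to i)}\,1\Big(\sum_{l\in V_n}B_{il}1(l\to i)>0,\ i\ne j\Big).$$ Opinion process. $R^{(k)}\in[-1,1]^{n\times\ell}$ has $i$th row $\mathbf{R}_i^{(k)}$ and satisfies $$\mathbf{R}_i^{(k+1)}=c\sum_{j\in V_n}C_{ij}\mathbf{R}_j^{(k)}+\mathbf{W}_i^{(k+1)}+(1-c-d)\mathbf{R}_i^{(k)},\quad k\ge 0,$$ with external signals $\mathbf{W}_i^{(k)}=d\,\mathbf{Z}_i^{(k)}+c\,\mathbf{Q}_i1(d_i^-=0)\in[-1,1]^\ell$, where $d_i^-=\sum_{j\in V_n}1(j\to i)$. Given the graph and attributes, the media signals $\mathbf{Z}_i^{(k)}$ are independent over $i$ and $k$, independent of $R^{(0)}$, with $\{\mathbf{Z}_i^{(k)}:k\ge 0\}$ i.i.d. with law $\nu(\mathbf{A}_i)$. The rows $\{\mathbf{R}_i^{(0)}:J_i=r\}$ of the initial matrix are identically distributed for each $r$; given $\mathscr{J}_n$, the rows of $R^{(0)}$ are conditionally independent of each other and $R^{(0)}$ is conditionally independent of the edges and the weights. Dependence of the process on $n$ is suppressed in the notation. Constants. $\beta_{r,s}=E[B_{ij}\mid J_i=r,J_j=s]$, $v_{r,s}=E[B_{ij}^2\mid J_i=r,J_j=s]$. $M\in[0,1]^{K\times K}$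 has entries $$m_{rs}=\frac{\pi_s\beta_{r,s}\kappa(s,r)}{\sum_{t=1}^K\pi_t\beta_{r,t}\kappa(t,r)}\,1\Big(\sum_{t=1}^K\pi_t\beta_{r,t}\kappa(t,r)>0\Big),$$ and $\mathcal{I}=\{r:\sum_{s=1}^K m_{rs}>0\}$. Also $\mu_r^{(n)}=\sum_{s=1}^K\beta_{r,s}\pi_s^{(n)}\kappa(s,r)$, $\nu_r^{(n)}=\sum_{s=1}^Kv_{r,s}\pi_s^{(n)}\kappa(s,r)$, $\Delta_n=\max_{r\in\mathcal{I}}\nu_r^{(n)}/(\mu_r^{(n)})^2$, $\Lambda_n=\max_{r\in\mathcal{I}}\mu_r^{(n)}/\nu_r^{(n)}$. $\bar W,\bar R\in[-1,1]^{K\times\ell}$ have $r$th rows $E[\mathbf{W}_i^{(0)}\mid J_i=r]$ and $E[\mathbf{R}_i^{(0)}\mid J_i=r]$. Approximating process. $\mathcal{R}^{(0)}=R^{(0)}$ and, for $k\ge 1$, $\mathcal{R}^{(k)}$ has $i$th row $$\boldsymbol{\mathcal{R}}_i^{(k)}=\sum_{t=0}^{k-1}(1-c-d)^t\mathbf{W}_i^{(k-t)}+1(k\ge 2)\sum_{t=1}^{k-1}\sum_{s=1}^ta_{s,t}(M^s\bar W)_{J_i\bullet}+\sum_{s=1}^ka_{s,k}(M^s\bar R)_{J_i\bullet}+(1-c-d)^k\mathbf{R}_i^{(0)},$$ where $a_{s,t}=\binom{t}{s}(1-c-d)^{t-s}c^s$ (with $0^0=1$) and $X_{j\bullet}$ denotes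 the $j$th row of a matrix $X$. Norms. For vectors, $\|\cdot\|_1$ is the $\ell_1$ norm; for a matrix, $\|X\|_\infty$ is the operator norm induced by the vector sup norm (maximum absolute row sum). $\xrightarrow{P}$ denotes convergence in probability.
   Formalization: In (1) it is also assumed that κ(r,s)θ_n/n ≤ 1 for all r,s and all large n, that n ≥ 2 and that all π_r^(n) > 0, and the bound holds a.s.; W̄ and R̄ are means conditional on the labels; given the labels, the weights are independent of the beliefs. *)

(* Defs.v *)
From HB Require Import structures.
From mathcomp Require Import all_boot all_order all_algebra.
From mathcomp Require Import all_classical all_reals all_analysis.

Set Implicit Arguments.
Unset Strict Implicit.
Unset Printing Implicit Defensive.

Import Order.TTheory GRing.Theory Num.Theory.
Import numFieldNormedType.Exports.
Local Open Scope classical_set_scope.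
Local Open Scope ring_scope.

(* Random vectors are tuples, which carry the product sigma-algebra;
   deterministic linear algebra is done with matrices. *)
Notation vec R l := (l.-tuple (measurableTypeR R)).

Definition cube {R : realType} {l : nat} : set (vec R l) :=
  [set x | forall j, `|tnth x j| <= 1].

Record params (R : realType) (K l : nat) := Params {
  p_c : R;
  p_d : R;
  p_H : R;
  p_kappa : 'I_K -> 'I_K -> R;
  p_F : 'I_K -> probability (vec R l) R;
  p_G : 'I_K -> 'I_K -> probability (measurableTypeR R) R;
  (* nu(r, q) is p_media r q; only its values for q in the cube matter. *)
  p_media : 'I_K -> R.-pker (vec R l) ~> (vec R l);
  p_theta : nat -> R;
  p_pi : 'I_K -> R;
  p_c01 : 0 <= p_c <= 1;
  p_d01 : 0 < p_d <= 1;
  p_cd : 0 < p_c + p_d <= 1;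
  p_H_gt0 : 0 < p_H;
  p_kappa_ge0 : forall r s, 0 <= p_kappa r s;
  p_F_supp : forall r, p_F r cube = 1%E;
  p_G_supp : forall r s, p_G r s [set x | 0 <= x <= p_H] = 1%E;
  p_theta_gt0 : forall n, 0 < p_theta n;
  p_theta_limsup :
    (limn_esup (fun n => (\big[Num.max/0]_r \big[Num.max/0]_s
       (p_kappa r s * p_theta n / n%:R))%:E) <= 1)%E;
  p_pi_gt0 : forall r, 0 < p_pi r;
  p_pi_sum : \sum_r p_pi r = 1 }.

(* Raw random objects; the vertex set of the n-th graph is 'I_n. *)
Record data (R : realType) (K l : nat) (dO : measure_display)
    (Omega : measurableType dO) (P : probability Omega R) := Data {
  x_J : forall n, 'I_n -> Omega -> 'I_K;
  (* x_edge i j is the indicator of i -> j; pairs (i, i) are included, so a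
     loop counts in the in-degree and in the normalization of the weights,
     although the weight matrix has zero diagonal. *)
  x_edge : forall n, 'I_n -> 'I_n -> {RV P >-> bool};
  x_B : forall n, 'I_n -> 'I_n -> {RV P >-> measurableTypeR R};
  x_Q : forall n, 'I_n -> {RV P >-> vec R l};
  x_Z : forall n, 'I_n -> nat -> {RV P >-> vec R l};
  x_R0 : forall n, 'I_n -> {RV P >-> vec R l};
  x_J_meas : forall n (i : 'I_n) r, measurable [set w | x_J i w = r] }.

Definition mxnorm_oo {R : realType} {m n} (X : 'M[R]_(m, n)) : R :=
  \big[Num.max/0]_i \sum_j `|X i j|.

Definition norm1 {R : realType} {n} (x : 'rV[R]_n) : R := \sum_j `|x 0 j|.

Definition cvg_in_probability {R : realType} {dO : measure_display}
    {Omega : measurableType dO} (P : probability Omega R)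
    (X : nat -> Omega -> \bar R) (a : R) : Prop :=
  forall eps : R, 0 < eps ->
    P [set w | (eps%:E < `|X n w - a%:E|)%E] @[n --> \oo] --> 0%E.

Section Deterministic.
Context {R : realType} {K l : nat} (p : params R K l).
Local Notation c := (p_c p).
Local Notation d := (p_d p).
Local Notation kappa := (p_kappa p).
Local Notation pi := (p_pi p).

Definition edge_prob n (j : 'I_n -> 'I_K) (i i' : 'I_n) : R :=
  Num.min (kappa (j i) (j i') * p_theta p n / n%:R) 1.

Definition beta r s : R := \int[p_G p r s]_x x.
Definition beta2 r s : R := \int[p_G p r s]_x (x ^+ 2).

Definition M_denom r : R := \sum_t pi t * beta r t * kappa t r.

Definition Mmx : 'M[R]_K := \matrix_(r, s)
  (pi s * beta r s * kappa s r / M_denom r * (0 < M_denom r)%R%:R).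

Definition active (r : 'I_K) : bool := 0 < \sum_s Mmx r s.

Definition acoef s t : R := 'C(t, s)%:R * (1 - c - d) ^+ (t - s) * c ^+ s.

(* The quantities below depend on the labels j of the n vertices. *)
Definition pin n (j : 'I_n -> 'I_K) r : R := #|[pred i | j i == r]|%:R / n%:R.

Definition mun n (j : 'I_n -> 'I_K) r : R :=
  \sum_s beta r s * pin j s * kappa s r.
Definition nun n (j : 'I_n -> 'I_K) r : R :=
  \sum_s beta2 r s * pin j s * kappa s r.

(* A maximum over an empty index set is 0. *)
Definition Deltan n (j : 'I_n -> 'I_K) : R :=
  \big[Num.max/0]_(r | active r) (nun j r / mun j r ^+ 2).
Definition Lambdan n (j : 'I_n -> 'I_K) : R :=
  \big[Num.max/0]_(r | active r) (mun j r / nun j r).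

Definition calEn n (j : 'I_n -> 'I_K) : R :=
  \big[Num.max/0]_r \big[Num.max/0]_s
    `|(pin j s * pi r - pi s * pin j r) / (pin j r * pi s)|.

End Deterministic.

Section Random.
Context {R : realType} {K l : nat} (p : params R K l).
Context {dO : measure_display} {Omega : measurableType dO}
  {P : probability Omega R} (X : data K l P).
Local Notation c := (p_c p).
Local Notation d := (p_d p).

Definition labels n (w : Omega) : {ffun 'I_n -> 'I_K} := [ffun i => x_J X i w].

Definition atom n (j : {ffun 'I_n -> 'I_K}) : set Omega :=
  [set w | labels n w = j].

(* The sigma-algebra generated by the labels is finite, with atoms the events
   [atom j]: the conditional expectation given the labels is the average over
   the atom of w (and 0 on null atoms). *)
Definition En n (Y : Omega -> R) (w : Omega) : \bar R :=
  ((\int[P]_(w' in atom (labels n w)) (Y w')%:E) *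
   ((fine (P (atom (labels n w))))^-1)%:E)%E.

Definition indeg n (i : 'I_n) (w : Omega) : nat :=
  (\sum_(j < n) x_edge X j i w)%N.

Definition inweight n (i : 'I_n) (w : Omega) : R :=
  \sum_(j < n) x_B X i j w * (x_edge X j i w)%:R.

Definition Cmx n (w : Omega) : 'M[R]_n := \matrix_(i, j)
  (x_B X i j w * (x_edge X j i w)%:R / inweight i w *
   ((0 < inweight i w)%R && (i != j))%:R).

Definition Wmx n (k : nat) (w : Omega) : 'M[R]_(n, l) := \matrix_(i, j)
  (d * tnth (x_Z X i k w) j
   + c * tnth (x_Q X i w) j * (indeg i w == 0)%:R).

Definition R0mx n (w : Omega) : 'M[R]_(n, l) :=
  \matrix_(i, j) tnth (x_R0 X i w) j.

Fixpoint opinion_process n (k : nat) (w : Omega) : 'M[R]_(n, l) :=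
  if k is k'.+1 then
    c *: (Cmx n w *m opinion_process n k' w) + Wmx n k w
    + (1 - c - d) *: opinion_process n k' w
  else R0mx n w.

(* Row r is the conditional mean, given the labels, of the row of Y at a vertex
   with label r.  Under [is_model] it does not depend on that vertex when Y is
   Wmx n 0 or R0mx n. *)
Definition community_mean n (Y : Omega -> 'M[R]_(n, l)) (w : Omega) :
    'M[R]_(K, l) := \matrix_(r, j)
  if [pick i | labels n w i == r] is Some i
  then fine (En n (fun w' => Y w' i j) w) else 0.

Definition Wbar n : Omega -> 'M[R]_(K, l) := community_mean (Wmx n 0).
Definition Rbar n : Omega -> 'M[R]_(K, l) := community_mean (R0mx n).

Definition approx_process n (k : nat) (w : Omega) : 'M[R]_(n, l) :=
  if k is 0 then R0mx n w else \matrix_(i < n)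
   (\sum_(0 <= t < k) (1 - c - d) ^+ t *: row i (Wmx n (k - t) w)
    + (2 <= k)%:R *: \sum_(1 <= t < k) \sum_(1 <= s < t.+1)
        acoef p s t *: row (labels n w i) (Mmx p ^+ s *m Wbar n w)
    + \sum_(1 <= s < k.+1)
        acoef p s k *: row (labels n w i) (Mmx p ^+ s *m Rbar n w)
    + (1 - c - d) ^+ k *: row i (R0mx n w)).

Record is_model : Prop := {
  (* Joint law: given the labels, the edges are independent Bernoulli, the
     weights are independent with laws G, and edges, weights and the pair
     (beliefs, initial opinions) are mutually independent; given all of these
     the media signals are independent with laws nu(A_i). *)
  joint_law : forall n (j : {ffun 'I_n -> 'I_K}) (e : 'I_n -> 'I_n -> bool)
      (S : 'I_n -> 'I_n -> set (measurableTypeR R))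
      (U V : 'I_n -> set (vec R l)) (m : nat)
      (T : 'I_n -> 'I_m -> set (vec R l)),
    (forall i i', measurable (S i i')) ->
    (forall i, measurable (U i)) -> (forall i, measurable (V i)) ->
    (forall i k, measurable (T i k)) ->
    P (atom j `&`
       [set w | forall i i', x_edge X i i' w = e i i'] `&`
       [set w | forall i i', S i i' (x_B X i i' w)] `&`
       [set w | forall i, U i (x_Q X i w) /\ V i (x_R0 X i w)] `&`
       [set w | forall i (k : 'I_m), T i k (x_Z X i k w)]) =
    ((\prod_i \prod_i' (if e i i' then edge_prob p j i i'
                        else 1 - edge_prob p j i i'))%:E *
     (\prod_i \prod_i' fine (p_G p (j i) (j i') (S i i')))%:E *
     \int[P]_(w in atom j `&`
                [set w | forall i, U i (x_Q X i w) /\ V i (x_R0 X i w)])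
       (\prod_i \prod_(k < m) fine (p_media p (j i) (x_Q X i w) (T i k)))%:E)%E;
  Q_law : forall n (j : {ffun 'I_n -> 'I_K}) (U : 'I_n -> set (vec R l)),
    (forall i, measurable (U i)) ->
    P (atom j `&` [set w | forall i, U i (x_Q X i w)]) =
    (P (atom j) * (\prod_i fine (p_F p (j i) (U i)))%:E)%E;
  R0_indep : forall n (j : {ffun 'I_n -> 'I_K}) (V : 'I_n -> set (vec R l)),
    (forall i, measurable (V i)) ->
    P (atom j `&` [set w | forall i, V i (x_R0 X i w)]) =
    (P (atom j) * (\prod_i (fine (P (atom j `&` [set w | V i (x_R0 X i w)])) /
                            fine (P (atom j))))%:E)%E;
  R0_ident : forall n (j : {ffun 'I_n -> 'I_K}) (i i' : 'I_n) (V : set (vec R l)),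
    measurable V -> j i = j i' ->
    P (atom j `&` [set w | V (x_R0 X i w)]) =
    P (atom j `&` [set w | V (x_R0 X i' w)]);
  R0_bounded : forall n (i : 'I_n), {ae P, forall w, cube (x_R0 X i w)};
  W_bounded : forall n (i : 'I_n) k,
    {ae P, forall w, forall j, `|Wmx n k w i j| <= 1};
  pin_cvg : forall r,
    cvg_in_probability P (fun n w => (pin (labels n w) r)%:E) (p_pi p r) }.

End Random.

(* Main.v *)
Require Import Defs.
From HB Require Import structures.
From mathcomp Require Import all_boot all_order all_algebra.
From mathcomp Require Import all_classical all_reals all_analysis.
From mathcomp Require Import measurable_realfun ring lra.

Set Implicit Arguments.
Unset Strict Implicit.
Unset Printing Implicit Defensive.

Import Order.TTheory GRing.Theory Num.Theory.
Import numFieldNormedType.Exports.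
Local Open Scope classical_set_scope.
Local Open Scope ring_scope.

(** Fix the labels and work under the conditional law on the corresponding
    atom, the event that the labels take these values.  There the edges with
    their weights are independent over ordered pairs of vertices, and so are the
    data of the vertices.

    The approximating process obeys a recursion of the same form as the opinion
    process ([approx_split]): the opinion of a vertex is the sum of a fluctuation
    produced by its own past signals and of a mean opinion of its community,
    driven by the matrix M.  Subtracting the two recursions
    ([error_decomposition]), the error D satisfies
      D(k+1) = (1 - c - d) D(k) + c C D(k) + c (noise + averaging error),
    where the noise is the average by C of the fluctuations of the neighbours,
    and the averaging error is the difference between C and M applied to the mean
    opinions.  The rows of C sum to at most 1, so the recursion contracts by
    1 - d and the error is at most 1/d times the error of one step, uniformly in
    time.

    The one-step errors are small because the total weight received by a vertex
    has mean of order theta.  Exponential moments of sums of independent weights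
    ([Ex_mgf_block_sum]) and of combinations of centred variables with
    independent coefficients ([Ex_mgf_centered]) show that the maximum of these
    errors over a set of N vertices has mean of order rho, provided that
    ln N <= rho^2 theta ([Ex_max_averaging], [Ex_max_noise]).  To this is added
    the distance gam0 between the mean community weights given the labels and
    their limits.

    For the maximum over all vertices rho^2 = ln n / theta, and the recursion is
    solved in the sup norm ([Ex_max_Delta]).  For a single vertex one wants
    rho^2 = 1 / theta, and the maximum over all vertices is not available.  The
    recursion is then followed along the walk that explores the graph from that
    vertex: as long as the walk does not return to a visited vertex, the weights
    of the current vertex are independent of the errors still to come, and
    returns have probability of order rho ([Ex_explored], [Ex_Delta]).

    Finally gam0 is bounded by a multiple of the discrepancy of the label
    frequencies ([pin_deviation], [empirical_deviation]), and the label
    configurations of probability zero form a negligible event. *)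

(** * Expectation of bounded random variables *)

Section BoundedExpectation.
Context d (T : measurableType d) (R : realType) (P : probability T R).
Implicit Types f g : T -> R.

(** Every variable below is bounded everywhere, not only almost everywhere:
    integrability is then automatic and expectations are real numbers. *)
Definition bounded_rv f :=
  measurable_fun setT f /\ exists M : R, forall x, `|f x| <= M.

Definition Ex f : R := \int[P]_x f x.

Lemma bounded_rv_integrable f : bounded_rv f -> P.-integrable setT (EFin \o f).
Proof.
move=> [mf [M fM]]; apply: measurable_bounded_integrable => //.
  by rewrite -ge0_fin_numE// fin_num_measure.
exists M; split; first by rewrite num_real.
by move=> x /ltW Mx y _; apply: le_trans Mx; exact: fM.
Qed.

Lemma bounded_rv_cst (r : R) : bounded_rv (fun=> r).
Proof. by split; [exact: measurable_cst|exists `|r|]. Qed.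

Lemma bounded_rvD f g : bounded_rv f -> bounded_rv g -> bounded_rv (f \+ g).
Proof.
move=> [mf [M fM]] [mg [N gN]]; split; first exact: measurable_funD.
by exists (M + N) => x; rewrite (le_trans (ler_normD _ _))// lerD.
Qed.

Lemma bounded_rvM f g : bounded_rv f -> bounded_rv g -> bounded_rv (f \* g).
Proof.
move=> [mf [M fM]] [mg [N gN]]; split; first exact: measurable_funM.
by exists (M * N) => x; rewrite normrM ler_pM.
Qed.

Lemma Ex_fin f : bounded_rv f -> (\int[P]_x (f x)%:E)%E = (Ex f)%:E.
Proof.
move=> /bounded_rv_integrable fi; rewrite /Ex /Rintegral fineK//.
exact: integrable_fin_num.
Qed.

Lemma Ex_cst r : Ex (fun=> r) = r.
Proof. by rewrite /Ex Rintegral_cst//; have /= -> := probability_setT P; rewrite mulr1. Qed.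

Lemma eq_Ex f g : f =1 g -> Ex f = Ex g.
Proof. by move=> fg; apply: eq_Rintegral => x _. Qed.

Lemma ExD f g : bounded_rv f -> bounded_rv g ->
  Ex (fun x => f x + g x) = Ex f + Ex g.
Proof. by move=> bf bg; rewrite /Ex RintegralD//; exact: bounded_rv_integrable. Qed.

Lemma ExZ r f : bounded_rv f -> Ex (fun x => r * f x) = r * Ex f.
Proof. by move=> bf; rewrite /Ex RintegralZl//; exact: bounded_rv_integrable. Qed.

Lemma le_Ex f g : bounded_rv f -> bounded_rv g -> (forall x, f x <= g x) ->
  Ex f <= Ex g.
Proof.
by move=> bf bg fg; apply: le_Rintegral => //; exact: bounded_rv_integrable.
Qed.

Lemma Ex_ge0 f : (forall x, 0 <= f x) -> 0 <= Ex f.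
Proof. by move=> f0; apply: Rintegral_ge0 => x _. Qed.

Lemma bounded_rv_sum (J : Type) (s : seq J) (p : pred J) (F : J -> T -> R) :
  (forall i, p i -> bounded_rv (F i)) ->
  bounded_rv (fun x => \sum_(i <- s | p i) F i x).
Proof.
move=> bF; rewrite (_ : (fun x => _) = \sum_(i <- s | p i) F i); last first.
  by apply/funext => x; rewrite fct_sumE.
elim/big_ind : _ => //; first exact: (bounded_rv_cst 0).
by move=> f g bf bg; exact: bounded_rvD.
Qed.

Lemma bounded_rv_prod (J : Type) (s : seq J) (p : pred J) (F : J -> T -> R) :
  (forall i, p i -> bounded_rv (F i)) ->
  bounded_rv (fun x => \prod_(i <- s | p i) F i x).
Proof.
move=> bF; rewrite (_ : (fun x => _) = \prod_(i <- s | p i) F i); last first.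
  by apply/funext => x; rewrite fct_prodE.
elim/big_ind : _ => //; first exact: (bounded_rv_cst 1).
by move=> f g bf bg; exact: bounded_rvM.
Qed.

Lemma Ex_sum (J : Type) (s : seq J) (p : pred J) (F : J -> T -> R) :
  (forall i, p i -> bounded_rv (F i)) ->
  Ex (fun x => \sum_(i <- s | p i) F i x) = \sum_(i <- s | p i) Ex (F i).
Proof.
move=> bF; elim: s => [|i s IH].
  by rewrite big_nil; under eq_Ex do rewrite big_nil; exact: Ex_cst.
rewrite big_cons; under eq_Ex do rewrite big_cons.
case: ifP => // pi; rewrite ExD ?IH//; first exact: bF.
exact: bounded_rv_sum.
Qed.

Lemma bounded_rv_norm f : bounded_rv f -> bounded_rv (fun x => `|f x|).
Proof.
move=> [mf [M fM]]; split; first exact: measurableT_comp.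
by exists M => x; rewrite normr_id.
Qed.

End BoundedExpectation.

Section IndependentProduct.
Context d (T : measurableType d) (R : realType) (P : probability T R).

(** By independence the law of the pair (f, g) agrees with the product of the
    laws on rectangles, hence everywhere; Fubini then factors the expectation. *)
Lemma Ex_mul_indep (f g : T -> R) : bounded_rv f -> bounded_rv g ->
  (forall A B, measurable A -> measurable B ->
     P (f @^-1` A `&` g @^-1` B) = (P (f @^-1` A) * P (g @^-1` B))%E) ->
  Ex P (fun x => f x * g x) = Ex P f * Ex P g.
Proof.
move=> bf bg indep.
have [mf [M fM]] := bf; have [mg [N gN]] := bg.
pose fT : {mfun T >-> R} := mfun_Sub (mem_set mf).
pose gT : {mfun T >-> R} := mfun_Sub (mem_set mg).
pose fgT : {mfun T >-> (R * R)%type} :=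
  mfun_Sub (mem_set (measurable_fun_pair mf mg)).
pose h : R * R -> \bar R :=
  fun z => (z.1 * z.2)%:E.
have mh : measurable_fun setT h.
  by apply/measurable_EFinP; apply: measurable_funM.
have bfg := bounded_rvM bf bg.
pose muf := distribution P fT; pose mug := distribution P gT.
pose m12 : {measure set (R * R) -> \bar R} := distribution P fgT.
pose mp : {measure set (R * R) -> \bar R} := (muf \x mug)%E.
have m12E A : measurable A -> m12 A = mp A.
  move=> mA; apply/esym; rewrite /mp.
  by apply: product_measure_unique mA => X Y mX mY; exact: indep.
have Eprod h' : (\int[m12]_z h' z = \int[mp]_z h' z)%E.
  by apply: (eq_measure_integral mp) => A mA _; exact: m12E.
have int_fg : m12.-integrable setT h.
  apply: integrable_pushforward => //.
  by rewrite preimage_setT; exact: bounded_rv_integrable bfg.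
have int_h : mp.-integrable setT h.
  by move/integrableP : int_fg => [_]; rewrite Eprod => ?; exact/integrableP.
have : (Ex P (fun x => f x * g x))%:E = (Ex P f * Ex P g)%:E; last by case.
transitivity (\int[m12]_z h z)%E.
  rewrite -Ex_fin// [RHS]integral_pushforward//.
  by rewrite preimage_setT; exact: bounded_rv_integrable bfg.
rewrite Eprod -(integral12_prod_meas1 int_h).
have Eg (x : R) : (\int[mug]_y (x * y)%:E = (x * Ex P g)%:E)%E.
  rewrite [LHS]integral_pushforward//=.
  - by rewrite -ExZ// -(Ex_fin P (bounded_rvM (bounded_rv_cst _ x) bg)).
  - by apply/measurable_EFinP; apply: measurable_funM.
  - rewrite preimage_setT; apply/bounded_rv_integrable.
    exact: (bounded_rvM (bounded_rv_cst _ x) bg).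
rewrite /fubini_F /h /=; under eq_integral do rewrite Eg.
rewrite [LHS]integral_pushforward//=.
- under eq_integral do rewrite /= mulrC.
  by rewrite (Ex_fin P (bounded_rvM (bounded_rv_cst _ _) bf)) ExZ// mulrC.
- by apply/measurable_EFinP; apply: measurable_funM.
- rewrite preimage_setT; apply/bounded_rv_integrable.
  exact: (bounded_rvM bf (bounded_rv_cst _ _)).
Qed.

End IndependentProduct.

(** * Families of independent blocks of events *)

Section IndependentBlocks.
Context d (T : measurableType d) (R : realType) (P : probability T R).
Context (I : finType) (G : I -> set (set T)).
Implicit Types (S : pred I) (f g : T -> R).

(** The block [b] carries a pi-system [G b], and events from distinct blocks
    are jointly independent.  Pi-systems, rather than sigma-algebras, are what
    a product formula for the joint law provides. *)
Record independent_blocks : Prop := IndependentBlocks {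
  block_measurable : forall b A, G b A -> measurable A;
  block_setT : forall b, G b setT;
  block_setI : forall b, setI_closed (G b);
  block_indep : forall A : I -> set T, (forall b, G b (A b)) ->
    P [set x | forall b, A b x] = (\prod_b fine (P (A b)))%:E }.

Definition block_events S : set (set T) :=
  [set B | exists2 A : I -> set T, forall b, G b (A b) &
           B = [set x | forall b, S b -> A b x]].

(** The measurable space of the blocks in [S]: measurability with respect to
    it expresses that a variable depends on these blocks only. *)
Definition block_space S := g_sigma_algebraType (block_events S).

Definition block_rv S f := bounded_rv (f : block_space S -> R).

Hypothesis GI : independent_blocks.

Lemma block_events_setT S : block_events S setT.
Proof.
exists (fun=> setT); first exact: (block_setT GI).
by apply/seteqP; split.
Qed.

Lemma block_events_setI S : setI_closed (block_events S).
Proof.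
move=> _ _ [A GA ->] [B GB ->]; exists (fun b => A b `&` B b).
  by move=> b; apply: (block_setI GI).
apply/seteqP; split => x /=; first by move=> [xA xB] b Sb; split; auto.
by move=> xAB; split=> b /xAB[].
Qed.

Lemma block_events_measurable S : block_events S `<=` measurable.
Proof.
move=> _ [A GA ->].
rewrite (_ : [set x | _] = \bigcap_(b in [set` S]) A b)//.
apply: fin_bigcap_measurable => // b _; exact: (block_measurable GI (GA b)).
Qed.

Lemma sub_block_events S S' : {subset S <= S'} ->
  block_events S `<=` block_events S'.
Proof.
move=> SS' _ [A GA ->]; exists (fun b => if S b then A b else setT).
  by move=> b; case: ifP => _; [exact: GA|exact: (block_setT GI)].
apply/seteqP; split => x /= xA b; first by case: ifP => // Sb _; exact: xA.
by move=> Sb; have := xA b (SS' b Sb); rewrite Sb.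
Qed.

Lemma sub_block_sigma S S' : {subset S <= S'} ->
  <<s block_events S >> `<=` <<s block_events S' >>.
Proof.
move=> SS'; apply: smallest_sub; first exact: smallest_sigma_algebra.
by move=> A /(sub_block_events SS'); exact: sub_sigma_algebra.
Qed.

Lemma block_sigma_measurable S : <<s block_events S >> `<=` measurable.
Proof.
apply: smallest_sub; first exact: sigma_algebra_measurable.
exact: block_events_measurable.
Qed.

Lemma probability_block_event S (A : I -> set T) : (forall b, G b (A b)) ->
  P [set x | forall b, S b -> A b x] = (\prod_(b | S b) fine (P (A b)))%:E.
Proof.
move=> GA.
have -> : [set x | forall b, S b -> A b x] =
          [set x | forall b, (if S b then A b else setT) x].
  apply/seteqP; split => x /= xA b; first by case: ifP => // Sb; exact: xA.
  by move=> Sb; have := xA b; rewrite Sb.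
rewrite (block_indep GI); last first.
  by move=> b; case: ifP => _; [exact: GA|exact: (block_setT GI)].
congr EFin; rewrite [RHS]big_mkcond; apply: eq_bigr => b _.
by case: ifP => // _; have /= -> := probability_setT P.
Qed.

Lemma block_events_indep S S' A B : (forall b, S b -> ~~ S' b) ->
  block_events S A -> block_events S' B -> P (A `&` B) = (P A * P B)%E.
Proof.
move=> SS' [A' GA ->] [B' GB ->]; rewrite !probability_block_event// -EFinM.
have -> : [set x | forall b, S b -> A' b x] `&`
          [set x | forall b, S' b -> B' b x] =
  [set x | forall b, predT b ->
    (if S b then A' b else if S' b then B' b else setT) x].
  apply/seteqP; split => x /=.
    by move=> [xA xB] b _; case: ifP => [/xA//|_]; case: ifP => [/xB//|_].
  move=> xAB; split=> b Sb; have := xAB b isT; first by rewrite Sb.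
  by case: ifPn => [/SS'|_]; rewrite Sb.
rewrite probability_block_event; last first.
  move=> b; case: ifP => _; first exact: GA.
  by case: ifP => _; [exact: GB|exact: (block_setT GI)].
congr EFin; rewrite [X in X * _]big_mkcond [X in _ * X]big_mkcond -big_split/=.
apply: eq_bigr => b _; case: ifPn => [/SS'/negbTE->|_]; first by rewrite mulr1.
by case: ifP => _; rewrite mul1r//; have /= -> := probability_setT P.
Qed.

(** Both sides are finite measures in [A] that agree on a pi-system generating
    the sigma-algebra. *)
Lemma dynkin_indep (H : set (set T)) (B : set T) : H `<=` measurable ->
  setI_closed H -> H setT -> measurable B ->
  (forall A, H A -> P (A `&` B) = (P A * P B)%E) ->
  forall A, <<s H >> A -> P (A `&` B) = (P A * P B)%E.
Proof.
move=> Hm HI HT mB HB A sA.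
have PB0 : 0 <= fine (P B) by rewrite fine_ge0.
pose m1 : {measure set T -> \bar R} := mrestr P mB.
pose m2 : {measure set T -> \bar R} := mscale (NngNum PB0) P.
have PBE : (fine (P B))%:E = P B by rewrite fineK// fin_num_measure.
have -> : (P A * P B)%E = m2 A by rewrite /m2 /= /mscale /= PBE muleC.
change (P (A `&` B)) with (m1 A).
apply: (g_sigma_algebra_measure_unique H Hm (fun=> setT)) sA => //.
- by rewrite bigcup_const//; exists 0%N.
- by move=> X HX; rewrite /m1 /m2 /= /mscale /mrestr /= PBE HB// muleC.
- move=> _; rewrite /m1 /= /mrestr setTI.
  by rewrite -ge0_fin_numE// fin_num_measure.
Qed.

(** [dynkin_indep] applied twice, first extending one of the two events and
    then the other. *)
Lemma block_sigma_indep S S' A B : (forall b, S b -> ~~ S' b) ->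
  <<s block_events S >> A -> <<s block_events S' >> B ->
  P (A `&` B) = (P A * P B)%E.
Proof.
move=> SS' sA sB.
apply: (@dynkin_indep (block_events S)) => //.
- exact: block_events_measurable.
- exact: block_events_setI.
- exact: (@block_events_setT _).
- exact: block_sigma_measurable sB.
move=> {sA}A sA; rewrite setIC muleC.
apply: (@dynkin_indep (block_events S')) => //.
- exact: block_events_measurable.
- exact: block_events_setI.
- exact: (@block_events_setT _).
- exact: block_events_measurable sA.
by move=> {sB}B sB; rewrite setIC muleC; exact: block_events_indep sA sB.
Qed.

Lemma block_rv_sub S S' f : {subset S <= S'} -> block_rv S f -> block_rv S' f.
Proof.
move=> SS' [mf bf]; split=> // _ B mB.
have mfB := mf measurableT B mB.
exact: (sub_block_sigma SS' mfB).
Qed.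

Lemma block_rvW S f : block_rv S f -> bounded_rv f.
Proof.
move=> [mf bf]; split=> // _ B mB.
have mfB := mf measurableT B mB.
exact: (block_sigma_measurable mfB).
Qed.

Lemma Ex_block_mul S S' f g : (forall b, S b -> ~~ S' b) ->
  block_rv S f -> block_rv S' g ->
  Ex P (fun x => f x * g x) = Ex P f * Ex P g.
Proof.
move=> SS' bf bg; apply: Ex_mul_indep; [exact: block_rvW bf|exact: block_rvW bg|].
move=> A B mA mB; apply: (block_sigma_indep SS').
  by rewrite -[_ @^-1` _]setTI; case: bf => mf _; exact: (mf measurableT).
by rewrite -[_ @^-1` _]setTI; case: bg => mg _; exact: (mg measurableT).
Qed.

Lemma Ex_block_prod (J : eqType) (s : seq J) (S : J -> pred I)
    (F : J -> T -> R) : uniq s ->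
  (forall i j b, i \in s -> j \in s -> S i b -> S j b -> i = j) ->
  (forall j, j \in s -> block_rv (S j) (F j)) ->
  Ex P (fun x => \prod_(j <- s) F j x) = \prod_(j <- s) Ex P (F j).
Proof.
elim: s => [|i s IH] /=.
  by move=> _ _ _; under eq_Ex do rewrite big_nil; rewrite big_nil Ex_cst.
move=> /andP[ins us] dS bF; rewrite big_cons; under eq_Ex do rewrite big_cons.
have bF' j : j \in s -> block_rv (S j) (F j).
  by move=> js; apply: bF; rewrite inE js orbT.
rewrite (@Ex_block_mul (S i) [pred b | has (S^~ b) s]).
- congr (_ * _); apply: IH => // j k b js ks.
  by apply: dS; rewrite inE ?js ?ks orbT.
- move=> b Sib /=; apply/hasPn => j js; apply/negP => Sjb.
  move: ins; rewrite (dS i j b) ?js// ?inE ?eqxx// js orbT//.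
- by apply: bF; rewrite inE eqxx.
- rewrite (_ : (fun x => _) = fun x => \prod_(j <- s | j \in s) F j x); last first.
    by apply/funext => x; rewrite big_seq.
  rewrite /block_rv; apply: bounded_rv_prod => j js; apply: block_rv_sub (bF' j js).
  by move=> b Sjb; apply/hasP; exists j.
Qed.

End IndependentBlocks.

(** * Exponential moments and maximal inequalities *)

Section Moments.
Context (R : realType).

(** From e^(-x) >= 1 - x by inversion; the factor 2 replaces 1/2 in the Taylor
    bound and leaves room up to x = 1/2. *)
Lemma expR_le_quadratic (x : R) : x <= 2^-1 -> expR x <= 1 + x + 2 * x ^+ 2.
Proof.
move=> x2; have x1 : 0 < 1 - x by lra.
have : (expR (- x))^-1 <= (1 - x)^-1.
  rewrite lef_pV2 ?posrE ?expR_gt0//; exact: expR_ge1Dx.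
rewrite -expRN opprK => /le_trans; apply.
rewrite -[leLHS]mul1r ler_pdivrMr//.
have : 0 <= x ^+ 2 * (1 - 2 * x) by rewrite mulr_ge0 ?sqr_ge0//; lra.
by rewrite (_ : (1 + x + _) * _ = 1 + x ^+ 2 * (1 - 2 * x)); [lra|ring].
Qed.

Lemma expR_big_sum (J : Type) (s : seq J) (p : pred J) (F : J -> R) :
  expR (\sum_(j <- s | p j) F j) = \prod_(j <- s | p j) expR (F j).
Proof.
by elim/big_rec2 : _ => [|j y z _ <-]; rewrite ?expR0 ?expRD.
Qed.

End Moments.

Section MoreBounded.
Context d (T : measurableType d) (R : realType) (P : probability T R).
Implicit Types f g : T -> R.

Lemma bounded_rv_exp f : bounded_rv f -> bounded_rv (fun x => expR (f x)).
Proof.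
move=> [mf [M fM]]; split; first exact: measurableT_comp.
exists (expR M) => x; rewrite ger0_norm ?expR_ge0// ler_expR.
exact: le_trans (ler_norm _) (fM x).
Qed.

Lemma bounded_rv_bigmax (J : Type) (s : seq J) (p : pred J) (F : J -> T -> R) :
  (forall i, p i -> bounded_rv (F i)) ->
  bounded_rv (fun x => \big[Num.max/0]_(i <- s | p i) F i x).
Proof.
move=> bF; elim: s => [|i s [mS [M SM]]].
  by under eq_fun do rewrite big_nil; exact: bounded_rv_cst.
case pi: (p i); last first.
  by under eq_fun do rewrite big_cons pi; split=> //; exists M.
under eq_fun do rewrite big_cons pi.
have [mF [N FN]] := bF i pi; split; first exact: measurable_maxr.
exists (Num.max M N) => x; rewrite le_max.
by case: (leP (F i x)) => _; rewrite ?SM ?FN ?orbT.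
Qed.

Lemma bounded_rvZ (r : R) f : bounded_rv f -> bounded_rv (fun x => r * f x).
Proof. by move=> bf; exact: (bounded_rvM (bounded_rv_cst T r) bf). Qed.

Lemma bounded_rvB f g : bounded_rv f -> bounded_rv g ->
  bounded_rv (fun x => f x - g x).
Proof.
move=> bf bg; have := bounded_rvD bf (bounded_rvZ (-1) bg).
by congr bounded_rv; apply/funext => x /=; rewrite mulN1r.
Qed.

Lemma bounded_rv_bool (b : T -> bool) : measurable_fun setT b ->
  bounded_rv (fun x => (b x)%:R : R).
Proof.
move=> mb; split.
  rewrite (_ : (fun x => _) = fun x => if b x then 1 else 0).
    exact: measurable_fun_ifT.
  by apply/funext => x; case: (b x).
by exists 1 => x; case: (b x); rewrite ?normr1 ?normr0.
Qed.

(** On the positive half-line 1/x is exp(-ln x), a composition of measurable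
    functions; the indicator removes the other values. *)
Lemma measurable_fun_ratio f g : measurable_fun setT f -> measurable_fun setT g ->
  measurable_fun setT (fun x => f x / g x * (0 < g x)%R%:R).
Proof.
move=> mf mg.
rewrite (_ : (fun x => _) =
             fun x => f x * expR (- ln (g x)) * (0 < g x)%R%:R); last first.
  apply/funext => x; case: ltP => [g0|_]; last by rewrite !mulr0.
  by rewrite expRN lnK.
apply: measurable_funM.
  apply: measurable_funM => //; apply: measurableT_comp => //.
  by apply: measurable_funN; apply: measurableT_comp.
have [//] := bounded_rv_bool (measurable_fun_ltr (@measurable_cst _ _ T _ setT (0 : R)) mg).
Qed.

(** With t = tau + s one has lam y <= t + e^(lam y - t), because 1 + x <= e^x.
    The maximum is thus bounded by a sum of exponentials, whose mean is at most
    2 #|D| e^(s - t) <= 2; the price of the maximum is only ln #|D|. *)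
Lemma Ex_max_subgaussian (J : finType) (D : pred J) (X : J -> T -> R)
    (lam s tau : R) :
  0 < lam -> (0 < #|D|)%N -> ln #|D|%:R <= tau ->
  (forall i, D i -> bounded_rv (X i)) ->
  (forall i, D i -> Ex P (fun x => expR (lam * X i x)) <= expR s) ->
  (forall i, D i -> Ex P (fun x => expR (- lam * X i x)) <= expR s) ->
  Ex P (fun x => \big[Num.max/0]_(i | D i) `|X i x|) <= (tau + s + 2) / lam.
Proof.
move=> lam0 D0 Dtau bX Xp Xm; set t := tau + s.
pose e1 i x := expR (lam * X i x); pose e2 i x := expR (- lam * X i x).
have be1 i : D i -> bounded_rv (e1 i).
  by move=> Di; apply: bounded_rv_exp; apply: bounded_rvZ; exact: bX.
have be2 i : D i -> bounded_rv (e2 i).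
  by move=> Di; apply: bounded_rv_exp; apply: bounded_rvZ; exact: bX.
have be12 i : D i -> bounded_rv (fun x => e1 i x + e2 i x).
  by move=> Di; exact: (bounded_rvD (be1 i Di) (be2 i Di)).
pose B x := lam^-1 * (t + expR (- t) * \sum_(i | D i) (e1 i x + e2 i x)).
have bB : bounded_rv B.
  apply: bounded_rvZ; apply: (bounded_rvD (bounded_rv_cst _ t)).
  by apply: bounded_rvZ; apply: bounded_rv_sum.
have bm : bounded_rv (fun x => \big[Num.max/0]_(i | D i) `|X i x|).
  by apply: bounded_rv_bigmax => i Di; apply: bounded_rv_norm; exact: bX.
have key y : lam * y <= t + expR (- t) * expR (lam * y).
  by rewrite -expRD; have := expR_ge1Dx (- t + lam * y); lra.
apply: (@le_trans _ _ (Ex P B)).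
  apply: le_Ex => // x.
  have posS : 0 <= \sum_(i | D i) (e1 i x + e2 i x).
    by apply: sumr_ge0 => i _; rewrite addr_ge0 ?expR_ge0.
  have le_lamB y : lam * y <= t + expR (- t) * \sum_(i | D i) (e1 i x + e2 i x) ->
      y <= B x by move=> h; rewrite /B ler_pdivlMl.
  have bnd i : D i -> `|X i x| <= B x.
    move=> Di; apply: le_lamB.
    have le1 y : y = X i x \/ y = - X i x ->
        lam * y <= t + expR (- t) * \sum_(i | D i) (e1 i x + e2 i x).
      move=> yE; apply: le_trans (key y) _; rewrite lerD2l ler_pM2l ?expR_gt0//.
      rewrite (bigD1 i)//= -[leLHS]addr0 lerD//; last first.
        by apply: sumr_ge0 => j _; rewrite addr_ge0 ?expR_ge0.
      case: yE => ->; rewrite /e1 /e2; first by rewrite lerDl expR_ge0.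
      by rewrite mulrN -mulNr lerDr expR_ge0.
    by case: (ler0P (X i x)) => _; apply: le1; [right|left].
  apply: bigmax_le => //.
  have [i Di] : exists i, D i by move/card_gt0P : D0 => [i]; exists i.
  exact: le_trans (normr_ge0 _) (bnd i Di).
rewrite /B ExZ; last first.
  apply: (bounded_rvD (bounded_rv_cst _ t)).
  by apply: bounded_rvZ; apply: bounded_rv_sum.
rewrite mulrC ler_pM2r ?invr_gt0// ExD ?Ex_cst; [|exact: bounded_rv_cst|]; last first.
  by apply: bounded_rvZ; apply: bounded_rv_sum.
rewrite lerD2l ExZ; last by apply: bounded_rv_sum.
rewrite Ex_sum//.
apply: (@le_trans _ _ (expR (- t) * \sum_(i | D i) (expR s + expR s))).
  rewrite ler_pM2l ?expR_gt0//; apply: ler_sum => i Di.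
  rewrite (ExD P (be1 i Di) (be2 i Di)); apply: lerD; [exact: Xp|exact: Xm].
rewrite sumr_const -[_ *+ #|_|]mulr_natr.
rewrite (_ : _ * _ = 2 * (expR (- t + s) * #|D|%:R)); last by rewrite expRD; ring.
rewrite (_ : - t + s = - tau); last by rewrite /t; lra.
have D0' : 0 < #|D|%:R :> R by rewrite ltr0n.
have : #|D|%:R <= expR tau by rewrite -ler_ln ?posrE ?expR_gt0// expRK.
rewrite expRN => Dexp.
have : #|D|%:R / expR tau <= 1 by rewrite ler_pdivrMr ?expR_gt0// mul1r.
by lra.
Qed.

End MoreBounded.

Section BlockClosure.
Context d (T : measurableType d) (R : realType) (P : probability T R).
Context (I : finType) (G : I -> set (set T)).
Local Notation brv := (@block_rv _ T R I G).
Implicit Types (S : pred I) (f g : T -> R).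

Lemma block_rv_cst S (r : R) : brv S (fun=> r).
Proof. exact: bounded_rv_cst. Qed.

Lemma block_rvD S f g : brv S f -> brv S g -> brv S (fun x => f x + g x).
Proof. exact: bounded_rvD. Qed.

Lemma block_rvB S f g : brv S f -> brv S g -> brv S (fun x => f x - g x).
Proof. exact: bounded_rvB. Qed.

Lemma block_rvM S f g : brv S f -> brv S g -> brv S (fun x => f x * g x).
Proof. exact: bounded_rvM. Qed.

Lemma block_rvZ S (r : R) f : brv S f -> brv S (fun x => r * f x).
Proof. exact: bounded_rvZ. Qed.

Lemma block_rv_sum S (J : eqType) (s : seq J) (p : pred J) (F : J -> T -> R) :
  (forall i, i \in s -> p i -> brv S (F i)) ->
  brv S (fun x => \sum_(i <- s | p i) F i x).
Proof.
move=> bF; rewrite (_ : (fun x => _) =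
    fun x => \sum_(i <- s | (i \in s) && p i) F i x); last first.
  by apply/funext => x; rewrite big_seq_cond.
by apply: bounded_rv_sum => i /andP[]; exact: bF.
Qed.

Lemma block_rv_prod S (J : eqType) (s : seq J) (p : pred J) (F : J -> T -> R) :
  (forall i, i \in s -> p i -> brv S (F i)) ->
  brv S (fun x => \prod_(i <- s | p i) F i x).
Proof.
move=> bF; rewrite (_ : (fun x => _) =
    fun x => \prod_(i <- s | (i \in s) && p i) F i x); last first.
  by apply/funext => x; rewrite big_seq_cond.
by apply: bounded_rv_prod => i /andP[]; exact: bF.
Qed.

Lemma block_rv_norm S f : brv S f -> brv S (fun x => `|f x|).
Proof. exact: bounded_rv_norm. Qed.

Lemma block_rv_ratio S f g (M : R) : brv S f -> brv S g ->
  (forall x, `|f x / g x * (0 < g x)%R%:R| <= M) ->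
  brv S (fun x => f x / g x * (0 < g x)%R%:R).
Proof.
move=> [mf _] [mg _] fgM; split; last by exists M.
exact: measurable_fun_ratio.
Qed.

Lemma block_rv_le S f g : brv S f -> brv S g ->
  brv S (fun x => (f x <= g x)%R%:R).
Proof. by move=> [mf _] [mg _]; exact/bounded_rv_bool/measurable_fun_ler. Qed.

End BlockClosure.

Section BlockMoments.
Context d (T : measurableType d) (R : realType) (P : probability T R).
Context (I : finType) (G : I -> set (set T)) (GI : independent_blocks P G).
Local Notation brv := (block_rv G).
Implicit Types (S : pred I) (f g : T -> R).

(** For 0 <= X <= H the quadratic term of e^(lam X) is at most a multiple of
    lam^2 H X, so it is controlled by the mean of X. *)
Lemma Ex_mgf_small (X : T -> R) (H lam : R) : bounded_rv X ->
  (forall x, 0 <= X x <= H) -> `|lam| * H <= 2^-1 ->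
  Ex P (fun x => expR (lam * X x)) <=
    expR (lam * Ex P X + 2 * lam ^+ 2 * H * Ex P X).
Proof.
move=> bX X0H lamH; set c := lam + 2 * lam ^+ 2 * H.
apply: (@le_trans _ _ (Ex P (fun x => 1 + c * X x))).
  apply: le_Ex.
  - exact/bounded_rv_exp/bounded_rvZ.
  - exact: (bounded_rvD (bounded_rv_cst _ 1) (bounded_rvZ c bX)).
  move=> x; have /andP[X0 XH] := X0H x.
  have lX : lam * X x <= 2^-1.
    apply: le_trans lamH; apply: le_trans (ler_norm _) _.
    by rewrite normrM (ger0_norm X0) ler_wpM2l.
  apply: le_trans (expR_le_quadratic lX) _.
  have : 0 <= lam ^+ 2 * (X x * (H - X x)).
    by apply: mulr_ge0; [exact: sqr_ge0|apply: mulr_ge0; rewrite ?subr_ge0].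
  by rewrite /c; lra.
rewrite (ExD P (bounded_rv_cst _ 1) (bounded_rvZ c bX)) Ex_cst ExZ//.
by apply: le_trans (expR_ge1Dx _) _; rewrite /c mulrDl.
Qed.

(** A Bernstein bound with the mean of the sum in place of its variance.  This
    matters for sparse graphs: the total weight of a vertex has mean of order
    theta although it has n summands. *)
Lemma Ex_mgf_block_sum (J : eqType) (s : seq J) (S : J -> pred I)
    (X : J -> T -> R) (H lam mu : R) : uniq s ->
  (forall i j b, i \in s -> j \in s -> S i b -> S j b -> i = j) ->
  (forall j, brv (S j) (X j)) -> (forall j x, 0 <= X j x <= H) ->
  `|lam| * H <= 2^-1 ->
  mu = \sum_(j <- s) Ex P (X j) ->
  Ex P (fun x => expR (lam * (\sum_(j <- s) X j x - mu))) <=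
    expR (2 * lam ^+ 2 * H * mu).
Proof.
move=> us dS bX X0H lamH muE.
have bX' j : bounded_rv (X j) by exact: (block_rvW GI (bX j)).
have -> : (fun x => expR (lam * (\sum_(j <- s) X j x - mu))) =
    fun x => expR (- (lam * mu)) * \prod_(j <- s) expR (lam * X j x).
  apply/funext => x; rewrite -expR_big_sum -expRD; congr expR.
  by rewrite -mulr_sumr; ring.
rewrite ExZ; last first.
  by apply: bounded_rv_prod => j _; exact/bounded_rv_exp/bounded_rvZ.
rewrite (Ex_block_prod GI us dS); last first.
  by move=> j _; apply: bounded_rv_exp; apply: bounded_rvZ; exact: bX.
apply: (@le_trans _ _ (expR (- (lam * mu)) *
    \prod_(j <- s) expR (lam * Ex P (X j) + 2 * lam ^+ 2 * H * Ex P (X j)))).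
  rewrite ler_pM2l ?expR_gt0//; apply: ler_prod => j _; apply/andP; split.
    by apply: Ex_ge0 => x; exact: expR_ge0.
  exact: Ex_mgf_small.
rewrite -expR_big_sum -expRD ler_expR big_split/= -!mulr_sumr -muE.
by lra.
Qed.

(** The coefficients [q j] are random but live on blocks [S0] disjoint from
    those of the centred [Y j].  Each factor e^t is bounded by (1 + 2 t^2) + t
    with t = lam q_j Y_j, and t^2 by a quantity measurable for [S0]; when the
    product is expanded, every term containing some Y_j has mean zero.  The rest
    is at most exp(2 lam^2 L^2 sum q_j^2). *)
Lemma Ex_mgf_centered (J : eqType) (s : seq J) (S0 : pred I) (S : J -> pred I)
    (q Y : J -> T -> R) (L c0 v lam : R) : uniq s ->
  (forall i j b, i \in s -> j \in s -> S i b -> S j b -> i = j) ->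
  (forall j b, j \in s -> S0 b -> ~~ S j b) ->
  (forall j, brv S0 (q j)) -> (forall j, brv (S j) (Y j)) ->
  (forall j x, `|q j x| <= c0) -> (forall j x, `|Y j x| <= L) ->
  (forall j, Ex P (Y j) = 0) ->
  `|lam| * c0 * L <= 2^-1 ->
  (forall x, \sum_(j <- s) q j x ^+ 2 <= v) ->
  Ex P (fun x => expR (lam * \sum_(j <- s) q j x * Y j x)) <=
    expR (2 * lam ^+ 2 * L ^+ 2 * v).
Proof.
move=> us dS dS0 bq bY qc YL EY lcL qv.
pose A j x := 1 + 2 * (lam * q j x * L) ^+ 2.
have bA j : brv S0 (A j).
  apply: block_rvD; first exact: block_rv_cst.
  apply: block_rvZ.
  have bqL : brv S0 (fun x => (lam * q j x * L)).
    by apply: block_rvM; [apply: block_rvZ|exact: block_rv_cst].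
  by under eq_fun do rewrite expr2; exact: (block_rvM bqL bqL).
pose F j x := A j x + lam * q j x * Y j x.
have bF j (S' : pred I) : (forall b, S0 b || S j b -> S' b) -> brv S' (F j).
  move=> SS'; apply: block_rvD.
    by apply: (block_rv_sub GI _ (bA j)) => b Sb; apply: SS'; rewrite [S0 b]Sb.
  apply: block_rvM; first apply: block_rvZ.
    by apply: (block_rv_sub GI _ (bq j)) => b Sb; apply: SS'; rewrite [S0 b]Sb.
  by apply: (block_rv_sub GI _ (bY j)) => b Sb; apply: SS'; rewrite [S j b]Sb orbT.
(* the factors containing some Y_j average out one at a time; g collects
   the coefficients already processed *)
have expand (s' : seq J) (g : T -> R) : uniq s' -> {subset s' <= s} -> brv S0 g ->
    Ex P (fun x => g x * \prod_(j <- s') F j x) =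
    Ex P (fun x => g x * \prod_(j <- s') A j x).
  elim: s' g => [|j s' IH] g; first by move=> _ _ _; under eq_Ex do rewrite !big_nil;
      under [RHS]eq_Ex do rewrite !big_nil.
  move=> /= /andP[js' us'] ss bg.
  have sj : j \in s by apply: ss; rewrite inE eqxx.
  have ss' : {subset s' <= s} by move=> k ks; apply: ss; rewrite inE ks orbT.
  pose U : pred I := [pred b | S0 b || has (S^~ b) s'].
  have bprod : brv U (fun x => \prod_(k <- s') F k x).
    apply: block_rv_prod => k ks' _; apply: bF => b /orP[Sb|Sb]; rewrite /U/= ?Sb//.
    by apply/orP; right; apply/hasP; exists k.
  have S0U : {subset S0 <= U} by move=> b Sb; rewrite inE /U/= [S0 b]Sb.
  transitivity (Ex P (fun x => g x * A j x * \prod_(k <- s') F k x) +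
      Ex P (fun x => (Y j x) * (g x * (lam * q j x) * \prod_(k <- s') F k x))).
    rewrite -ExD.
    - by apply: eq_Ex => x; rewrite big_cons /F; ring.
    - apply: (block_rvW GI (S := U)); apply: block_rvM bprod.
      by apply: (block_rv_sub GI S0U); exact: block_rvM bg (bA j).
    - apply: (block_rvW GI (S := predT)).
      apply: block_rvM; first by exact: (block_rv_sub GI _ (bY j)).
      apply: block_rvM; last exact: (block_rv_sub GI _ bprod).
      apply: (block_rv_sub GI (S := S0)) => //.
      exact: block_rvM bg (block_rvZ lam (bq j)).
  rewrite [X in _ + X](Ex_block_mul GI (S := S j) (S' := U)) ?EY ?mul0r ?addr0.
  - rewrite (IH _ us' ss' (block_rvM bg (bA j))).
    by apply: eq_Ex => x; rewrite big_cons mulrA.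
  - move=> b Sjb; apply/negP => /orP[S0b|/hasP[k ks' Skb]].
      by have := dS0 j b sj S0b; rewrite Sjb.
    by move: js'; rewrite (dS j k b)// ?ss'// ks'.
  - exact: bY.
  - apply: block_rvM bprod.
    apply: (block_rv_sub GI S0U).
    exact: block_rvM bg (block_rvZ lam (bq j)).
have lq j x : `|lam * q j x * Y j x| <= 2^-1.
  apply: le_trans lcL; rewrite !normrM ler_pM ?mulr_ge0//.
  by rewrite ler_wpM2l.
apply: (@le_trans _ _ (Ex P (fun x => 1 * \prod_(j <- s) F j x))).
  apply: le_Ex.
  - apply: bounded_rv_exp; apply: bounded_rvZ; apply: bounded_rv_sum => j _.
    exact: bounded_rvM (block_rvW GI (bq j)) (block_rvW GI (bY j)).
  - apply: bounded_rvZ; apply: bounded_rv_prod => j _.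
    by apply: (block_rvW GI (S := predT)); exact: bF.
  move=> x; rewrite mul1r mulr_sumr expR_big_sum; apply: ler_prod => j _.
  rewrite expR_ge0/= /F /A mulrA.
  apply: le_trans (expR_le_quadratic _) _.
    exact: le_trans (ler_norm _) (lq j x).
  rewrite addrAC lerD2r lerD2l ler_wpM2l//.
  rewrite -[leLHS]real_normK ?num_real// -[leRHS]real_normK ?num_real//.
  rewrite lerXn2r ?nnegrE//.
  rewrite !normrM ler_wpM2l ?mulr_ge0//.
  exact: le_trans (YL j x) (ler_norm _).
rewrite (expand s (fun=> 1))//; last exact: bounded_rv_cst.
rewrite -[leRHS](Ex_cst P); apply: le_Ex.
- apply: bounded_rvZ; apply: bounded_rv_prod => j _; exact: (block_rvW GI (bA j)).
- exact: bounded_rv_cst.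
move=> x; rewrite mul1r.
apply: (@le_trans _ _ (\prod_(j <- s) expR (2 * (lam * q j x * L) ^+ 2))).
  apply: ler_prod => j _; rewrite expR_ge1Dx andbT /A.
  by rewrite addr_ge0// mulr_ge0// sqr_ge0.
rewrite -expR_big_sum ler_expR.
rewrite (eq_bigr (fun j => 2 * lam ^+ 2 * L ^+ 2 * q j x ^+ 2)); last first.
  by move=> j _; ring.
rewrite -mulr_sumr ler_wpM2l//.
by apply: mulr_ge0; [apply: mulr_ge0; rewrite ?sqr_ge0|exact: sqr_ge0].
Qed.

End BlockMoments.

(** * Weighted averages and error recursions on a random network *)

Ltac nonneg := repeat (first [done | exact: ltW | apply: addr_ge0 |
  apply: mulr_ge0 | apply: exprn_ge0 | rewrite invr_ge0]).

(** A weighted directed network under one probability law.  The block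
    [inl (i, j)] carries the weight that [i] gives to [j], the block [inr j] the
    own randomness of the vertex [j]; the row of [i] consists of its weights and
    its own randomness.  The scale of the total weights is [theta], and [rho] is
    the size of the relative fluctuations to be tolerated. *)
Section Network.
Context d (T : measurableType d) (R : realType) (P : probability T R).
Context (n K : nat) (lab : 'I_n -> 'I_K).
Notation I := ('I_n * 'I_n + 'I_n)%type.
Context (G : I -> set (set T)) (w : 'I_n -> 'I_n -> T -> R) (H : R).
Local Notation brv := (block_rv G).

Definition row_blocks (i : 'I_n) : pred I :=
  fun b => match b with inl p => p.1 == i | inr j => j == i end.

Definition community_weight i s x := \sum_(j | lab j == s) w i j x.
Definition total_weight i x := \sum_j w i j x.
Definition share i j x := w i j x / total_weight i x * (0 < total_weight i x)%R%:R.
Definition weight_mx i j x :=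
  w i j x / total_weight i x * ((0 < total_weight i x)%R && (i != j))%:R.
Definition mean_weight i s : R := Ex P (community_weight i s).
Definition mean_total i : R := \sum_s mean_weight i s.

Local Notation N := community_weight.
Local Notation Nt := total_weight.
Local Notation C := weight_mx.
Local Notation mu := mean_weight.
Local Notation mt := mean_total.

Hypothesis GI : independent_blocks P G.
Hypothesis w_block : forall i j, brv (pred1 (inl (i, j))) (w i j).
Hypothesis H_gt0 : 0 < H.
Hypothesis w_bnd : forall i j x, 0 <= w i j x <= H.

Lemma w_ge0 i j x : 0 <= w i j x. Proof. by case/andP: (w_bnd i j x). Qed.

Lemma bounded_w i j : bounded_rv (w i j).
Proof. exact: (block_rvW GI (w_block i j)). Qed.

Lemma w_row i j : brv (row_blocks i) (w i j).
Proof.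
apply: (block_rv_sub GI _ (w_block i j)) => b.
by move=> /eqP ->; rewrite unfold_in /= eqxx.
Qed.

Lemma community_weight_ge0 i s x : 0 <= N i s x.
Proof. by apply: sumr_ge0 => j _; exact: w_ge0. Qed.

Lemma total_weight_ge0 i x : 0 <= Nt i x.
Proof. by apply: sumr_ge0 => j _; exact: w_ge0. Qed.

Lemma total_weightE i x : Nt i x = \sum_s N i s x.
Proof. exact: (partition_big lab predT). Qed.

Lemma community_weight_row i s : brv (row_blocks i) (N i s).
Proof. by apply: block_rv_sum => j _ _; exact: w_row. Qed.

Lemma bounded_community_weight i s : bounded_rv (N i s).
Proof. exact: (block_rvW GI (community_weight_row i s)). Qed.

Lemma total_weight_row i : brv (row_blocks i) (Nt i).
Proof. by apply: block_rv_sum => j _ _; exact: w_row. Qed.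

Lemma mean_weight_ge0 i s : 0 <= mu i s.
Proof. by apply: Ex_ge0 => x; exact: community_weight_ge0. Qed.

Lemma share_ge0 i j x : 0 <= share i j x.
Proof.
by rewrite /share mulr_ge0// mulr_ge0 ?w_ge0// invr_ge0 total_weight_ge0.
Qed.

Lemma sum_share_le1 (p : pred 'I_n) i x : \sum_(j | p j) share i j x <= 1.
Proof.
rewrite /share; case: ltP => [N0|_]; last first.
  by rewrite big1// => j _; rewrite mulr0.
under eq_bigr do rewrite mulr1.
rewrite -mulr_suml ler_pdivrMr// mul1r /total_weight [leRHS](bigID p)/= lerDl.
by apply: sumr_ge0 => j _; exact: w_ge0.
Qed.

Lemma share_le1 i j x : share i j x <= 1.
Proof.
by have := sum_share_le1 (pred1 j) i x; rewrite big_pred1_eq.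
Qed.

Lemma share_row i j : brv (row_blocks i) (share i j).
Proof.
apply: (block_rv_ratio (M := 1)); [exact: w_row|exact: total_weight_row|].
by move=> x; rewrite ger0_norm ?share_ge0// share_le1.
Qed.

Lemma weight_mxE i j x : C i j x = share i j x * (i != j)%:R.
Proof.
rewrite /weight_mx /share.
by case: (0 < _); case: (i != j); rewrite ?(mulr1, mulr0).
Qed.

Lemma weight_mx_ge0 i j x : 0 <= C i j x.
Proof. by rewrite weight_mxE mulr_ge0// share_ge0. Qed.

Lemma weight_mx_le_share i j x : C i j x <= share i j x.
Proof. by rewrite weight_mxE ler_piMr ?share_ge0// lern1 leq_b1. Qed.

Lemma weight_mx_diag i x : C i i x = 0.
Proof. by rewrite weight_mxE eqxx mulr0. Qed.

Lemma sum_weight_mx_le1 (p : pred 'I_n) i x : \sum_(j | p j) C i j x <= 1.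
Proof.
apply: le_trans (sum_share_le1 p i x).
by apply: ler_sum => j _; exact: weight_mx_le_share.
Qed.

Lemma weight_mx_row i j : brv (row_blocks i) (C i j).
Proof.
rewrite (_ : C i j = fun x => share i j x * (i != j)%:R); last first.
  by apply/funext => x; rewrite weight_mxE.
by apply: block_rvM; [exact: share_row|exact: block_rv_cst].
Qed.

Lemma sum_share_community i s x :
  \sum_(j | lab j == s) share i j x = N i s x / Nt i x * (0 < Nt i x)%R%:R.
Proof. by rewrite /share -mulr_suml -mulr_suml. Qed.

(** Since a/N0 lies in [0, 1], replacing the denominator N0 by m0 costs at most
    |N0 - m0| / m0.  No lower bound on the random total N0 is assumed, so that no
    event has to be excluded. *)
Lemma ratio_deviation (a N0 al m0 : R) : 0 <= a <= N0 -> 0 <= al <= m0 -> 0 < m0 ->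
  `|a / N0 * (0 < N0)%R%:R - al / m0| <= (`|N0 - m0| + `|a - al|) / m0.
Proof.
move=> /andP[a0 aN] /andP[al0 alm] m00.
rewrite ler_pdivlMr// -[X in _ * X](gtr0_norm m00) -normrM mulrBl.
rewrite -[al / m0 * m0]mulrA mulVf ?gt_eqF// mulr1.
case: (ltrP 0 N0) => [N00|N00]; last first.
  have -> : N0 = 0 by apply/eqP; rewrite eq_le N00 (le_trans a0 aN).
  rewrite mulr0 mul0r !sub0r !normrN (ger0_norm al0) (gtr0_norm m00).
  by rewrite (le_trans alm)// lerDl.
rewrite mulr1 (_ : _ - al = a / N0 * (m0 - N0) + (a - al)); last first.
  by field; rewrite gt_eqF.
apply: le_trans (ler_normD _ _) _; rewrite lerD2r normrM distrC.
rewrite ler_piMl// ger0_norm ?divr_ge0//; last exact: le_trans a0 aN.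
by rewrite ler_pdivrMr// mul1r.
Qed.

Context (theta mu0 b gamma rho : R) (m : 'I_K -> 'I_K -> R) (act : pred 'I_K).
Hypothesis theta_gt0 : 0 < theta.
Hypothesis mu0_gt0 : 0 < mu0.
Hypothesis b_ge0 : 0 <= b.
Hypothesis gamma_ge0 : 0 <= gamma.
Hypothesis inactive_w : forall i j x, ~~ act (lab i) -> w i j x = 0.
Hypothesis inactive_m : forall r s, ~~ act r -> m r s = 0.
Hypothesis active_total : forall i, act (lab i) -> theta * mu0 <= mt i.
Hypothesis active_ratio : forall i s, act (lab i) ->
  `|mu i s / mt i - m (lab i) s| <= gamma.
Hypothesis mean_weight_le : forall i s, mu i s <= theta * b.
Hypothesis rho_gt0 : 0 < rho.
Hypothesis rho_H : rho * H <= 2^-1.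
Hypothesis rho_theta : 2^-1 <= rho ^+ 2 * theta.

(** Total deviation of the community weights from their means, at the scale
    theta: every error of the averaging is controlled by it. *)
Definition dev i x := (\sum_s `|N i s x - mu i s|) / theta.

Lemma dev_ge0 i x : 0 <= dev i x.
Proof. by apply: divr_ge0; [exact: sumr_ge0|exact: ltW]. Qed.

Lemma bounded_dev i : bounded_rv (dev i).
Proof.
rewrite /dev; under eq_fun do rewrite mulrC.
apply: bounded_rvZ; apply: bounded_rv_sum => s _; apply: bounded_rv_norm.
by apply: bounded_rvB; [exact: bounded_community_weight|exact: bounded_rv_cst].
Qed.

Definition cdev : R := K%:R * (5 + 2 * H * b).

Lemma cdev_ge0 : 0 <= cdev.
Proof. by rewrite /cdev mulr_ge0// addr_ge0// !mulr_ge0// ltW. Qed.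

Lemma H_theta : H / theta <= rho.
Proof.
rewrite ler_pdivrMr//.
have h1 : H <= H * (2 * (rho ^+ 2 * theta)).
  rewrite ler_peMr ?(ltW H_gt0)//; have := rho_theta; lra.
apply: le_trans h1 _; have h2 : 0 <= (2^-1 - rho * H) * (rho * theta).
  by rewrite mulr_ge0 ?subr_ge0// mulr_ge0 ?ltW.
by lra.
Qed.

Lemma mgf_community_weight i s (lam : R) : `|lam| = rho ->
  Ex P (fun x => expR (lam * (N i s x - mu i s))) <=
    expR (2 * rho ^+ 2 * H * (theta * b)).
Proof.
move=> lamE; pose sq := [seq j <- index_enum 'I_n | lab j == s].
have NE x : N i s x = \sum_(j <- sq) w i j x by rewrite big_filter.
have muE : mu i s = \sum_(j <- sq) Ex P (w i j).
  rewrite big_filter /mean_weight /community_weight Ex_sum//.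
  by move=> j _; exact: bounded_w.
under eq_Ex do rewrite NE.
apply: le_trans (Ex_mgf_block_sum (S := fun j => pred1 (inl (i, j))) (H := H) GI
  _ _ _ _ _ muE) _ => //.
- by rewrite filter_uniq// index_enum_uniq.
- by move=> j k c _ _ /eqP -> /eqP[].
- by rewrite lamE.
rewrite ler_expR -(real_normK (num_real lam)) lamE ler_wpM2l//.
by rewrite !mulr_ge0// ?sqr_ge0 ?ltW.
Qed.

(** The maximal inequality at parameter rho: the exponential moments of
    [mgf_community_weight] are of order rho^2 theta, and so is ln #|D|, hence
    the maximum is of order rho theta before scaling. *)
Lemma Ex_max_dev (D : pred 'I_n) : (0 < #|D|)%N ->
  ln #|D|%:R <= rho ^+ 2 * theta ->
  Ex P (fun x => \big[Num.max/0]_(i | D i) dev i x) <= cdev * rho.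
Proof.
move=> D0 Dln.
have bX i s : bounded_rv (fun x => N i s x - mu i s).
  by apply: bounded_rvB; [exact: bounded_community_weight|exact: bounded_rv_cst].
have bmx s : bounded_rv (fun x => \big[Num.max/0]_(i | D i) `|N i s x - mu i s|).
  by apply: bounded_rv_bigmax => i _; exact: bounded_rv_norm.
apply: (@le_trans _ _ (Ex P (fun x => theta^-1 * \sum_s
    \big[Num.max/0]_(i | D i) `|N i s x - mu i s|))).
  apply: le_Ex.
  - by apply: bounded_rv_bigmax => i _; exact: bounded_dev.
  - by apply: bounded_rvZ; exact: bounded_rv_sum.
  move=> x; apply: bigmax_le.
    rewrite mulr_ge0 ?invr_ge0 ?(ltW theta_gt0)// sumr_ge0// => s _.
    exact: bigmax_ge_id.
  move=> i Di; rewrite /dev mulrC ler_wpM2l ?invr_ge0 ?(ltW theta_gt0)//.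
  apply: ler_sum => s _.
  exact: (le_bigmax_cond 0 (fun i => `|N i s x - mu i s|)).
rewrite ExZ; last exact: bounded_rv_sum.
rewrite Ex_sum// ler_pdivrMl//.
apply: (@le_trans _ _ (\sum_(s < K)
   (rho ^+ 2 * theta + 2 * rho ^+ 2 * H * (theta * b) + 2) / rho)).
  apply: ler_sum => s _; apply: Ex_max_subgaussian => //.
  - by move=> i _; apply: mgf_community_weight; rewrite gtr0_norm.
  - by move=> i _; apply: mgf_community_weight; rewrite normrN gtr0_norm.
rewrite sumr_const card_ord -[leLHS]mulr_natl.
have -> : theta * (cdev * rho) = K%:R * (theta * (5 + 2 * H * b) * rho).
  by rewrite /cdev; ring.
rewrite ler_wpM2l// ler_pdivrMr//; have := rho_theta; lra.
Qed.

Lemma Ex_max_le_dev (D : pred 'I_n) (f : 'I_n -> T -> R) (A B : R) :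
  (0 < #|D|)%N -> ln #|D|%:R <= rho ^+ 2 * theta ->
  (forall i, bounded_rv (f i)) -> 0 <= A -> 0 <= B ->
  (forall i x, f i x <= A + B * dev i x) ->
  Ex P (fun x => \big[Num.max/0]_(i | D i) f i x) <= A + B * (cdev * rho).
Proof.
move=> D0 Dln bf A0 B0 fAB.
have bmd : bounded_rv (fun x => \big[Num.max/0]_(i | D i) dev i x).
  by apply: bounded_rv_bigmax => i _; exact: bounded_dev.
apply: (@le_trans _ _ (Ex P (fun x =>
    A + B * \big[Num.max/0]_(i | D i) dev i x))).
  apply: le_Ex.
  - by apply: bounded_rv_bigmax.
  - exact: (bounded_rvD (bounded_rv_cst _ A) (bounded_rvZ B bmd)).
  move=> x; apply: bigmax_le.
    by rewrite addr_ge0// mulr_ge0// bigmax_ge_id.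
  move=> i Di; apply: le_trans (fAB i x) _; rewrite lerD2l ler_wpM2l//.
  exact: (le_bigmax_cond 0 (dev^~ x)).
rewrite (ExD P (bounded_rv_cst _ A) (bounded_rvZ B bmd)) Ex_cst ExZ//.
by rewrite lerD2l ler_wpM2l//; exact: Ex_max_dev.
Qed.

Lemma total_dev i x : `|Nt i x - mt i| <= theta * dev i x.
Proof.
rewrite /dev mulrCA divff ?gt_eqF// mulr1 total_weightE /mean_total -sumrB.
exact: ler_norm_sum.
Qed.

(** A total below half of its mean is itself a deviation of order one, so its
    indicator is bounded by a multiple of [dev], whose mean is of order rho. *)
Lemma small_total_dev i x : act (lab i) -> 2 * Nt i x < mt i ->
  1 <= 2 * dev i x / mu0.
Proof.
move=> ai Nsmall; rewrite ler_pdivlMr// mul1r.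
have /ler_normlP[h _] := total_dev i x; have hm := active_total ai.
by rewrite -(ler_pM2l theta_gt0); lra.
Qed.

Lemma share_le_mean i j x : act (lab i) -> mt i <= 2 * Nt i x ->
  share i j x <= 2 * H / (theta * mu0).
Proof.
move=> ai Nbig; have hm := active_total ai.
have tm0 : 0 < theta * mu0 by rewrite mulr_gt0.
have N0 : 0 < Nt i x by lra.
rewrite /share N0 mulr1 ler_pdivrMr// mulrAC ler_pdivlMr//.
have /andP[wi0 wH] := w_bnd i j x.
apply: (@le_trans _ _ (H * (theta * mu0))); first by rewrite ler_wpM2r// ltW.
have : 0 <= H * (2 * Nt i x - theta * mu0).
  by apply: mulr_ge0; [exact: ltW|lra].
by lra.
Qed.

Lemma share_dev i j x : share i j x <= 2 * rho / mu0 + 2 / mu0 * dev i x.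
Proof.
have rd : 0 <= 2 * rho / mu0 by rewrite divr_ge0 ?mulr_ge0// ltW.
have dd : 0 <= 2 / mu0 * dev i x by rewrite mulr_ge0 ?dev_ge0// divr_ge0// ltW.
have [ai|ai] := boolP (act (lab i)); last first.
  by rewrite /share inactive_w// !mul0r addr_ge0.
case: (lerP (mt i) (2 * Nt i x)) => [Nbig|Nsmall].
  rewrite -[leLHS]addr0 lerD//; apply: le_trans (share_le_mean j ai Nbig) _.
  rewrite (_ : 2 * H / _ = 2 * (H / theta) / mu0); last first.
    by field; rewrite !gt_eqF.
  by rewrite ler_pM2r ?invr_gt0// ler_pM2l// H_theta.
rewrite -[leLHS]add0r lerD//; apply: le_trans (share_le1 i j x) _.
by rewrite mulrAC; exact: small_total_dev.
Qed.

(** A single vertex is a set of vertices with ln #|D| = 0. *)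
Lemma Ex_single (f : 'I_n -> T -> R) (B : R) i : (forall k, bounded_rv (f k)) ->
  (forall D : pred 'I_n, (0 < #|D|)%N -> ln #|D|%:R <= rho ^+ 2 * theta ->
     Ex P (fun x => \big[Num.max/0]_(k | D k) f k x) <= B) ->
  Ex P (f i) <= B.
Proof.
move=> bf fB; apply: le_trans (fB (pred1 i) _ _); rewrite ?card1//.
  apply: le_Ex => // [|x]; first exact: bounded_rv_bigmax.
  by apply: (le_bigmax_cond 0 (f^~ x)); exact: eqxx.
by rewrite ln1 mulr_ge0 ?sqr_ge0// ltW.
Qed.

Lemma Ex_dev i : Ex P (dev i) <= cdev * rho.
Proof. by apply: (Ex_single _ bounded_dev) => D; exact: Ex_max_dev. Qed.

(** A given neighbour receives a share of order rho only; this makes a return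
    of the walk to a visited vertex unlikely. *)
Lemma Ex_weight_mx i j : Ex P (C i j) <= 2 * (1 + cdev) / mu0 * rho.
Proof.
have bd := bounded_dev i; have bCij := block_rvW GI (weight_mx_row i j).
apply: (@le_trans _ _ (Ex P (fun x => 2 * rho / mu0 + 2 / mu0 * dev i x))).
  apply: le_Ex => //.
    exact: (bounded_rvD (bounded_rv_cst _ _) (bounded_rvZ _ bd)).
  by move=> x; apply: le_trans (weight_mx_le_share i j x) (share_dev i j x).
rewrite (ExD P (bounded_rv_cst _ _) (bounded_rvZ _ bd)) Ex_cst ExZ//.
have -> : 2 * (1 + cdev) / mu0 * rho = 2 * rho / mu0 + 2 / mu0 * (cdev * rho).
  by field; rewrite gt_eqF.
by rewrite lerD2l ler_wpM2l ?divr_ge0 ?(ltW mu0_gt0)//; exact: Ex_dev.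
Qed.

Lemma community_ratio_dev i s x : act (lab i) ->
  `|N i s x / Nt i x * (0 < Nt i x)%R%:R - mu i s / mt i| <= 2 / mu0 * dev i x.
Proof.
move=> ai; have mt0 : 0 < mt i.
  by apply: lt_le_trans (active_total ai); rewrite mulr_gt0.
have hN : 0 <= N i s x <= Nt i x.
  rewrite community_weight_ge0/= total_weightE (bigD1 s)//= lerDl.
  by apply: sumr_ge0 => r _; exact: community_weight_ge0.
have hmu : 0 <= mu i s <= mt i.
  rewrite mean_weight_ge0/= /mean_total (bigD1 s)//= lerDl.
  by apply: sumr_ge0 => r _; exact: mean_weight_ge0.
apply: le_trans (ratio_deviation hN hmu mt0) _.
have hs : `|N i s x - mu i s| <= theta * dev i x.
  rewrite /dev mulrCA divff ?gt_eqF// mulr1 (bigD1 s)//= lerDl.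
  exact: sumr_ge0.
rewrite ler_pdivrMr//.
apply: (@le_trans _ _ (2 * (theta * dev i x))).
  by have := total_dev i x; lra.
rewrite (_ : 2 / mu0 * dev i x * mt i = 2 * (mt i / mu0 * dev i x)); last first.
  by field; rewrite gt_eqF.
rewrite ler_wpM2l// ler_wpM2r ?dev_ge0// ler_pdivlMr//; exact: active_total.
Qed.

(** The average of a function of the community differs from its mean-field
    value by the deviations of the community shares, and by the share of the
    missing diagonal entry, which is of order rho. *)
Lemma averaging_error (y : 'I_K -> R) (L : R) i x : (forall s, `|y s| <= L) ->
  `|\sum_j C i j x * y (lab j) - \sum_s m (lab i) s * y s| <=
    L * (K%:R * gamma + 2 / mu0 * rho) + L * (2 / mu0 * (K%:R + 1)) * dev i x.
Proof.
move=> yL; have L0 : 0 <= L.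
  by have s := lab i; apply: le_trans (yL s); exact: normr_ge0.
have dev0 := dev_ge0 i x.
have m20 : 0 <= 2 / mu0 by rewrite divr_ge0// ltW.
have [ai|ai] := boolP (act (lab i)); last first.
  rewrite !big1 ?subrr ?normr0.
  - have K0 : 0 <= K%:R :> R by [].
    by nonneg.
  - by move=> s _; rewrite inactive_m// mul0r.
  - by move=> j _; rewrite weight_mxE /share inactive_w// !mul0r.
have -> : \sum_j C i j x * y (lab j) =
    \sum_s N i s x / Nt i x * (0 < Nt i x)%R%:R * y s - share i i x * y (lab i).
  have -> : \sum_s N i s x / Nt i x * (0 < Nt i x)%R%:R * y s =
            \sum_j share i j x * y (lab j).
    rewrite [RHS](partition_big lab predT)//=; apply: eq_bigr => s _.
    by rewrite -sum_share_community mulr_suml; apply: eq_bigr => j /eqP ->.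
  rewrite [RHS]addrC (bigD1 i)//= [in RHS](bigD1 i)//= weight_mx_diag mul0r add0r.
  rewrite addKr; apply: eq_bigr => j ji.
  by rewrite weight_mxE eq_sym ji mulr1.
rewrite addrAC -sumrB; apply: le_trans (ler_normB _ _) _.
rewrite (_ : L * _ + _ = K%:R * (L * (2 / mu0 * dev i x + gamma)) +
   L * (2 * rho / mu0 + 2 / mu0 * dev i x)); last by field; rewrite gt_eqF.
apply: lerD.
  rewrite -[K in leRHS]card_ord mulr_natl -sumr_const.
  apply: le_trans (ler_norm_sum _ _ _) _; apply: ler_sum => s _.
  rewrite -mulrBl normrM mulrC ler_pM//.
  rewrite -[X in X - m _ _](subrK (mu i s / mt i)) -addrA.
  by apply: le_trans (ler_normD _ _) _; rewrite lerD ?community_ratio_dev ?active_ratio.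
rewrite normrM mulrC ler_pM// ger0_norm ?share_ge0//; exact: share_dev.
Qed.

Lemma Ex_max_averaging (D : pred 'I_n) (y : 'I_K -> R) (L : R) :
  (0 < #|D|)%N -> ln #|D|%:R <= rho ^+ 2 * theta -> 0 <= L ->
  (forall s, `|y s| <= L) ->
  Ex P (fun x => \big[Num.max/0]_(i | D i)
     `|\sum_j C i j x * y (lab j) - \sum_s m (lab i) s * y s|) <=
  L * (K%:R * gamma + 2 / mu0 * rho) + L * (2 / mu0 * (K%:R + 1)) * (cdev * rho).
Proof.
move=> D0 Dln L0 yL.
have m20 : 0 <= 2 / mu0 by rewrite divr_ge0// ltW.
apply: Ex_max_le_dev => //.
- move=> i; apply: bounded_rv_norm; apply: bounded_rvB; last exact: bounded_rv_cst.
  apply: bounded_rv_sum => j _; apply: (block_rvW GI (S := row_blocks i)).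
  by apply: block_rvM; [exact: weight_mx_row|exact: block_rv_cst].
- by nonneg.
- by nonneg.
- by move=> i x; exact: averaging_error.
Qed.

Lemma row_blocks_inj i j (c : I) : row_blocks i c -> row_blocks j c -> i = j.
Proof. by case: c => [p|k] /= /eqP -> /eqP. Qed.

(** Given the row of [i], the sum over the neighbours is a combination of
    independent centred variables: the row of [i] is disjoint from the rows of
    its neighbours, the diagonal coefficient being zero.  When the total weight
    exceeds half of its mean, the coefficients are of order 1/theta and sum to at
    most 1, and [Ex_mgf_centered] applies; otherwise [small_total_dev] does. *)
Lemma Ex_max_noise (D : pred 'I_n) (Y : 'I_n -> T -> R) (L : R) :
  (0 < #|D|)%N -> ln #|D|%:R <= rho ^+ 2 * theta -> 0 <= L ->
  4 * H * L * rho <= mu0 ->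
  (forall j, brv (row_blocks j) (Y j)) -> (forall j x, `|Y j x| <= L) ->
  (forall j, Ex P (Y j) = 0) ->
  Ex P (fun x => \big[Num.max/0]_(i | D i) `|\sum_j C i j x * Y j x|) <=
  (5 + 4 * L ^+ 2 * H / mu0) * rho + L * (2 / mu0) * (cdev * rho).
Proof.
move=> D0 Dln L0 rho_small bY YL EY.
have m20 : 0 <= 2 / mu0 by rewrite divr_ge0// ltW.
have tm0 : 0 < theta * mu0 by rewrite mulr_gt0.
(* coefficients cut off on the event that the total weight is too small,
   which keeps them below c0 *)
pose big i x := (mt i <= 2 * Nt i x)%R%:R : R.
pose Ct i j x := C i j x * big i x.
pose c0 := 2 * H / (theta * mu0).
have c00 : 0 <= c0 by rewrite /c0 divr_ge0 ?mulr_ge0// ltW.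
have bbig i : brv (row_blocks i) (big i).
  by apply: block_rv_le; [exact: block_rv_cst|apply: block_rvZ; exact: total_weight_row].
have bCt i j : brv (row_blocks i) (Ct i j).
  by apply: block_rvM; [exact: weight_mx_row|exact: bbig].
have Ct0 i j x : 0 <= Ct i j x by rewrite mulr_ge0 ?weight_mx_ge0// ler0n.
have Ctc i j x : Ct i j x <= c0.
  have [ai|ai] := boolP (act (lab i)); last first.
    by rewrite /Ct weight_mxE /share inactive_w// !mul0r.
  rewrite /Ct /big; case: (lerP (mt i) (2 * Nt i x)) => [Nbig|_]; last by rewrite mulr0.
  by rewrite mulr1; apply: le_trans (weight_mx_le_share _ _ _) (share_le_mean _ ai Nbig).
pose X i x := \sum_(j | j != i) Ct i j x * Y j x.
have bXi i : bounded_rv (X i).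
  apply: bounded_rv_sum => j _.
  exact: bounded_rvM (block_rvW GI (bCt i j)) (block_rvW GI (bY j)).
have mgfX i lam : `|lam| = theta * rho -> Ex P (fun x => expR (lam * X i x)) <=
    expR (4 * rho ^+ 2 * theta * L ^+ 2 * H / mu0).
  move=> lamE.
  have XE x : X i x = \sum_(j <- [seq j <- index_enum 'I_n | j != i]) Ct i j x * Y j x.
    by rewrite big_filter.
  under eq_Ex do rewrite XE.
  apply: le_trans (Ex_mgf_centered (S0 := row_blocks i) (S := row_blocks)
     (L := L) (c0 := c0) (v := c0) GI _ _ _ _ _ _ _ _ _ _) _ => //.
  - by rewrite filter_uniq// index_enum_uniq.
  - by move=> j k c _ _; exact: row_blocks_inj.
  - move=> j c; rewrite mem_filter => /andP[ji _] ic; apply/negP => jc.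
    by move: ji; rewrite (row_blocks_inj ic jc) eqxx.
  - by move=> j x; rewrite ger0_norm.
  - rewrite lamE /c0 (_ : _ * _ * L = 2 * H * L * rho / mu0); last first.
      by field; rewrite !gt_eqF.
    by rewrite ler_pdivrMr//; lra.
  - move=> x; rewrite big_filter.
    apply: (@le_trans _ _ (\sum_(j | j != i) c0 * C i j x)).
      apply: ler_sum => j _; rewrite expr2 ler_pM//.
      by rewrite /Ct ler_piMr ?weight_mx_ge0// /big lern1 leq_b1.
    by rewrite -mulr_sumr ler_piMr// sum_weight_mx_le1.
  rewrite ler_expR -(real_normK (num_real lam)) lamE /c0 le_eqVlt.
  by apply/orP; left; apply/eqP; field; rewrite !gt_eqF.
have bmX : bounded_rv (fun x => \big[Num.max/0]_(i | D i) `|X i x|).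
  by apply: bounded_rv_bigmax => i _; exact: bounded_rv_norm.
have bmd : bounded_rv (fun x => \big[Num.max/0]_(i | D i) dev i x).
  by apply: bounded_rv_bigmax => i _; exact: bounded_dev.
have bCY i : bounded_rv (fun x => \sum_j C i j x * Y j x).
  apply: bounded_rv_sum => j _.
  exact: bounded_rvM (block_rvW GI (weight_mx_row i j)) (block_rvW GI (bY j)).
apply: (@le_trans _ _ (Ex P (fun x => \big[Num.max/0]_(i | D i) `|X i x| +
    L * (2 / mu0) * \big[Num.max/0]_(i | D i) dev i x))).
  apply: le_Ex.
  - by apply: bounded_rv_bigmax => i _; exact: bounded_rv_norm.
  - exact: (bounded_rvD bmX (bounded_rvZ _ bmd)).
  move=> x; apply: bigmax_le.
    by rewrite addr_ge0 ?bigmax_ge_id// mulr_ge0 ?bigmax_ge_id// mulr_ge0.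
  move=> i Di; apply: (@le_trans _ _ (`|X i x| + L * (2 / mu0) * dev i x)); last first.
    apply: lerD; first exact: (le_bigmax_cond 0 (fun i => `|X i x|)).
    apply: ler_wpM2l; [exact: mulr_ge0|exact: (le_bigmax_cond 0 (dev^~ x))].
  have CE : \sum_j C i j x * Y j x = X i x + (1 - big i x) * \sum_j C i j x * Y j x.
    have -> : X i x = big i x * \sum_j C i j x * Y j x.
      rewrite (bigD1 i)//= weight_mx_diag mul0r add0r mulr_sumr.
      by apply: eq_bigr => j _; rewrite /Ct; ring.
    by ring.
  rewrite CE; apply: le_trans (ler_normD _ _) _; rewrite lerD2l.
  have sumL : `|\sum_j C i j x * Y j x| <= L.
    apply: le_trans (ler_norm_sum _ _ _) _.
    apply: (@le_trans _ _ (\sum_j C i j x * L)).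
      by apply: ler_sum => j _; rewrite normrM ger0_norm ?weight_mx_ge0// ler_wpM2l ?weight_mx_ge0.
    by rewrite -mulr_suml ler_piMl// sum_weight_mx_le1.
  have [ai|ai] := boolP (act (lab i)); last first.
    rewrite big1 ?mulr0 ?normr0; first by have := dev_ge0 i x; nonneg.
    move=> j _.
    by rewrite weight_mxE /share inactive_w// !mul0r.
  rewrite /big; case: (lerP (mt i) (2 * Nt i x)) => [_|Nsmall].
    by rewrite subrr mul0r normr0; have := dev_ge0 i x; nonneg.
  rewrite subr0 mul1r; apply: le_trans sumL _; rewrite -mulrA ler_peMr//.
  by rewrite mulrAC; exact: small_total_dev.
rewrite (ExD P bmX (bounded_rvZ _ bmd)) ExZ//; apply: lerD; last first.
  by apply: ler_wpM2l; [exact: mulr_ge0|exact: Ex_max_dev].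
apply: le_trans (Ex_max_subgaussian (lam := theta * rho)
   (s := 4 * rho ^+ 2 * theta * L ^+ 2 * H / mu0) (tau := rho ^+ 2 * theta)
   _ D0 Dln _ _ _) _ => //.
- by rewrite mulr_gt0.
- by move=> i _; apply: mgfX; rewrite gtr0_norm ?mulr_gt0.
- by move=> i _; apply: mgfX; rewrite normrN gtr0_norm ?mulr_gt0.
rewrite ler_pdivrMr ?mulr_gt0//.
rewrite (_ : (5 + _) * _ * _ = 5 * (rho ^+ 2 * theta) +
    4 * rho ^+ 2 * theta * L ^+ 2 * H / mu0); last by field; rewrite gt_eqF.
by have := rho_theta; lra.
Qed.

Lemma Ex_averaging (y : 'I_K -> R) (L : R) i : 0 <= L -> (forall s, `|y s| <= L) ->
  Ex P (fun x => `|\sum_j C i j x * y (lab j) - \sum_s m (lab i) s * y s|) <=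
  L * (K%:R * gamma + 2 / mu0 * rho) + L * (2 / mu0 * (K%:R + 1)) * (cdev * rho).
Proof.
move=> L0 yL; apply: (Ex_single (f := fun i x =>
  `|\sum_j C i j x * y (lab j) - \sum_s m (lab i) s * y s|)) => [k|D D0 Dln].
  apply: bounded_rv_norm; apply: bounded_rvB; last exact: bounded_rv_cst.
  apply: bounded_rv_sum => j _; apply: (block_rvW GI (S := row_blocks k)).
  by apply: block_rvM; [exact: weight_mx_row|exact: block_rv_cst].
exact: Ex_max_averaging.
Qed.

Lemma Ex_noise (Y : 'I_n -> T -> R) (L : R) i : 0 <= L ->
  4 * H * L * rho <= mu0 ->
  (forall j, brv (row_blocks j) (Y j)) -> (forall j x, `|Y j x| <= L) ->
  (forall j, Ex P (Y j) = 0) ->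
  Ex P (fun x => `|\sum_j C i j x * Y j x|) <=
  (5 + 4 * L ^+ 2 * H / mu0) * rho + L * (2 / mu0) * (cdev * rho).
Proof.
move=> L0 rho_small bY YL EY.
apply: (Ex_single (f := fun i x => `|\sum_j C i j x * Y j x|)) => [k|D D0 Dln].
  apply: bounded_rv_norm; apply: bounded_rv_sum => j _.
  exact: bounded_rvM (block_rvW GI (weight_mx_row k j)) (block_rvW GI (bY j)).
exact: Ex_max_noise.
Qed.

Context (a c dd L : R) (Y : nat -> 'I_n -> T -> R) (y : nat -> 'I_K -> R)
  (Delta : nat -> 'I_n -> T -> R).
Hypothesis a_ge0 : 0 <= a.
Hypothesis c_ge0 : 0 <= c.
Hypothesis dd_gt0 : 0 < dd.
Hypothesis acdd : a + c + dd = 1.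
Hypothesis m_ge0 : forall r s, 0 <= m r s.
Hypothesis m_sum : forall r, \sum_s m r s <= 1.
Hypothesis L_ge0 : 0 <= L.
Hypothesis rho_small : 4 * H * L * rho <= mu0.
Hypothesis y_bnd : forall k s, `|y k s| <= L.
Hypothesis Y_row : forall k j, brv (row_blocks j) (Y k j).
Hypothesis Y_bnd : forall k j x, `|Y k j x| <= L.
Hypothesis Y_mean : forall k j, Ex P (Y k j) = 0.

Definition noise k i x := \sum_j C i j x * Y k j x.
Definition avg_error k i x :=
  \sum_j C i j x * y k (lab j) - \sum_s m (lab i) s * y k s.

Hypothesis Delta0 : forall i x, Delta 0 i x = 0.
Hypothesis DeltaS : forall k i x, Delta k.+1 i x =
  a * Delta k i x + c * \sum_j C i j x * Delta k j x +
  c * (noise k i x + avg_error k i x).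

Definition one_step_error : R :=
  (5 + 4 * L ^+ 2 * H / mu0) * rho + L * (2 / mu0) * (cdev * rho) +
  (L * (K%:R * gamma + 2 / mu0 * rho) + L * (2 / mu0 * (K%:R + 1)) * (cdev * rho)).

Lemma one_step_error_ge0 : 0 <= one_step_error.
Proof. by have h := cdev_ge0; rewrite /one_step_error; nonneg. Qed.

Lemma noise_bnd k i x : `|noise k i x| <= L.
Proof.
apply: le_trans (ler_norm_sum _ _ _) _.
apply: (@le_trans _ _ (\sum_j C i j x * L)).
  by apply: ler_sum => j _; rewrite normrM ger0_norm ?weight_mx_ge0// ler_wpM2l ?weight_mx_ge0.
by rewrite -mulr_suml ler_piMl// sum_weight_mx_le1.
Qed.

Lemma avg_error_bnd k i x : `|avg_error k i x| <= 2 * L.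
Proof.
apply: le_trans (ler_normB _ _) _; rewrite (_ : 2 * L = L + L); last by ring.
apply: lerD; apply: le_trans (ler_norm_sum _ _ _) _.
  apply: (@le_trans _ _ (\sum_j C i j x * L)).
    by apply: ler_sum => j _; rewrite normrM ger0_norm ?weight_mx_ge0// ler_wpM2l ?weight_mx_ge0.
  by rewrite -mulr_suml ler_piMl// sum_weight_mx_le1.
apply: (@le_trans _ _ (\sum_s m (lab i) s * L)).
  by apply: ler_sum => j _; rewrite normrM ger0_norm// ler_wpM2l.
by rewrite -mulr_suml ler_piMl// m_sum.
Qed.

Lemma weighted_average_le (f : 'I_n -> R) (B : R) i x : 0 <= B ->
  (forall j, `|f j| <= B) -> `|\sum_j C i j x * f j| <= B.
Proof.
move=> B0 fB; apply: le_trans (ler_norm_sum _ _ _) _.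
apply: (@le_trans _ _ (\sum_j C i j x * B)).
  by apply: ler_sum => j _; rewrite normrM ger0_norm ?weight_mx_ge0// ler_wpM2l ?weight_mx_ge0.
by rewrite -mulr_suml ler_piMl// sum_weight_mx_le1.
Qed.

Definition Delta_bound : R := 3 * L / dd.

Lemma Delta_bnd k i x : `|Delta k i x| <= Delta_bound.
Proof.
have B0 : 0 <= Delta_bound by rewrite /Delta_bound; nonneg.
elim: k i x => [|k IH] i x; first by rewrite Delta0 normr0.
rewrite DeltaS; apply: le_trans (ler_normD _ _) _.
have ddB : dd * Delta_bound = 3 * L.
  by rewrite /Delta_bound mulrCA divff ?mulr1// gt_eqF.
have c1 : c <= 1 by have := acdd; have := ltW dd_gt0; have := a_ge0; lra.
apply: (@le_trans _ _ (a * Delta_bound + c * Delta_bound + 3 * L)).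
  apply: lerD.
    apply: le_trans (ler_normD _ _) _; rewrite !normrM (ger0_norm a_ge0) (ger0_norm c_ge0).
    by apply: lerD; rewrite ler_wpM2l// weighted_average_le.
  rewrite normrM (ger0_norm c_ge0).
  apply: (@le_trans _ _ (1 * (L + 2 * L))); last by rewrite mul1r; lra.
  rewrite ler_pM//; apply: le_trans (ler_normD _ _) _.
  by rewrite lerD ?noise_bnd ?avg_error_bnd.
have -> : a = 1 - c - dd by have := acdd; lra.
by rewrite -ddB; lra.
Qed.

Lemma noise_rv k i : bounded_rv (noise k i).
Proof.
apply: bounded_rv_sum => j _.
exact: bounded_rvM (block_rvW GI (weight_mx_row i j)) (block_rvW GI (Y_row k j)).
Qed.

Lemma avg_error_row k i : brv (row_blocks i) (avg_error k i).
Proof.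
apply: block_rvB; last exact: block_rv_cst.
apply: block_rv_sum => j _ _.
by apply: block_rvM; [exact: weight_mx_row|exact: block_rv_cst].
Qed.

Lemma Delta_rv k i : bounded_rv (Delta k i).
Proof.
elim: k i => [|k IH] i.
  by rewrite (_ : Delta 0 i = fun=> 0); [exact: bounded_rv_cst|apply/funext].
rewrite (_ : Delta k.+1 i = fun x =>
  a * Delta k i x + c * \sum_j C i j x * Delta k j x +
  c * (noise k i x + avg_error k i x)); last by apply/funext.
apply: bounded_rvD; first apply: bounded_rvD.
- exact: bounded_rvZ.
- apply: bounded_rvZ; apply: bounded_rv_sum => j _.
  exact: bounded_rvM (block_rvW GI (weight_mx_row i j)) (IH j).
- apply: bounded_rvZ; apply: bounded_rvD; first exact: noise_rv.
  exact: (block_rvW GI (avg_error_row k i)).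
Qed.

(** In the sup norm the recursion contracts by a + c = 1 - dd, since the rows
    of the weight matrix sum to at most 1; a geometric series turns the error of
    one step into 1/dd of it, whatever the number of steps. *)
Theorem Ex_max_Delta k : (0 < n)%N -> ln n%:R <= rho ^+ 2 * theta ->
  Ex P (fun x => \big[Num.max/0]_i `|Delta k i x|) <= one_step_error / dd.
Proof.
move=> n0 nln.
have T0 : (0 < #|[pred _ : 'I_n | true]|)%N by rewrite card_ord.
have Tln : ln #|[pred _ : 'I_n | true]|%:R <= rho ^+ 2 * theta by rewrite card_ord.
pose mD k x := \big[Num.max/0]_i `|Delta k i x|.
pose mN k x := \big[Num.max/0]_i `|noise k i x|.
pose mA k x := \big[Num.max/0]_i `|avg_error k i x|.
have bD k' : bounded_rv (mD k').
  by apply: bounded_rv_bigmax => i _; apply: bounded_rv_norm; exact: Delta_rv.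
have bN k' : bounded_rv (mN k').
  by apply: bounded_rv_bigmax => i _; apply: bounded_rv_norm; exact: noise_rv.
have bA k' : bounded_rv (mA k').
  apply: bounded_rv_bigmax => i _; apply: bounded_rv_norm.
  exact: (block_rvW GI (avg_error_row k' i)).
have EN k' : Ex P (mN k') + Ex P (mA k') <= one_step_error.
  by apply: lerD; [exact: Ex_max_noise|exact: Ex_max_averaging].
rewrite -/(mD k); elim: k => [|k IH].
  rewrite (_ : mD 0 = fun=> 0).
    by rewrite Ex_cst divr_ge0 ?(ltW dd_gt0)//; exact: one_step_error_ge0.
  apply/funext => x; rewrite /mD big1_idem//= ?maxxx// => i _.
  by rewrite Delta0 normr0.
have c1 : c <= 1 by have := acdd; have := ltW dd_gt0; have := a_ge0; lra.
have bR : bounded_rv (fun x => (a + c) * mD k x + c * (mN k x + mA k x)).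
  by apply: bounded_rvD; apply: bounded_rvZ => //; apply: bounded_rvD.
apply: (@le_trans _ _ (Ex P (fun x => (a + c) * mD k x + c * (mN k x + mA k x)))).
  apply: le_Ex => // x.
  have mD0 k' : 0 <= mD k' x by exact: bigmax_ge_id.
  have mN0 k' : 0 <= mN k' x by exact: bigmax_ge_id.
  have mA0 k' : 0 <= mA k' x by exact: bigmax_ge_id.
  apply: bigmax_le.
    by have h1 := mD0 k; have h2 := mN0 k; have h3 := mA0 k; nonneg.
  move=> i _; rewrite DeltaS.
  apply: le_trans (ler_normD _ _) _; apply: lerD.
    apply: le_trans (ler_normD _ _) _.
    rewrite !normrM (ger0_norm a_ge0) (ger0_norm c_ge0) mulrDl.
    apply: lerD; rewrite ler_wpM2l//; first exact: (le_bigmax 0 (fun i => `|Delta k i x|)).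
    by apply: weighted_average_le => // j; exact: (le_bigmax 0 (fun i => `|Delta k i x|)).
  rewrite normrM (ger0_norm c_ge0) ler_wpM2l//.
  apply: le_trans (ler_normD _ _) _; apply: lerD.
    exact: (le_bigmax 0 (fun i => `|noise k i x|)).
  exact: (le_bigmax 0 (fun i => `|avg_error k i x|)).
rewrite (ExD P (bounded_rvZ _ (bD k)) (bounded_rvZ _ (bounded_rvD (bN k) (bA k)))).
rewrite (ExZ P _ (bD k)) (ExZ P _ (bounded_rvD (bN k) (bA k))) (ExD P (bN k) (bA k)).
apply: (@le_trans _ _ ((a + c) * (one_step_error / dd) + 1 * one_step_error)).
  apply: lerD; first by rewrite ler_wpM2l// addr_ge0.
  rewrite ler_pM// addr_ge0//; apply: Ex_ge0 => x; exact: bigmax_ge_id.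
have dde : dd * (one_step_error / dd) = one_step_error.
  by rewrite mulrCA divff ?mulr1// gt_eqF.
have -> : a + c = 1 - dd by have := acdd; lra.
by rewrite mulrBl dde; lra.
Qed.

(** For a single vertex the maximum over all vertices is too expensive, and the
    weights C_ij are not independent of the errors of the neighbours.  The
    recursion is read along a walk that starts at the vertex and steps to random
    neighbours; [A] is the set of vertices visited so far, and on a return to [A]
    the error is replaced by its deterministic bound.  Off [A] the process only
    uses rows of unvisited vertices, which restores the independence of C_ij
    and the later errors. *)
Fixpoint explored (A : {set 'I_n}) (k : nat) (i : 'I_n) (x : T) {struct k} : R :=
  if i \in A then Delta_bound else
  if k is k'.+1 then
    a * explored A k' i x + c * \sum_j C i j x * explored (i |: A) k' j x +
    c * (`|\sum_(j | j \notin A) C i j x * Y k' j x| +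
         L * \sum_(j in A) C i j x + `|avg_error k' i x|)
  else 0.

Lemma exploredS (A : {set 'I_n}) k i x : i \notin A -> explored A k.+1 i x =
    a * explored A k i x + c * \sum_j C i j x * explored (i |: A) k j x +
    c * (`|\sum_(j | j \notin A) C i j x * Y k j x| +
         L * \sum_(j in A) C i j x + `|avg_error k i x|).
Proof. by move=> iA /=; rewrite (negbTE iA). Qed.

Lemma explored_in (A : {set 'I_n}) k i x : i \in A -> explored A k i x = Delta_bound.
Proof. by case: k => [|k] /= ->. Qed.

Lemma Delta_le_explored (A : {set 'I_n}) k i x : `|Delta k i x| <= explored A k i x.
Proof.
elim: k A i => [|k IH] A i.
  have [iA|iA] := boolP (i \in A); first by rewrite explored_in// Delta_bnd.
  by rewrite Delta0 normr0 /= (negbTE iA).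
have [iA|iA] := boolP (i \in A); first by rewrite explored_in// Delta_bnd.
rewrite DeltaS exploredS//; apply: le_trans (ler_normD _ _) _; apply: lerD.
  apply: le_trans (ler_normD _ _) _.
  rewrite !normrM (ger0_norm a_ge0) (ger0_norm c_ge0).
  apply: lerD; rewrite ler_wpM2l//.
  apply: le_trans (ler_norm_sum _ _ _) _; apply: ler_sum => j _.
  by rewrite normrM ger0_norm ?weight_mx_ge0// ler_wpM2l ?weight_mx_ge0.
rewrite normrM (ger0_norm c_ge0) ler_wpM2l//.
apply: le_trans (ler_normD _ _) _; rewrite lerD2r.
rewrite /noise (bigID (fun j => j \in A))/= addrC.
apply: le_trans (ler_normD _ _) _; rewrite lerD2l.
apply: le_trans (ler_norm_sum _ _ _) _; rewrite mulr_sumr; apply: ler_sum => j _.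
by rewrite normrM ger0_norm ?weight_mx_ge0// mulrC ler_wpM2r ?weight_mx_ge0.
Qed.

Definition outside (A : {set 'I_n}) : pred I :=
  fun e => match e with inl p => p.1 \notin A | inr j => j \notin A end.

Lemma outside_sub (A B : {set 'I_n}) : A \subset B -> {subset outside B <= outside A}.
Proof. by move=> /fintype.subsetP AB [p|j]; rewrite !unfold_in; apply: contra => /AB. Qed.

Lemma row_outside (A : {set 'I_n}) i : i \notin A ->
  {subset row_blocks i <= outside A}.
Proof. by move=> iA [p|j]; rewrite !unfold_in => /eqP ->. Qed.

(** The point of the construction: no row of a visited vertex is used. *)
Lemma explored_outside (A : {set 'I_n}) k i : brv (outside A) (explored A k i).
Proof.
elim: k A i => [|k IH] A i.
  by rewrite /=; case: (i \in A); exact: block_rv_cst.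
have [iA|iA] := boolP (i \in A).
  rewrite (_ : explored A k.+1 i = fun=> Delta_bound); first exact: block_rv_cst.
  by apply/funext => x; rewrite explored_in.
rewrite (_ : explored A k.+1 i = fun x =>
    a * explored A k i x + c * \sum_j C i j x * explored (i |: A) k j x +
    c * (`|\sum_(j | j \notin A) C i j x * Y k j x| +
         L * \sum_(j in A) C i j x + `|avg_error k i x|)); last first.
  by apply/funext => x; rewrite exploredS.
have bC j : brv (outside A) (C i j).
  exact: (block_rv_sub GI (row_outside iA) (weight_mx_row i j)).
apply: block_rvD; [apply: block_rvD|]; apply: block_rvZ => //.
  apply: block_rv_sum => j _ _; apply: block_rvM; first exact: bC.
  by apply: (block_rv_sub GI _ (IH (i |: A) j)); apply: outside_sub; exact: finset.subsetUr.
apply: block_rvD; [apply: block_rvD|].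
- apply: block_rv_norm; apply: block_rv_sum => j _ jA.
  apply: block_rvM; first exact: bC.
  exact: (block_rv_sub GI (row_outside jA) (Y_row k j)).
- by apply: block_rvZ; apply: block_rv_sum => j _ _; exact: bC.
- apply: block_rv_norm.
  exact: (block_rv_sub GI (row_outside iA) (avg_error_row k i)).
Qed.

Definition return_error : R := 2 * (1 + cdev) / mu0 * rho.

(** Induction on the number of steps.  A step to a new vertex factors by
    independence and has total weight at most 1; returns have total mean weight
    at most [return_error] times #|A|.  The bound is affine in #|A| with a slope that the
    contraction reproduces although #|A| grows by one at each step. *)
Lemma Ex_explored (A : {set 'I_n}) k i : i \notin A -> Ex P (explored A k i) <=
  one_step_error / dd +
  return_error * ((Delta_bound + L) / dd * #|A|%:R + (Delta_bound + L) / dd / dd).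
Proof.
set g := one_step_error / dd; set al := (Delta_bound + L) / dd.
have cd0 := cdev_ge0; have ddle := ltW dd_gt0.
have B0 : 0 <= Delta_bound by rewrite /Delta_bound; nonneg.
have al0 : 0 <= al by rewrite /al; nonneg.
have eps0 : 0 <= return_error by rewrite /return_error; nonneg.
have g0 : 0 <= g by apply: divr_ge0 => //; exact: one_step_error_ge0.
have bC i' j' := block_rvW GI (weight_mx_row i' j').
have bE A' k' j' := block_rvW GI (explored_outside A' k' j').
elim: k A i => [|k IH] A i iA.
  rewrite (_ : explored A 0 i = fun=> 0); first by rewrite Ex_cst; nonneg.
  by apply/funext => x; rewrite /= (negbTE iA).
have bCE j : bounded_rv (fun x => C i j x * explored (i |: A) k j x).
  exact: bounded_rvM (bC i j) (bE _ _ _).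
pose nz x := `|\sum_(j | j \notin A) C i j x * Y k j x|.
pose cA x := \sum_(j in A) C i j x.
have bnz : bounded_rv nz.
  apply: bounded_rv_norm; apply: bounded_rv_sum => j _.
  exact: bounded_rvM (bC i j) (block_rvW GI (Y_row k j)).
have bcA : bounded_rv cA by apply: bounded_rv_sum => j _; exact: bC.
have bav : bounded_rv (fun x => `|avg_error k i x|).
  apply: bounded_rv_norm; exact: (block_rvW GI (avg_error_row k i)).
pose sE x := \sum_j C i j x * explored (i |: A) k j x.
have bsE : bounded_rv sE by apply: bounded_rv_sum => j _; exact: bCE.
pose last x := nz x + L * cA x + `|avg_error k i x|.
have blast : bounded_rv last.
  by apply: bounded_rvD => //; apply: bounded_rvD => //; exact: bounded_rvZ.
have -> : Ex P (explored A k.+1 i) =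
    a * Ex P (explored A k i) + c * Ex P sE + c * Ex P last.
  rewrite -!ExZ// -ExD; [|exact: bounded_rvZ..].
  rewrite -ExD; [|by apply: bounded_rvD; exact: bounded_rvZ|exact: bounded_rvZ].
  by apply: eq_Ex => x; rewrite exploredS.
have ECA : \sum_(j in A) Ex P (C i j) <= return_error * #|A|%:R.
  rewrite mulr_natr -sumr_const; apply: ler_sum => j _; exact: Ex_weight_mx.
have Elast : Ex P last <= one_step_error + L * (return_error * #|A|%:R).
  rewrite /last (ExD P _ bav); last by apply: bounded_rvD => //; exact: bounded_rvZ.
  rewrite (ExD P bnz (bounded_rvZ L bcA)) ExZ//.
  have en : Ex P nz <=
      (5 + 4 * L ^+ 2 * H / mu0) * rho + L * (2 / mu0) * (cdev * rho).
    (* the noise is truncated to the unvisited vertices by setting the other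
       fluctuations to zero *)
    pose Y' j x := if j \in A then 0 else Y k j x.
    have -> : nz = fun x => `|\sum_j C i j x * Y' j x|.
      apply/funext => x; rewrite /nz; congr `|_|.
      rewrite [RHS](bigID (fun j => j \notin A))/= [X in _ + X]big1 ?addr0.
        by apply: eq_bigr => j /negbTE jA; rewrite /Y' jA.
      by move=> j; rewrite negbK => jA; rewrite /Y' jA mulr0.
    apply: Ex_noise => //.
    - by move=> j; rewrite /Y'; case: (j \in A) => //; exact: block_rv_cst.
    - by move=> j x; rewrite /Y'; case: (j \in A); rewrite ?normr0.
    - by move=> j; rewrite /Y'; case: (j \in A) => //; exact: Ex_cst.
  have ea : Ex P (fun x => `|avg_error k i x|) <=
      L * (K%:R * gamma + 2 / mu0 * rho) + L * (2 / mu0 * (K%:R + 1)) * (cdev * rho).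
    exact: Ex_averaging.
  have ec : L * Ex P cA <= L * (return_error * #|A|%:R).
    by rewrite ler_wpM2l// /cA Ex_sum// => j _; exact: bC.
  by rewrite /one_step_error; lra.
pose G' := g + return_error * (al * (#|A|%:R + 1) + al / dd).
(* the neighbours split into visited ones, where the process is constant,
   and new ones, where the induction hypothesis applies to i |: A *)
have EsE : Ex P sE <= Delta_bound * (return_error * #|A|%:R) + G'.
  have G'0 : 0 <= G' by rewrite /G'; nonneg.
  rewrite /sE Ex_sum//; apply: (@le_trans _ _
      (\sum_(j in A) Delta_bound * Ex P (C i j) + \sum_(j | j \notin A) Ex P (C i j) * G')).
    rewrite (bigID (fun j => j \in A))/=; apply: lerD; apply: ler_sum => j jA.
      rewrite -ExZ//; apply: le_Ex => //; first exact: bounded_rvZ.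
      have jiA : j \in i |: A by rewrite !inE jA orbT.
      by move=> x; rewrite (explored_in _ _ jiA) [leLHS]mulrC lexx.
    have [->|ji] := eqVneq j i.
      rewrite (_ : (fun x => _) = fun=> 0); last first.
        by apply/funext => x; rewrite weight_mx_diag mul0r.
      rewrite Ex_cst mulr_ge0//; apply: Ex_ge0 => x; exact: weight_mx_ge0.
    rewrite (Ex_block_mul GI (S := row_blocks i) (S' := outside (i |: A))).
    - rewrite ler_wpM2l//; first by apply: Ex_ge0 => x; exact: weight_mx_ge0.
      have := IH (i |: A) j; rewrite !inE negb_or ji jA => /(_ isT) /le_trans; apply.
      by rewrite cardsU1 iA natrD /G' [1 + _]addrC lexx.
    - by move=> [p|j'] /= /eqP ->; rewrite negbK !inE eqxx.
    - exact: weight_mx_row.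
    - exact: explored_outside.
  rewrite -mulr_sumr -mulr_suml; apply: lerD; first by rewrite ler_wpM2l.
  rewrite ler_piMl//.
  have : Ex P (fun x => \sum_(j | j \notin A) C i j x) <= 1.
    rewrite -[leRHS](Ex_cst P 1); apply: le_Ex; [|exact: bounded_rv_cst|].
      by apply: bounded_rv_sum => j _; exact: bC.
    by move=> x; exact: sum_weight_mx_le1.
  by rewrite Ex_sum// => j _; exact: bC.
have c1 : c <= 1 by have := acdd; have := a_ge0; lra.
apply: (@le_trans _ _ (a * (g + return_error * (al * #|A|%:R + al / dd)) +
    c * (Delta_bound * (return_error * #|A|%:R) + G') +
    c * (one_step_error + L * (return_error * #|A|%:R)))).
  by apply: lerD; [apply: lerD|]; rewrite ler_wpM2l// IH.
have ge : dd * g = one_step_error by rewrite /g mulrCA divff ?mulr1// gt_eqF.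
have ale : dd * al = Delta_bound + L by rewrite /al mulrCA divff ?mulr1// gt_eqF.
have be : dd * (al / dd) = al by rewrite mulrCA divff ?mulr1// gt_eqF.
rewrite /G'; set A' : R := #|A|%:R; have A0 : 0 <= A' by rewrite /A' ler0n.
set be' := al / dd; rewrite -/be' in be.
have -> : a = 1 - c - dd by have := acdd; lra.
rewrite -ge.
have h1 : 0 <= (1 - c) * (dd * g) by rewrite ge; apply: mulr_ge0; [lra|exact: one_step_error_ge0].
have h2 : 0 <= (1 - c) * (return_error * (dd * al) * A').
  by apply: mulr_ge0; [lra|nonneg].
have h3 : 0 <= (1 - c) * (return_error * (dd * be')).
  by apply: mulr_ge0; [lra|rewrite be; nonneg].
have e2 : return_error * (dd * al) * A' = return_error * (Delta_bound + L) * A'.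
  by rewrite ale.
have e3 : return_error * (dd * be') = return_error * al by rewrite be.
have e4 : c * (return_error * (dd * al) * A') = c * (return_error * (Delta_bound + L) * A').
  by rewrite ale.
have e5 : c * (return_error * (dd * be')) = c * (return_error * al) by rewrite be.
by lra.
Qed.

Theorem Ex_Delta k i : Ex P (fun x => `|Delta k i x|) <=
  one_step_error / dd + return_error * ((Delta_bound + L) / dd / dd).
Proof.
have := @Ex_explored finset.set0 k i; rewrite inE cards0 mulr0 add0r => /(_ isT).
apply: le_trans; apply: le_Ex.
- by apply: bounded_rv_norm; exact: Delta_rv.
- exact: (block_rvW GI (explored_outside _ _ _)).
- by move=> x; exact: Delta_le_explored.
Qed.

End Network.

Section NetworkConstant.
Context (R : realType) (K : nat) (H b mu0 L dd : R).

Definition step_coef : R :=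
  (5 + 4 * L ^+ 2 * H / mu0) + L * (2 / mu0) * cdev K H b + L * (2 / mu0) +
  L * (2 / mu0 * (K%:R + 1)) * cdev K H b.

Lemma one_step_errorE gamma rho : one_step_error K H mu0 b gamma rho L =
  step_coef * rho + L * K%:R * gamma.
Proof. by rewrite /one_step_error /step_coef; ring. Qed.

End NetworkConstant.

(** * Closed form of the mean-field recursion *)

Section ClosedForm.
Context (R : comNzRingType) (n K l : nat) (f : 'I_n -> 'I_K) (a c : R).
Context (M : 'M[R]_K) (Wb Rb : 'M[R]_(K, l)).
Context (W : nat -> 'M[R]_(n, l)) (R0 : 'M[R]_(n, l)).

Definition lift_rows (X : 'M[R]_(K, l)) : 'M[R]_(n, l) := rowsub f X.

(** Opinions of the communities when every average is replaced by its mean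
    value [M] and every signal by its mean [Wb]. *)
Fixpoint mean_opinion k : 'M[R]_(K, l) :=
  if k is k'.+1 then c *: (M *m mean_opinion k') + Wb + a *: mean_opinion k' else Rb.

(** Centred signals and initial opinions remembered by a vertex through its own
    past opinions, without any contribution of its neighbours. *)
Fixpoint fluctuation k : 'M[R]_(n, l) :=
  if k is k'.+1 then W k - lift_rows Wb + a *: fluctuation k' else R0 - lift_rows Rb.

(** Coefficient of M^s in the binomial expansion of (c M + a)^t. *)
Definition binom_coef s t : R := 'C(t, s)%:R * a ^+ (t - s) * c ^+ s.

Lemma binom_coef0 t : binom_coef 0 t = a ^+ t.
Proof. by rewrite /binom_coef bin0 mul1r subn0 expr0 mulr1. Qed.

(** The operator (c M + a)^t applied to [X]. *)
Fixpoint lazy_power t (X : 'M[R]_(K, l)) : 'M[R]_(K, l) :=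
  if t is t'.+1 then c *: (M *m lazy_power t' X) + a *: lazy_power t' X else X.

Lemma lazy_powerE t X :
  lazy_power t X = \sum_(0 <= s < t.+1) binom_coef s t *: (M ^+ s *m X).
Proof.
elim: t => [|t IH] /=.
  by rewrite big_nat1 binom_coef0 !expr0 scale1r mul1mx.
have -> : c *: (M *m lazy_power t X) =
    \sum_(0 <= s < t.+1) (c * binom_coef s t) *: (M ^+ s.+1 *m X).
  rewrite IH mulmx_sumr scaler_sumr; apply: eq_bigr => s _.
  by rewrite -scalemxAr scalerA exprS mulmxA.
have -> : a *: lazy_power t X =
    \sum_(0 <= s < t.+2) (a * (if (s <= t)%N then binom_coef s t else 0)) *: (M ^+ s *m X).
  rewrite big_nat_recr//= ltnn mulr0 scale0r addr0 IH scaler_sumr.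
  apply: eq_big_nat => s /andP[_ st].
  by rewrite scalerA -ltnS st.
rewrite [X in _ + X]big_nat_recl//= [RHS]big_nat_recl//= addrCA; congr (_ + _).
  by rewrite !binom_coef0 exprS.
rewrite -big_split/=; apply: eq_big_nat => s /andP[_ st].
rewrite -scalerDl; congr (_ *: _); rewrite /binom_coef binS natrD subSS.
case: ltnP => sts.
  have -> : (t - s = (t - s.+1).+1)%N by rewrite -subSn// subSS.
  by rewrite !exprS; ring.
have {st} -> : s = t by apply/eqP; rewrite eqn_leq sts andbT -ltnS.
by rewrite (bin_small (ltnSn t)) exprS; ring.
Qed.

Lemma mean_opinionE k :
  mean_opinion k = \sum_(0 <= t < k) lazy_power t Wb + lazy_power k Rb.
Proof.
elim: k => [|k IH] /=; first by rewrite big_nil add0r.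
rewrite IH mulmxDr !scalerDr big_nat_recl//= mulmx_sumr !scaler_sumr.
have -> : \sum_(0 <= i < k) (c *: (M *m lazy_power i Wb) + a *: lazy_power i Wb) =
   \sum_(0 <= i < k) c *: (M *m lazy_power i Wb) + \sum_(0 <= i < k) a *: lazy_power i Wb.
  by rewrite big_split.
by rewrite addrAC addrACA addrC addrA.
Qed.

Lemma lift_rowsD X Y : lift_rows (X + Y) = lift_rows X + lift_rows Y.
Proof. by apply/matrixP => i q; rewrite !mxE. Qed.

Lemma lift_rowsZ r X : lift_rows (r *: X) = r *: lift_rows X.
Proof. by apply/matrixP => i q; rewrite !mxE. Qed.

Lemma lift_rows_sum (J : Type) (s : seq J) (F : J -> 'M[R]_(K, l)) :
  lift_rows (\sum_(j <- s) F j) = \sum_(j <- s) lift_rows (F j).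
Proof.
elim: s => [|j s IH]; last by rewrite !big_cons lift_rowsD IH.
by rewrite !big_nil; apply/matrixP => i q; rewrite !mxE.
Qed.

Lemma row_lift i X : row i (lift_rows X) = row (f i) X.
Proof. by apply/rowP => q; rewrite !mxE. Qed.

Lemma fluctuationE k : fluctuation k =
  \sum_(0 <= t < k) a ^+ t *: (W (k - t)%N - lift_rows Wb) +
  a ^+ k *: (R0 - lift_rows Rb).
Proof.
elim: k => [|k IH] /=; first by rewrite big_nil add0r expr0 scale1r.
rewrite IH big_nat_recl//= subn0 expr0 scale1r scalerDr scaler_sumr !addrA.
congr (_ + _ + _); last by rewrite scalerA -exprS.
by apply: eq_bigr => t _; rewrite scalerA -exprS subSS.
Qed.

(** The explicit approximating process solves two recursions: its mean part
    follows the averaged dynamics, and what is left is the fluctuation of the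
    vertex alone.  This is what makes it comparable to the opinion process step
    by step. *)
Lemma approx_split k :
  (if k is 0 then R0 else \matrix_(i < n)
   (\sum_(0 <= t < k) a ^+ t *: row i (W (k - t)%N)
    + (2 <= k)%:R *: \sum_(1 <= t < k) \sum_(1 <= s < t.+1)
        binom_coef s t *: row (f i) (M ^+ s *m Wb)
    + \sum_(1 <= s < k.+1) binom_coef s k *: row (f i) (M ^+ s *m Rb)
    + a ^+ k *: row i R0)) =
  fluctuation k + lift_rows (mean_opinion k).
Proof.
case: k => [|k]; first by rewrite /= subrK.
have lp t X : lazy_power t X =
    \sum_(1 <= s < t.+1) binom_coef s t *: (M ^+ s *m X) + a ^+ t *: X.
  by rewrite lazy_powerE big_ltn// binom_coef0 expr0 mul1mx addrC.
rewrite fluctuationE mean_opinionE [lazy_power k.+1 Rb]lp !lift_rowsD lift_rows_sum.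
under [in RHS]eq_bigr do rewrite scalerBr.
under [X in _ = _ + (X + _)]eq_bigr => t _ do rewrite lp lift_rowsD lift_rowsZ.
rewrite sumrB big_split/= lift_rowsZ scalerBr.
set SW := \sum_(0 <= t < k.+1) a ^+ t *: W _.
set SB := \sum_(0 <= t < k.+1) a ^+ t *: lift_rows Wb.
set DW := \sum_(0 <= t < k.+1) lift_rows _.
set DR := lift_rows (\sum_(1 <= s < k.+2) _).
have -> : SW - SB + (a ^+ k.+1 *: R0 - a ^+ k.+1 *: lift_rows Rb) +
   (DW + SB + (DR + a ^+ k.+1 *: lift_rows Rb)) = SW + DW + DR + a ^+ k.+1 *: R0.
  apply/matrixP => i q; rewrite !mxE; ring.
apply/row_matrixP => i; rewrite rowK !linearD/= linearZ/=.
congr (_ + _ + _ + _).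
- by rewrite linear_sum/=; apply: eq_bigr => t _; rewrite linearZ.
- have rowDW : row i DW = \sum_(1 <= t < k.+1) \sum_(1 <= s < t.+1)
      binom_coef s t *: row (f i) (M ^+ s *m Wb).
    rewrite /DW linear_sum/= big_ltn// big_geq// row_lift linear0 add0r.
    by apply: eq_bigr => t _; rewrite row_lift linear_sum; apply: eq_bigr => s _;
      rewrite linearZ.
  rewrite rowDW; case: k {SW SB DW DR rowDW} => [|k]; last by rewrite scale1r.
  by rewrite !big_geq// scaler0.
- by rewrite /DR row_lift linear_sum; apply: eq_bigr => s _; rewrite linearZ.
Qed.

End ClosedForm.

(** * Independence from product formulas, and conditioning on an event *)

Section ProductForm.
Context d (T : measurableType d) (R : realType) (P : probability T R).

Lemma measurable_forall (J : finType) (A : J -> set T) :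
  (forall i, measurable (A i)) -> measurable [set x | forall i, A i x].
Proof.
move=> mA; rewrite (_ : [set x | _] = \bigcap_(i in [set: J]) A i).
  exact: fin_bigcap_measurable.
by apply/seteqP; split => x /= xA i //; exact: xA.
Qed.

Lemma probability_split (F : finType) (h : T -> F) (A : set T) :
  (forall f, measurable (h @^-1` [set f])) -> measurable A ->
  P A = (\sum_f P (A `&` h @^-1` [set f]))%E.
Proof.
move=> mh mA; rewrite {1}(_ : A = \bigcup_(f in [set: F]) (A `&` h @^-1` [set f])); last first.
  apply/seteqP; split => x; first by move=> Ax; exists (h x).
  by move=> [f _ []].
rewrite measure_fin_bigcup//.
- rewrite (_ : [set: F] = [set` index_enum F]).
    by rewrite -fsbig_seq// index_enum_uniq.
  by apply/seteqP; split => f //= _; exact: mem_index_enum.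
- exact: finite_finset.
- by move=> f g _ _ [x [[_ <-] [_ <-]]].
- by move=> f _; exact: measurableI.
Qed.

(** A product formula over all index families suffices for independence, even
    if its factors are not the marginal probabilities: evaluated at the trivial
    event in all but one block, it identifies each factor up to a constant, and
    these constants multiply to 1. *)
Section ProductEvents.
Context (I : finType) (Th : Type) (ok : Th -> Prop) (top : Th).
Context (ev : I -> Th -> set T) (phi : I -> Th -> R).
Hypothesis ok_top : ok top.
Hypothesis ev_top : forall b, ev b top = setT.
Hypothesis ev_prod : forall th : I -> Th, (forall b, ok (th b)) ->
  P [set x | forall b, ev b (th b) x] = (\prod_b phi b (th b))%:E.

Lemma prod_phi_top : \prod_b phi b top = 1.
Proof.
have := ev_prod (th := fun=> top) (fun=> ok_top).
rewrite (_ : [set x | _] = setT); last first.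
  by apply/seteqP; split => x // _ b; rewrite ev_top.
by have /= -> := probability_setT P => -[].
Qed.

Lemma product_marginal b th : ok th -> P (ev b th) = (phi b th / phi b top)%:E.
Proof.
move=> okth.
have top0 : phi b top != 0.
  have : \prod_b phi b top != 0 by rewrite prod_phi_top oner_neq0.
  by move/prodf_neq0 => /(_ b isT).
have := ev_prod (th := fun b' => if b' == b then th else top).
rewrite (_ : [set x | _] = ev b th); last first.
  apply/seteqP; split => x /=; first by move=> /(_ b); rewrite eqxx.
  by move=> evx b'; case: eqP => [->//|_]; rewrite ev_top.
move=> ->; last by move=> b'; case: ifP.
congr EFin; rewrite (bigD1 b)//= eqxx; congr (_ * _).
rewrite (eq_bigr (fun b' => phi b' top)); last by move=> b' /negbTE ->.
move: prod_phi_top; rewrite (bigD1 b)//= => pt.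
by apply: (mulfI top0); rewrite pt mulfV.
Qed.

Lemma independent_of_product :
  (forall b th, ok th -> measurable (ev b th)) ->
  (forall b th th', ok th -> ok th' ->
     exists2 th'', ok th'' & ev b th `&` ev b th' = ev b th'') ->
  independent_blocks P (fun b => [set A | exists2 th, ok th & A = ev b th]).
Proof.
move=> evm evI; split.
- by move=> b _ [th okth ->]; exact: evm.
- by move=> b; exists top.
- by move=> b _ _ [th okth ->] [th' okth' ->]; have [th'' ? ?] := evI b th th' okth okth';
    exists th''.
move=> A GA.
have {GA} [th thP] : exists th, forall b, ok (th b) /\ A b = ev b (th b).
  have [th thE] : {th & forall b, ok (th b) /\ A b = ev b (th b)}.
    by apply: (@choice _ _ (fun b th => ok th /\ A b = ev b th)) => b;
      have [th okth ->] := GA b; exists th.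
  by exists th.
have okth b := (thP b).1; have AE b := (thP b).2.
rewrite (_ : [set x | _] = [set x | forall b, ev b (th b) x]); last first.
  by apply/seteqP; split => x /= xA b; have := xA b; rewrite AE.
rewrite ev_prod//; congr EFin.
under [RHS]eq_bigr do rewrite AE product_marginal//=.
by rewrite big_split/= -[RHS]/(_ * _) prodfV prod_phi_top invr1 mulr1.
Qed.

End ProductEvents.

Lemma Ex_eq0_ae (f : T -> R) : bounded_rv f -> (forall x, 0 <= f x) -> Ex P f = 0 ->
  {ae P, forall x, f x = 0}.
Proof.
move=> bf f0 Ef.
have mf : measurable_fun setT (EFin \o f) by apply/measurable_EFinP; case: bf.
have : (\int[P]_x `|(EFin \o f) x| = 0)%E.
  rewrite -[RHS]/(0%:E) -Ef -Ex_fin//; apply: eq_integral => x _ /=.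
  by rewrite ger0_norm.
move=> /(ae_eq_integral_abs P measurableT mf); apply: filterS => x /= /(_ Logic.I).
by move=> [].
Qed.

End ProductForm.

Lemma eq_law_Ex d d' (T : measurableType d) (T' : measurableType d') (R : realType)
    (P : probability T R) (P' : probability T' R) (X : T -> R) (X' : T' -> R) :
  bounded_rv X -> bounded_rv X' ->
  (forall A, measurable A -> P (X @^-1` A) = P' (X' @^-1` A)) -> Ex P X = Ex P' X'.
Proof.
move=> bX bX' law; have [mX [M XM]] := bX; have [mX' [M' X'M]] := bX'.
pose XT : {mfun T >-> R} := mfun_Sub (mem_set mX).
pose XT' : {mfun T' >-> R} := mfun_Sub (mem_set mX').
have : (Ex P X)%:E = (Ex P' X')%:E; last by case.
rewrite -!Ex_fin//.
transitivity (\int[distribution P XT]_y y%:E)%E.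
  rewrite [RHS]integral_pushforward//=.
  by rewrite preimage_setT; exact: bounded_rv_integrable.
transitivity (\int[distribution P' XT']_y y%:E)%E.
  by apply: eq_measure_integral => A mA _; exact: law.
rewrite [LHS]integral_pushforward//=.
by rewrite preimage_setT; exact: bounded_rv_integrable.
Qed.

Section Conditioning.
Context d (T : measurableType d) (R : realType) (P : probability T R).
Context (D : set T) (mD : measurable D) (D0 : P D != 0%E).

Definition cond_prob : probability T R := mnormalize (mrestr P mD) P.

Lemma fine_P_gt0 : 0 < fine (P D).
Proof.
by rewrite fine_gt0// lt0e D0 measure_ge0/= -ge0_fin_numE// fin_num_measure.
Qed.

Lemma cond_probE A : measurable A -> cond_prob A = (fine (P (D `&` A)) / fine (P D))%:E.
Proof.
move=> mA; transitivity (mnormalize (mrestr P mD) P A) => //.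
have mT : mrestr P mD [set: T] = P D by rewrite /mrestr setTI.
have mA' : mrestr P mD A = P (D `&` A) by rewrite /mrestr setIC.
have Py : P D == +oo%E = false.
  by apply/negbTE; rewrite -ltey -ge0_fin_numE// fin_num_measure.
rewrite /mnormalize /= mT (negbTE D0) Py /= mA' EFinM fineK//.
by rewrite fin_num_measure//; exact: measurableI.
Qed.

Lemma cond_prob_ae (Q : T -> Prop) : {ae P, forall x, Q x} ->
  {ae cond_prob, forall x, D x /\ Q x}.
Proof.
move=> [N [mN PN QN]]; exists (~` D `|` N); split.
- by apply: measurableU => //; exact: measurableC.
- rewrite cond_probE; last by apply: measurableU => //; exact: measurableC.
  rewrite (_ : D `&` _ = D `&` N); last first.
    by rewrite setIUr setICr set0U.
  rewrite (_ : P (D `&` N) = 0%E) ?mul0r//.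
  by apply: (@subset_measure0 _ _ _ P _ N) => //; exact: measurableI.
- move=> x /= /not_andP[Dx|Qx]; [by left|right].
  by apply: QN.
Qed.

Lemma integral_cond_prob_ge0 (f : T -> \bar R) : measurable_fun setT f ->
  (forall x, (0 <= f x)%E) ->
  (\int[cond_prob]_x f x = (\int[P]_(x in D) f x) * ((fine (P D))^-1)%:E)%E.
Proof.
move=> mf f0.
rewrite (@ge0_negligible_integral _ _ _ cond_prob setT (~` D))//; last 2 first.
- exact: measurableC.
- have := cond_probE (measurableC mD); rewrite setICr measure0 mul0r; exact.
have q0 : 0 <= (fine (P D))^-1 by rewrite invr_ge0 ltW// fine_P_gt0.
rewrite setTD setCK (eq_measure_integral (mscale (NngNum q0) P)); last first.
  move=> A mA AD; transitivity (cond_prob A) => //.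
  rewrite /mscale cond_probE//= setIidr//.
  by rewrite EFinM fineK ?fin_num_measure// muleC.
rewrite [RHS]muleC; apply: ge0_integral_mscale => //; exact: measurable_funTS.
Qed.

Lemma Ex_cond_prob (f : T -> R) : bounded_rv f ->
  ((\int[P]_(x in D) (f x)%:E) * ((fine (P D))^-1)%:E = (Ex cond_prob f)%:E)%E.
Proof.
move=> bf; have [mf [M fM]] := bf.
have M0 : 0 <= M by apply: le_trans (fM point); exact: normr_ge0.
have bM : bounded_rv (fun=> M : R) := bounded_rv_cst T M.
have fM0 x : (0 <= (f x + M)%:E)%E.
  by rewrite lee_fin -lerBlDr sub0r; have /ler_normlP[] := fM x; rewrite lerNl.
have mfM : measurable_fun setT (fun x => (f x + M)%:E).
  by apply/measurable_EFinP; exact: measurable_funD.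
have iD (g : T -> R) : bounded_rv g -> P.-integrable D (EFin \o g).
  by move=> bg; apply: (integrableS measurableT) => //; exact: bounded_rv_integrable.
have qP := fine_P_gt0.
have := integral_cond_prob_ge0 mfM fM0.
rewrite (Ex_fin _ (bounded_rvD bf bM)) (ExD _ bf bM) Ex_cst.
rewrite (_ : (\int[P]_(x in D) _)%E = (\int[P]_(x in D) f x + M * fine (P D))%:E).
  rewrite -EFinM => -[]; rewrite mulrDl (mulfK (lt0r_neq0 qP)) => /addIr ->.
  by rewrite EFinM /Rintegral fineK//; apply: integrable_fin_num => //; exact: iD.
rewrite EFinD /Rintegral fineK; last by apply: integrable_fin_num => //; exact: iD.
rewrite integralD_EFin//; [|exact: iD|exact: (iD (fun=> M))].
by rewrite integral_cst// EFinM fineK// fin_num_measure.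
Qed.

End Conditioning.

(** * The opinion model given the labels *)

Lemma block_measurable_fun d d' (T : measurableType d) (T' : measurableType d')
    (R : realType) (P : probability T R) (I : finType) (G : I -> set (set T))
    (GI : independent_blocks P G) (S : pred I) (b : I) (X : T -> T') : S b ->
  (forall B, measurable B -> G b (X @^-1` B)) ->
  measurable_fun setT (X : block_space G S -> T').
Proof.
move=> Sb GX _ B mB; rewrite setTI; apply: sub_sigma_algebra.
exists (fun b' => if b' == b then X @^-1` B else setT).
  by move=> b'; case: eqP => [->|_]; [exact: GX|exact: (block_setT GI)].
apply/seteqP; split => x /=; first by move=> XB b' _; case: ifP.
by move=> /(_ b Sb); rewrite eqxx.
Qed.

Section JointLaw.
Context (R : realType) (K l : nat) (p : params R K l).
Context (dO : measure_display) (Omega : measurableType dO).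
Context (P : probability Omega R) (X : data K l P) (hX : is_model p X).
Context (n : nat) (j : {ffun 'I_n -> 'I_K}).
Local Notation At := (atom X j).
Local Notation ep := (edge_prob p j).

Lemma atom_measurable : measurable At.
Proof.
rewrite (_ : At = [set w | forall i, x_J X i w = j i]).
  by apply: measurable_forall => i; exact: x_J_meas.
apply/seteqP; split => w /=.
  by rewrite /atom /= => <- i; rewrite ffunE.
by move=> Jw; apply/ffunP => i; rewrite ffunE Jw.
Qed.

Lemma edge_prob_ge0 i i' : 0 <= ep i i'.
Proof.
rewrite /edge_prob le_min ler01 andbT divr_ge0// mulr_ge0 ?p_kappa_ge0//.
exact: ltW (p_theta_gt0 p n).
Qed.

Lemma edge_prob_le1 i i' : ep i i' <= 1.
Proof. by rewrite /edge_prob ge_min lexx orbT. Qed.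

(** Probability that a Bernoulli variable of parameter [q] lies in [E]. *)
Definition edge_mass (E : set bool) (q : R) : R :=
  \sum_b (`[< E b >])%:R * (if b then q else 1 - q).

Lemma edge_massT q : edge_mass setT q = 1.
Proof.
rewrite /edge_mass (bigD1 true)//= (bigD1 false)//= big1 ?addr0.
  by rewrite !asboolT// !mul1r; ring.
by case=> [] /andP[].
Qed.

(** The joint law prescribes exact edge configurations; summing over the
    configurations compatible with [E] and distributing the product over the sum
    gives the law of events on edges. *)
Lemma joint_law_edges (E : 'I_n -> 'I_n -> set bool)
    (S : 'I_n -> 'I_n -> set (measurableTypeR R))
    (U V : 'I_n -> set (vec R l)) (m : nat) (T : 'I_n -> 'I_m -> set (vec R l)) :
  (forall i i', measurable (S i i')) ->
  (forall i, measurable (U i)) -> (forall i, measurable (V i)) ->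
  (forall i k, measurable (T i k)) ->
  P (At `&`
     [set w | forall i i', E i i' (x_edge X i i' w)] `&`
     [set w | forall i i', S i i' (x_B X i i' w)] `&`
     [set w | forall i, U i (x_Q X i w) /\ V i (x_R0 X i w)] `&`
     [set w | forall i (k : 'I_m), T i k (x_Z X i k w)]) =
  ((\prod_i \prod_i' edge_mass (E i i') (ep i i'))%:E *
   ((\prod_i \prod_i' fine (p_G p (j i) (j i') (S i i')))%:E *
   \int[P]_(w in At `&` [set w | forall i, U i (x_Q X i w) /\ V i (x_R0 X i w)])
     (\prod_i \prod_(k < m) fine (p_media p (j i) (x_Q X i w) (T i k)))%:E))%E.
Proof.
move=> mS mU mV mT.
set Ev := [set w | forall i i', E i i' _]; set Bv := [set w | forall i i', S i i' _].
set Qv := [set w | forall i, U i _ /\ _]; set Tv := [set w | forall i (k : 'I_m), _].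
set c := ((\prod_i \prod_i' fine (p_G p _ _ _))%:E * _)%E.
pose h w : {ffun 'I_n * 'I_n -> bool} := [ffun q => x_edge X q.1 q.2 w].
pose pr (q : 'I_n * 'I_n) (b : bool) : R := if b then ep q.1 q.2 else 1 - ep q.1 q.2.
have mh f : measurable (h @^-1` [set f]).
  rewrite (_ : _ @^-1` _ = [set w | forall q : 'I_n * 'I_n,
      (x_edge X q.1 q.2 @^-1` [set f q]) w]).
    by apply: measurable_forall => q; exact: measurable_funPTI.
  apply/seteqP; split => w /=; first by move=> <- q; rewrite ffunE.
  by move=> hw; apply/ffunP => q; rewrite ffunE hw.
have mEv : measurable Ev.
  apply: measurable_forall => i; apply: measurable_forall => i'.
  by have := measurable_funPTI (x_edge X i i') (Y := E i i'); apply.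
have mBv : measurable Bv.
  apply: measurable_forall => i; apply: measurable_forall => i'.
  exact: (measurable_funPTI (x_B X i i') (mS i i')).
have mQv : measurable Qv.
  apply: measurable_forall => i; apply: measurableI.
    exact: (measurable_funPTI (x_Q X i) (mU i)).
  exact: (measurable_funPTI (x_R0 X i) (mV i)).
have mTv : measurable Tv.
  apply: measurable_forall => i; apply: measurable_forall => k.
  exact: (measurable_funPTI (x_Z X i k) (mT i k)).
have mA : measurable (At `&` Ev `&` Bv `&` Qv `&` Tv).
  by do 4 (apply: measurableI => //); exact: atom_measurable.
rewrite (probability_split P mh mA).
have mass0 q b : 0 <= `[< E q.1 q.2 b >]%:R * pr q b.
  by rewrite mulr_ge0// /pr; case: b; rewrite ?subr_ge0 ?edge_prob_ge0 ?edge_prob_le1.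
transitivity (\sum_(f : {ffun 'I_n * 'I_n -> bool})
    (\prod_q (`[< E q.1 q.2 (f q) >]%:R * pr q (f q)))%:E * c)%E.
  apply: eq_bigr => f _.
  have [okf|nokf] := pselect (forall q : 'I_n * 'I_n, E q.1 q.2 (f q)).
    rewrite (_ : _ `&` _ = At `&` [set w | forall i i', x_edge X i i' w = f (i, i')]
        `&` Bv `&` Qv `&` Tv).
      rewrite (joint_law hX)// muleA /c; congr (_ * _ * _)%E.
      congr EFin; rewrite pair_bigA; apply: eq_bigr => -[i i'] _ /=.
      by rewrite asboolT ?mul1r//; exact: (okf (i, i')).
    apply/seteqP; split => w /=.
      move=> [[[[[Aw _] Bw] Qw] Tw] hw]; split => //; split => //; split => //.
      by split => // i i'; rewrite -hw ffunE.
    move=> [[[[Aw ew] Bw] Qw] Tw]; split; last first.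
      by apply/ffunP => -[i i']; rewrite ffunE ew.
    by split => //; split => //; split => //; split => // i i'; rewrite ew; exact: (okf (i, i')).
  have [q /= nEq] := (existsNP _).2 nokf.
  rewrite (bigD1 q)//= asboolF// !mul0r mul0e.
  rewrite (_ : _ `&` _ = set0) ?measure0//.
  apply/seteqP; split => w //= [[[[[_ Ew] _] _] _] hw].
  by apply: nEq; rewrite -hw ffunE; exact: Ew.
rewrite -ge0_sume_distrl; last first.
  by move=> f _; rewrite lee_fin; apply: prodr_ge0 => q _; exact: mass0.
congr (_ * _)%E; rewrite sumEFin pair_bigA; congr EFin.
rewrite /edge_mass.
by rewrite (bigA_distr_bigA (fun q b => `[< E q.1 q.2 b >]%:R * pr q b)).
Qed.

Hypothesis At0 : P At != 0%E.
Local Notation cP := (cond_prob P atom_measurable).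

Lemma Q_product (U : 'I_n -> set (vec R l)) : (forall i, measurable (U i)) ->
  cP [set w | forall i, (x_Q X i @^-1` U i) w] =
    (\prod_i fine (p_F p (j i) (U i)))%:E.
Proof.
move=> mU; rewrite cond_probE//; last first.
  by apply: measurable_forall => i; exact: (measurable_funPTI (x_Q X i) (mU i)).
have /= -> := Q_law hX j mU.
rewrite fineM// ?fin_num_measure//; last exact: atom_measurable.
by rewrite /= mulrAC divff ?mul1r// gt_eqF// fine_P_gt0//; exact: atom_measurable.
Qed.

Definition Q_events (i : 'I_n) (U : set (vec R l)) := x_Q X i @^-1` U.

Lemma Q_blocks : independent_blocks cP
  (fun i => [set A | exists2 U, measurable U & A = Q_events i U]).
Proof.
apply: (@independent_of_product _ _ _ _ _ _ measurable setT _
    (fun i U => fine (p_F p (j i) U))) => //.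
- by move=> th mth; exact: Q_product.
- by move=> i U mU; exact: (measurable_funPTI (x_Q X i) mU).
- by move=> i U U' mU mU'; exists (U `&` U') => //; exact: measurableI.
Qed.

Lemma Q_marginal i U : measurable U ->
  cP (x_Q X i @^-1` U) = (fine (p_F p (j i) U))%:E.
Proof.
move=> mU; have /= -> := @product_marginal _ _ _ cP _ _ measurable setT Q_events
  (fun i U => fine (p_F p (j i) U)) _ _ _ i U mU => //.
  by have /= -> := probability_setT (p_F p (j i)); rewrite divr1.
by move=> th mth; exact: Q_product.
Qed.

(** Density, given the belief, of the event that the belief lies in [U] and
    that the first [m] media signals lie in the sets [T]. *)
Definition media_density i (U : set (vec R l)) m (T : nat -> set (vec R l))
    (x : vec R l) : R :=
  \1_U x * \prod_(k < m) fine (p_media p (j i) x (T k)).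

Lemma media01 r x (A : set (vec R l)) : measurable A -> 0 <= fine (p_media p r x A) <= 1.
Proof.
move=> mA; have A1 : (p_media p r x A <= 1)%E.
  apply: le_trans (_ : p_media p r x setT <= 1)%E; last by rewrite prob_kernel.
  by apply: le_measure => //; rewrite inE.
have A0 : (0 <= p_media p r x A)%E by exact: measure_ge0.
rewrite fine_ge0//=; rewrite -[1]/(fine 1%E) fine_le//.
by rewrite ge0_fin_numE//; apply: le_lt_trans A1 (ltry _).
Qed.

Lemma bounded_media r (A : set (vec R l)) : measurable A ->
  bounded_rv (fun x => fine (p_media p r x A)).
Proof.
move=> mA; split; last first.
  by exists 1 => x; have /andP[h0 h1] := media01 r x mA; rewrite ger0_norm.
by apply: measurableT_comp => //; exact: measurable_kernel.
Qed.

Lemma bounded_media_density i U m T : measurable U -> (forall k, measurable (T k)) ->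
  bounded_rv (media_density i U m T).
Proof.
move=> mU mT; apply: bounded_rvM.
  split; first exact: measurable_indic.
  by exists 1 => x; rewrite indicE; case: (_ \in _); rewrite ?normr1 ?normr0.
by apply: bounded_rv_prod => k _; exact: bounded_media.
Qed.

Lemma bounded_rv_comp d' (T' : measurableType d') (d'' : measure_display)
    (T'' : measurableType d'') (f : T' -> R) (Y : T'' -> T') : bounded_rv f ->
  measurable_fun setT Y -> bounded_rv (f \o Y).
Proof.
move=> [mf [M fM]] mY; split; first exact: measurableT_comp.
by exists M => x; exact: fM.
Qed.

(** One type of parameters serves for all blocks of both systems below: an edge
    event and a weight event, then a vertex event, a number of media signals and
    the events required of them. *)
Definition event_param :=
  ((set bool * set (measurableTypeR R)) *
   (set (vec R l) * nat * (nat -> set (vec R l))))%type.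

Definition ok_param (th : event_param) :=
  [/\ measurable th.1.2, measurable th.2.1.1 & forall k, measurable (th.2.2 k)].

Definition top_param : event_param := ((setT, setT), (setT, 0%N, fun=> setT)).

(** The pair [(i, i')] stands for the weight that [i] gives to [i'], that is, for
    the edge from [i'] to [i]. *)
Definition edge_event (q : 'I_n * 'I_n) (th : event_param) :=
  [set w | th.1.1 (x_edge X q.2 q.1 w) /\ th.1.2 (x_B X q.1 q.2 w)].

Definition edge_factor (q : 'I_n * 'I_n) (th : event_param) : R :=
  edge_mass th.1.1 (ep q.2 q.1) * fine (p_G p (j q.1) (j q.2) th.1.2).

(** Two systems of blocks are needed, one with the beliefs and media signals and
    one with the initial opinions: each of the two families is independent over
    the vertices, but the belief and the initial opinion of the same vertex may
    be dependent, and their pairs are not assumed independent over vertices. *)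
Definition media_events (b : 'I_n * 'I_n + 'I_n) (th : event_param) : set Omega :=
  match b with
  | inl q => edge_event q th
  | inr i => [set w | th.2.1.1 (x_Q X i w) /\
                forall k, (k < th.2.1.2)%N -> th.2.2 k (x_Z X i k w)]
  end.

Definition media_factor (b : 'I_n * 'I_n + 'I_n) (th : event_param) : R :=
  match b with
  | inl q => edge_factor q th
  | inr i => Ex cP (media_density i th.2.1.1 th.2.1.2 th.2.2 \o x_Q X i)
  end.

Definition initial_events (b : 'I_n * 'I_n + 'I_n) (th : event_param) : set Omega :=
  match b with
  | inl q => edge_event q th
  | inr i => x_R0 X i @^-1` th.2.1.1
  end.

Definition initial_factor (b : 'I_n * 'I_n + 'I_n) (th : event_param) : R :=
  match b with
  | inl q => edge_factor q th
  | inr i => fine (cP (x_R0 X i @^-1` th.2.1.1))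
  end.

Lemma edge_event_measurable q th : ok_param th -> measurable (edge_event q th).
Proof.
case=> mS _ _; apply: measurableI.
  by have := measurable_funPTI (x_edge X q.2 q.1) (Y := th.1.1); apply.
exact: (measurable_funPTI (x_B X q.1 q.2) mS).
Qed.

Lemma media_events_measurable b th : ok_param th -> measurable (media_events b th).
Proof.
case: b => [q|i] /=; first exact: edge_event_measurable.
case=> _ mU mT; apply: measurableI.
  exact: (measurable_funPTI (x_Q X i) mU).
rewrite [X in measurable X](_ : _ =
  [set w | forall k : 'I_(th.2.1.2), (x_Z X i k @^-1` th.2.2 k) w]).
  by apply: measurable_forall => k; exact: (measurable_funPTI (x_Z X i k) (mT k)).
apply/seteqP; split => w /= h; first by move=> k; exact: h.
by move=> k km; exact: (h (Ordinal km)).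
Qed.

Lemma edge_factors (th : 'I_n * 'I_n -> event_param) :
  \prod_q edge_factor q (th q) =
  (\prod_i \prod_i' edge_mass (th (i', i)).1.1 (ep i i')) *
  (\prod_i \prod_i' fine (p_G p (j i) (j i') (th (i, i')).1.2)).
Proof.
rewrite exchange_big/= !pair_bigA -big_split/=.
by apply: eq_bigr => -[i i'] _.
Qed.

(** The numbers of signals required by the different vertices are first raised
    to their maximum by trivial events.  The integral over the beliefs that remains
    in the joint law then factors because the beliefs are independent. *)
Lemma media_product (th : 'I_n * 'I_n + 'I_n -> event_param) :
  (forall b, ok_param (th b)) ->
  cP [set w | forall b, media_events b (th b) w] = (\prod_b media_factor b (th b))%:E.
Proof.
move=> okth; rewrite cond_probE//; last first.
  by apply: measurable_forall => b; exact: media_events_measurable.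
pose U i := (th (inr i)).2.1.1; pose T i := (th (inr i)).2.2.
pose mm i := (th (inr i)).2.1.2; pose m := \max_i mm i.
pose T' i (k : 'I_m) := if (k < mm i)%N then T i k else setT.
pose E i i' := (th (inl (i', i))).1.1.
pose S i i' := (th (inl (i, i'))).1.2.
have mS i i' : measurable (S i i') by have [] := okth (inl (i, i')).
have mU i : measurable (U i) by have [] := okth (inr i).
have mT i k : measurable (T i k) by have [_ _] := okth (inr i); apply.
have mT' i k : measurable (T' i k) by rewrite /T'; case: ifP => _; [exact: mT|exact: measurableT].
have := @joint_law_edges E S U (fun=> setT) m T' mS mU (fun=> measurableT) mT'.
rewrite (_ : _ `&` _ `&` _ `&` _ `&` _ =
    At `&` [set w | forall b, media_events b (th b) w]); last first.
  apply/seteqP; split => w /=.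
    move=> [[[[Aw Ew] Bw] Qw] Tw]; split=> // -[[i i']|i] /=.
      by split; [exact: Ew|exact: Bw].
    split; first by have [] := Qw i.
    move=> k km; have kM : (k < m)%N by apply: leq_trans km _; exact: leq_bigmax.
    by have := Tw i (Ordinal kM); rewrite /T' /= km.
  move=> [Aw ew]; split; [split; [split; [split=> //|]|]|].
  - by move=> i i'; have [] := ew (inl (i', i)).
  - by move=> i i'; have [] := ew (inl (i, i')).
  - by move=> i; split=> //; have [] := ew (inr i).
  - move=> i k; rewrite /T'; case: ifP => // km.
    by have [_ /(_ k km)] := ew (inr i).
move=> ->; set I := (\int[P]_(w in _) _)%E.
pose g i := media_density i (U i) (mm i) (T i) \o x_Q X i.
have bg i : bounded_rv (g i) by apply: bounded_rv_comp => //; exact: bounded_media_density.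
have bprod : bounded_rv (fun w => \prod_i g i w) by apply: bounded_rv_prod.
have IE : I = (Ex cP (fun w => \prod_i g i w) * fine (P At))%:E.
  have qP := fine_P_gt0 atom_measurable At0.
  rewrite EFinM -(Ex_cond_prob atom_measurable At0 bprod) -muleA -EFinM.
  rewrite mulVf ?gt_eqF// mule1 /I integral_mkcondr.
  apply: eq_integral => w _; rewrite patchE.
  case: ifPn => [|nw]; first rewrite inE => Qw.
    congr EFin; apply: eq_bigr => i _; rewrite /g /media_density /=.
    rewrite indicE mem_set ?mul1r; last by have [] := Qw i.
    rewrite (big_ord_widen m (fun k => fine (p_media p (j i) (x_Q X i w) (T i k))));
      last exact: leq_bigmax.
    rewrite [RHS]big_mkcond; apply: eq_bigr => k _; rewrite /T'; case: ifP => // _.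
    by rewrite prob_kernel.
  move: nw; rewrite notin_setE => /existsNP[i Ui].
  rewrite (bigD1 i)//= /g /media_density /= indicE memNset ?mul0r//.
  by move=> Uiw; apply: Ui; split.
rewrite IE big_sumType edge_factors -!EFinM /=.
rewrite !mulrA mulfK ?gt_eqF ?fine_P_gt0//; last exact: atom_measurable.
congr (_ * _)%:E.
apply: (Ex_block_prod Q_blocks (S := fun i => pred1 i) (index_enum_uniq _)).
  by move=> i i' b _ _ /eqP -> /eqP.
move=> i _; apply: bounded_rv_comp; first exact: bounded_media_density.
apply: (block_measurable_fun Q_blocks (b := i)) => /=; first by rewrite eqxx.
by move=> B mB; exists B.
Qed.

Lemma initial_product (th : 'I_n * 'I_n + 'I_n -> event_param) :
  (forall b, ok_param (th b)) ->
  cP [set w | forall b, initial_events b (th b) w] =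
    (\prod_b initial_factor b (th b))%:E.
Proof.
move=> okth; rewrite cond_probE//; last first.
  apply: measurable_forall => -[q|i]; first exact: edge_event_measurable.
  by have [_ mU _] := okth (inr i); exact: (measurable_funPTI (x_R0 X i) mU).
pose V i := (th (inr i)).2.1.1.
pose E i i' := (th (inl (i', i))).1.1.
pose S i i' := (th (inl (i, i'))).1.2.
have mS i i' : measurable (S i i') by have [] := okth (inl (i, i')).
have mV i : measurable (V i) by have [] := okth (inr i).
have := @joint_law_edges E S (fun=> setT) V 0 (fun _ _ => setT) mS
  (fun=> measurableT) mV (fun _ _ => measurableT).
rewrite (_ : _ `&` _ `&` _ `&` _ `&` _ =
    At `&` [set w | forall b, initial_events b (th b) w]); last first.
  apply/seteqP; split => w /=.
    move=> [[[[Aw Ew] Bw] Qw] _]; split=> // -[[i i']|i] /=.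
      by split; [exact: Ew|exact: Bw].
    by have [] := Qw i.
  move=> [Aw ew]; split; [split; [split; [split=> //|]|]|].
  - by move=> i i'; have [] := ew (inl (i', i)).
  - by move=> i i'; have [] := ew (inl (i, i')).
  - by move=> i; split=> //; exact: (ew (inr i)).
  - by move=> i [].
move=> ->; set I := (\int[P]_(w in _) _)%E.
have IE : I = (P At * (\prod_i fine (cP (x_R0 X i @^-1` V i)))%:E)%E.
  have mAV : measurable (At `&` [set w | forall i, V i (x_R0 X i w)]).
    apply: measurableI; first exact: atom_measurable.
    by apply: measurable_forall => i; exact: (measurable_funPTI (x_R0 X i) (mV i)).
  rewrite /I (_ : _ `&` _ = At `&` [set w | forall i, V i (x_R0 X i w)]); last first.
    by apply/seteqP; split => w /= [Aw Vw]; split=> // i; have := Vw i => // -[].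
  rewrite (eq_integral (cst 1%E)); last first.
    by move=> w _; rewrite big1// => i _; rewrite big_ord0.
  rewrite integral_cst// mul1e; have /= -> := R0_indep hX j mV.
  congr (_ * _%:E)%E.
  apply: eq_bigr => i _; rewrite cond_probE//.
  exact: (measurable_funPTI (x_R0 X i) (mV i)).
rewrite IE big_sumType edge_factors.
rewrite -[P At]fineK; last by rewrite fin_num_measure//; exact: atom_measurable.
rewrite -!EFinM /= [fine (P At) * _]mulrC !mulrA.
by rewrite mulfK ?gt_eqF ?fine_P_gt0//; exact: atom_measurable.
Qed.

Definition media_system b := [set A | exists2 th, ok_param th & A = media_events b th].
Definition initial_system b := [set A | exists2 th, ok_param th & A = initial_events b th].

Definition meet_param (th th' : event_param) : event_param :=
  ((th.1.1 `&` th'.1.1, th.1.2 `&` th'.1.2),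
   (th.2.1.1 `&` th'.2.1.1, maxn th.2.1.2 th'.2.1.2,
    fun k => (if (k < th.2.1.2)%N then th.2.2 k else setT) `&`
             (if (k < th'.2.1.2)%N then th'.2.2 k else setT))).

Lemma ok_meet_param th th' : ok_param th -> ok_param th' -> ok_param (meet_param th th').
Proof.
case=> mS mU mT [mS' mU' mT']; split => //=; [exact: measurableI..|].
by move=> k; apply: measurableI; case: ifP => _; rewrite ?mT ?mT'//; exact: measurableT.
Qed.

Lemma edge_event_meet q th th' :
  edge_event q th `&` edge_event q th' = edge_event q (meet_param th th').
Proof.
by apply/seteqP; split => w /=; rewrite /edge_event/= => -[[? ?] [? ?]].
Qed.

Lemma ok_top_param : ok_param top_param.
Proof. by split => [||k] /=; exact: measurableT. Qed.

Definition edge_param E S : event_param := ((E, S), (setT, 0%N, fun=> setT)).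

Lemma ok_edge_param E S : measurable S -> ok_param (edge_param E S).
Proof. by move=> mS; split => [||k] /=; [exact: mS|exact: measurableT..]. Qed.

(** The product formula determines the independence, the number of signals of
    an intersection being the maximum of the two. *)
Lemma media_blocks : independent_blocks cP media_system.
Proof.
apply: (@independent_of_product _ _ _ _ _ _ ok_param top_param _ media_factor).
- exact: ok_top_param.
- by case=> [q|i]; apply/seteqP; split.
- exact: media_product.
- exact: media_events_measurable.
move=> [q|i] th th' okth okth'; exists (meet_param th th'); rewrite ?edge_event_meet//;
  try exact: ok_meet_param.
apply/seteqP; split => w /=.
  move=> [[Uw Tw] [Uw' Tw']]; split=> // k _.
  by split; case: ifP => // km; [exact: Tw|exact: Tw'].
move=> [[Uw Uw'] Tw]; split; split=> // k km.
  by have [+ _] := Tw k (leq_trans km (leq_maxl _ _)); rewrite km.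
by have [_ +] := Tw k (leq_trans km (leq_maxr _ _)); rewrite km.
Qed.

Lemma initial_events_measurable b th : ok_param th -> measurable (initial_events b th).
Proof.
case: b => [q|i] okth; first exact: edge_event_measurable.
by have [_ mU _] := okth; exact: (measurable_funPTI (x_R0 X i) mU).
Qed.

Lemma initial_blocks : independent_blocks cP initial_system.
Proof.
apply: (@independent_of_product _ _ _ _ _ _ ok_param top_param _ initial_factor).
- exact: ok_top_param.
- by case=> [q|i]; apply/seteqP; split.
- exact: initial_product.
- exact: initial_events_measurable.
by move=> [q|i] th th' okth okth'; exists (meet_param th th');
  rewrite ?edge_event_meet//; exact: ok_meet_param.
Qed.

Lemma edge_marginal q th : ok_param th -> cP (edge_event q th) = (edge_factor q th)%:E.
Proof.
move=> okth.
have /= -> := @product_marginal _ _ _ cP _ _ ok_param top_param media_events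
  media_factor ok_top_param _ media_product (inl q) th okth.
  rewrite /edge_factor/= edge_massT.
  by have /= -> := probability_setT (p_G p (j q.1) (j q.2)); rewrite mul1r divr1.
by case=> [q'|i]; apply/seteqP; split.
Qed.

Lemma Z_marginal i k T : measurable T ->
  cP (x_Z X i k @^-1` T) = (Ex cP (fun w => fine (p_media p (j i) (x_Q X i w) T)))%:E.
Proof.
move=> mT; pose T' k' := if k' == k then T else setT.
have mT' k' : measurable (T' k') by rewrite /T'; case: ifP.
pose th : event_param := ((setT, setT), (setT, k.+1, T')).
have okth : ok_param th by split => [||k'] /=; [exact: measurableT..|exact: mT'].
have := @product_marginal _ _ _ cP _ _ ok_param top_param media_events
  media_factor ok_top_param _ media_product (inr i) th okth.
rewrite (_ : media_events _ _ = x_Z X i k @^-1` T); last first.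
  apply/seteqP; split => w /=.
    by move=> [_ /(_ k (ltnSn k))]; rewrite /T' eqxx.
  by move=> Tw; split=> // k' _; rewrite /T'; case: eqP => // ->.
move=> ->; last by case=> [q'|i']; apply/seteqP; split.
congr EFin; rewrite /= [X in _ / X](_ : _ = 1); last first.
  rewrite -[RHS](Ex_cst cP 1); apply: eq_Ex => w.
  by rewrite /media_density /= big_ord0 indicE mem_set// mulr1.
rewrite divr1; apply: eq_Ex => w.
rewrite /media_density /= indicE mem_set// mul1r big_ord_recr/= /T' eqxx.
rewrite big1 ?mul1r// => k' _; rewrite ltn_eqF//.
by rewrite prob_kernel.
Qed.

(** Truncation to the interval where the variable lies almost surely: it turns
    almost sure bounds into bounds valid everywhere. *)
Definition clip (lo hi x : R) := Num.max lo (Num.min x hi).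

Lemma clip_id lo hi x : lo <= x <= hi -> clip lo hi x = x.
Proof. by case/andP => lx xh; rewrite /clip min_l// max_r. Qed.

Lemma clip_bnd lo hi x : lo <= hi -> lo <= clip lo hi x <= hi.
Proof. by move=> lh; rewrite /clip le_max lexx/= ge_max lh ge_min lexx orbT. Qed.

Lemma clip_norm M x : 0 <= M -> `|clip (- M) M x| <= M.
Proof. by move=> M0; rewrite ler_norml clip_bnd//; lra. Qed.

Lemma measurable_clip lo hi : measurable_fun setT (clip lo hi).
Proof. by apply: measurable_maxr => //; exact: measurable_minr. Qed.

Lemma bounded_clip lo hi : lo <= hi -> bounded_rv (clip lo hi).
Proof.
move=> lh; split; first exact: measurable_clip.
exists (Num.max `|lo| `|hi|) => x; have /andP[h1 h2] := clip_bnd x lh.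
rewrite le_max; case: (lerP 0 (clip lo hi x)) => c0.
  by rewrite ger0_norm// (le_trans h2 (ler_norm _)) orbT.
by rewrite ltr0_norm// -normrN (le_trans _ (ler_norm _))// lerN2.
Qed.

Local Notation H := (p_H p).
Local Notation bta := (beta p).

(** The other pairs contribute nothing to the mean weights.  Their weights vanish
    almost surely and are set to zero everywhere, so that vertices of inactive
    communities receive exactly no weight. *)
Definition keep i i' : bool := 0 < bta (j i) (j i') * p_kappa p (j i') (j i).

Definition weight i i' w : R :=
  clip 0 H (x_B X i i' w) * (x_edge X i' i w)%:R * (keep i i')%:R.

Lemma weight_bnd i i' w : 0 <= weight i i' w <= H.
Proof.
have H0 := ltW (p_H_gt0 p).
have /andP[b0 bH] := clip_bnd (x_B X i i' w) H0.
rewrite /weight; case: (x_edge X i' i w); case: (keep i i');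
  by rewrite ?(mulr1, mulr0, lexx, b0, bH, H0).
Qed.

Section WeightBlock.
Context (G : 'I_n * 'I_n + 'I_n -> set (set Omega)) (GI : independent_blocks cP G).
Hypothesis GE : forall q, G (inl q) = [set A | exists2 th, ok_param th & A = edge_event q th].

Lemma edge_block i i' : measurable_fun setT
  (x_edge X i' i : block_space G (pred1 (inl (i, i'))) -> bool).
Proof.
apply: (block_measurable_fun GI (b := inl (i, i'))); first by rewrite /= eqxx.
move=> E mE; rewrite GE; exists (edge_param E setT); first exact: ok_edge_param.
by apply/seteqP; split => w //= -[].
Qed.

Lemma weight_block i i' : block_rv G (pred1 (inl (i, i'))) (weight i i').
Proof.
have H0 := ltW (p_H_gt0 p).
apply: block_rvM; last exact: block_rv_cst.
apply: block_rvM; last by apply: bounded_rv_bool; exact: edge_block.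
apply: (bounded_rv_comp (bounded_clip H0)).
apply: (block_measurable_fun GI (b := inl (i, i'))); first by rewrite /= eqxx.
move=> S mS; rewrite GE; exists (edge_param setT S); first exact: ok_edge_param.
by apply/seteqP; split => w //= -[].
Qed.

End WeightBlock.

Lemma Ex_indic d' (T' : measurableType d') (P' : probability T' R) (A : set T') :
  measurable A -> Ex P' (\1_A) = fine (P' A).
Proof. by move=> mA; rewrite /Ex /Rintegral integral_indic// setIT. Qed.

(** The weight distribution is supported in [0, H], where clipping is the
    identity. *)
Lemma betaE r s : bta r s = Ex (p_G p r s) (clip 0 H).
Proof.
have mI : measurable [set x : measurableTypeR R | 0 <= x <= H].
  rewrite (_ : [set x | _] = `[0, H]%classic).
    exact: measurable_itv.
  by apply/seteqP; split => x /=; rewrite in_itv.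
rewrite /beta /Ex /Rintegral; congr fine; apply: ae_eq_integral => //.
- apply/measurable_EFinP; exact: measurable_clip.
exists (~` [set x | 0 <= x <= H]); split; first exact: measurableC.
  have /= -> := @probability_setC _ _ _ (p_G p r s) _ mI.
  by have /= -> := p_G_supp p r s; rewrite subee.
move=> x /= nx xH; apply: nx => _; congr EFin.
by rewrite clip_id.
Qed.

Lemma beta_ge0 r s : 0 <= bta r s.
Proof.
rewrite betaE; apply: Ex_ge0 => x.
by have /andP[] := clip_bnd x (ltW (p_H_gt0 p)).
Qed.

Lemma beta_le r s : bta r s <= H.
Proof.
rewrite betaE -[leRHS](Ex_cst (p_G p r s)); apply: le_Ex.
- exact: bounded_clip (ltW (p_H_gt0 p)).
- exact: bounded_rv_cst.
- by move=> x; have /andP[] := clip_bnd x (ltW (p_H_gt0 p)).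
Qed.

Lemma edge_mass_true q : edge_mass [set true] q = q.
Proof.
rewrite /edge_mass (bigD1 true)//= (bigD1 false)//= big1 ?addr0; last first.
  by case=> [] /andP[].
by rewrite asboolT// asboolF// mul1r mul0r addr0.
Qed.

Lemma Ex_edge i i' : Ex cP (fun w => (x_edge X i' i w)%:R) = ep i' i.
Proof.
have -> : (fun w => (x_edge X i' i w)%:R) = \1_(x_edge X i' i @^-1` [set true]) :> (Omega -> R).
  apply/funext => w; rewrite indicE; case E: (x_edge X i' i w).
    by rewrite mem_set.
  by rewrite memNset//= E.
rewrite Ex_indic; last exact: measurable_funPTI.
rewrite (_ : _ @^-1` _ = edge_event (i, i') (edge_param [set true] setT)); last first.
  by apply/seteqP; split => w //= -[].
rewrite edge_marginal; last exact: ok_edge_param.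
rewrite /edge_factor /= edge_mass_true.
by have /= -> := probability_setT (p_G p (j i) (j i')); rewrite mulr1.
Qed.

Lemma edge_event_indep (i i' : 'I_n) (S : set (measurableTypeR R)) (E : set bool) :
  measurable S ->
  cP (x_B X i i' @^-1` S `&` x_edge X i' i @^-1` E) =
  (cP (x_B X i i' @^-1` S) * cP (x_edge X i' i @^-1` E))%E.
Proof.
move=> mS.
rewrite (_ : _ `&` _ = edge_event (i, i') (edge_param E S)); last first.
  by apply/seteqP; split => w /= -[].
rewrite (_ : _ @^-1` S = edge_event (i, i') (edge_param setT S)); last first.
  by apply/seteqP; split => w //= -[].
rewrite (_ : _ @^-1` E = edge_event (i, i') (edge_param E setT)); last first.
  by apply/seteqP; split => w //= -[].
rewrite !edge_marginal; try exact: ok_edge_param.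
rewrite -EFinM /edge_factor /= edge_massT mul1r.
by have /= -> := probability_setT (p_G p (j i) (j i')); rewrite mulr1 mulrC.
Qed.

Lemma Ex_clip_B i i' : Ex cP (clip 0 H \o x_B X i i') = bta (j i) (j i').
Proof.
have bc := bounded_clip (ltW (p_H_gt0 p)).
rewrite betaE; apply: eq_law_Ex; [exact: (bounded_rv_comp bc (measurable_funPT (x_B X i i')))|exact: bc|].
move=> A mA; have mcA : measurable (clip 0 H @^-1` A).
  by rewrite -[_ @^-1` _]setTI; exact: measurable_clip.
rewrite (_ : _ @^-1` A = edge_event (i, i')
    (edge_param setT (clip 0 H @^-1` A))); last first.
  by apply/seteqP; split => w //= -[].
rewrite edge_marginal; last exact: ok_edge_param.
by rewrite /edge_factor /= edge_massT mul1r fineK// fin_num_measure.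
Qed.

Lemma Ex_clip_B_edge i i' :
  Ex cP (fun w => clip 0 H (x_B X i i' w) * (x_edge X i' i w)%:R) =
  bta (j i) (j i') * ep i' i.
Proof.
have bc := bounded_clip (ltW (p_H_gt0 p)).
rewrite -Ex_edge -(Ex_clip_B i i').
apply: (@Ex_mul_indep _ _ _ cP (clip 0 H \o x_B X i i')).
- exact: (bounded_rv_comp bc (measurable_funPT (x_B X i i'))).
- exact: bounded_rv_bool.
move=> A A' mA mA'.
apply: (@edge_event_indep i i' (clip 0 H @^-1` A) [set b : bool | A' b%:R]).
by rewrite -[_ @^-1` _]setTI; exact: measurable_clip.
Qed.

Lemma Ex_weight i i' : Ex cP (weight i i') = bta (j i) (j i') * ep i' i.
Proof.
rewrite -Ex_clip_B_edge /weight; case: (boolP (keep i i')) => [k|nk].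
  by apply: eq_Ex => w; rewrite mulr1.
rewrite (_ : (fun w => _) = fun=> 0); last by apply/funext => w; rewrite mulr0.
rewrite Ex_cst Ex_clip_B_edge; apply/esym/eqP; rewrite mulf_eq0.
have : bta (j i) (j i') * p_kappa p (j i') (j i) == 0.
  by rewrite eq_le leNgt nk mulr_ge0 ?beta_ge0 ?p_kappa_ge0.
rewrite mulf_eq0 => /orP[->//|/eqP k0]; apply/orP; right.
by rewrite /edge_prob k0 !mul0r min_l.
Qed.

Lemma cP_null (A : set Omega) : measurable A -> cP A = 0%E -> {ae cP, forall w, ~ A w}.
Proof. by move=> mA A0; exists A; split => // w /= /contrapT. Qed.

Lemma B_range (i i' : 'I_n) : {ae cP, forall w, 0 <= x_B X i i' w <= H}.
Proof.
have mI : measurable [set x : measurableTypeR R | 0 <= x <= H].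
  rewrite (_ : [set x | _] = `[0, H]%classic); first exact: measurable_itv.
  by apply/seteqP; split => x /=; rewrite in_itv.
have mC := measurableC mI.
have := @cP_null (x_B X i i' @^-1` (~` [set x | 0 <= x <= H])).
have EE : x_B X i i' @^-1` (~` [set x | 0 <= x <= H]) =
    edge_event (i, i') (edge_param setT (~` [set x | 0 <= x <= H])).
  by apply/seteqP; split => w //= -[].
have -> : cP (x_B X i i' @^-1` (~` [set x | 0 <= x <= H])) = 0%E.
  rewrite EE edge_marginal; last exact: ok_edge_param.
  rewrite /edge_factor /= edge_massT mul1r.
  have /= -> := @probability_setC _ _ _ (p_G p (j i) (j i')) _ mI.
  by have /= -> := p_G_supp p (j i) (j i'); rewrite subee.
move=> /(_ (measurable_funPTI (x_B X i i') mC) erefl).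
by apply: filterS => w /= /contrapT.
Qed.

(** A discarded pair has a nonnegative weight of mean zero, hence a null
    weight. *)
Lemma weight_ae i i' : {ae cP, forall w,
  weight i i' w = x_B X i i' w * (x_edge X i' i w)%:R}.
Proof.
have bc := bounded_clip (ltW (p_H_gt0 p)).
have bCB : bounded_rv (fun w => clip 0 H (x_B X i i' w) * (x_edge X i' i w)%:R : R).
  apply: (bounded_rvM (bounded_rv_comp bc (measurable_funPT (x_B X i i')))).
  exact: bounded_rv_bool.
case: (boolP (keep i i')) => [k|nk].
  apply: filterS (B_range i i') => w BH.
  by rewrite /weight k mulr1 clip_id.
have E0 : Ex cP (fun w => clip 0 H (x_B X i i' w) * (x_edge X i' i w)%:R) = 0.
  rewrite Ex_clip_B_edge -Ex_weight /weight (negbTE nk).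
  by rewrite (_ : (fun w => _) = fun=> 0) ?Ex_cst//; apply/funext => w; rewrite mulr0.
have ge0 w : 0 <= clip 0 H (x_B X i i' w) * (x_edge X i' i w)%:R.
  by rewrite mulr_ge0//; have /andP[] := clip_bnd (x_B X i i' w) (ltW (p_H_gt0 p)).
apply: filterS2 (B_range i i') (Ex_eq0_ae bCB ge0 E0) => w BH.
by rewrite /weight (negbTE nk) mulr0 clip_id.
Qed.

Local Notation c := (p_c p).
Local Notation dd := (p_d p).

(** The signal d Z + c Q 1(isolated) and the term c Q 1(isolated) are both at
    most 1 in absolute value, so d Z is at most 2. *)
Definition media_bound : R := 2 / dd.

Lemma media_bound_ge0 : 0 <= media_bound.
Proof. by have /andP[d0 _] := p_d01 p; rewrite /media_bound divr_ge0// ltW. Qed.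

Definition media_signal (i : 'I_n) k q w := clip (- media_bound) media_bound (tnth (x_Z X i k w) q).
Definition belief (i : 'I_n) q w := clip (- 1) 1 (tnth (x_Q X i w) q).
Definition isolated (i : 'I_n) w : R := (indeg X i w == 0%N)%:R.
Definition signal i k q w : R :=
  dd * media_signal i k q w + c * (belief i q w * isolated i w).
Definition initial (i : 'I_n) q w := clip (- 1) 1 (tnth (x_R0 X i w) q).

Lemma isolatedE i w : isolated i w = \prod_i' (1 - (x_edge X i' i w)%:R).
Proof.
rewrite /isolated /indeg sum_nat_eq0.
case: (boolP [forall i', _]) => [/forallP e0|].
  rewrite big1// => i' _; have := e0 i'; rewrite /= eqb0 => /negbTE ->.
  by rewrite subr0.
rewrite negb_forall => /existsP[i']; rewrite /= eqb0 negbK => e1.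
by rewrite (bigD1 i')//= e1 subrr mul0r.
Qed.

Lemma isolated_factor_block (i i' : 'I_n) :
  block_rv media_system (pred1 (inl (i, i'))) (fun w => 1 - (x_edge X i' i w)%:R : R).
Proof.
apply: block_rvB; first exact: block_rv_cst.
by apply: bounded_rv_bool; exact: (edge_block media_blocks).
Qed.

(** Isolation is decided by the edges pointing to [i], which belong to the row
    of [i]: signals therefore stay measurable for the row of their vertex. *)
Lemma isolated_block i : block_rv media_system
  (fun b => match b with inl q => q.1 == i | inr _ => false end) (isolated i).
Proof.
rewrite (_ : isolated i = fun w => \prod_i' (1 - (x_edge X i' i w)%:R)); last first.
  by apply/funext => w; rewrite isolatedE.
apply: block_rv_prod => i' _ _; apply: (block_rv_sub media_blocks _ (isolated_factor_block i i')).
by move=> b /eqP ->; rewrite unfold_in /= eqxx.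
Qed.

(** The number of incoming edges of a vertex is governed by independent edges,
    so the probability of isolation depends on the community of the vertex only. *)
Lemma Ex_isolated i : Ex cP (isolated i) = \prod_i' (1 - ep i' i).
Proof.
rewrite (_ : isolated i = fun w => \prod_i' (1 - (x_edge X i' i w)%:R)); last first.
  by apply/funext => w; rewrite isolatedE.
rewrite (Ex_block_prod media_blocks (S := fun i' => pred1 (inl (i, i'))) (index_enum_uniq _)).
- apply: eq_bigr => i' _; rewrite -Ex_edge.
  have be : bounded_rv (fun w => (x_edge X i' i w)%:R : R) by exact: bounded_rv_bool.
  have -> : (fun w => 1 - (x_edge X i' i w)%:R : R) =
            fun w => 1 + (-1) * (x_edge X i' i w)%:R.
    by apply/funext => w; rewrite mulN1r.
  by rewrite (ExD cP (bounded_rv_cst _ 1) (bounded_rvZ (-1) be)) Ex_cst ExZ// mulN1r.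
- by move=> i1 i2 b _ _ /eqP -> /eqP[].
- by move=> i' _; exact: isolated_factor_block.
Qed.

Lemma bounded_clip_tnth (M : R) q : 0 <= M ->
  bounded_rv (fun x : vec R l => clip (- M) M (tnth x q)).
Proof.
move=> M0; apply: (@bounded_rv_comp _ _ _ _ (clip (- M) M) (fun x : vec R l => tnth x q)).
  by apply: bounded_clip; lra.
exact: measurable_tnth.
Qed.

Lemma media_signal_block i k q : block_rv media_system (pred1 (inr i)) (media_signal i k q).
Proof.
apply: (bounded_rv_comp (bounded_clip_tnth q media_bound_ge0)).
apply: (block_measurable_fun media_blocks (b := inr i)); first by rewrite /= eqxx.
move=> T mT; exists ((setT, setT), (setT, k.+1, fun k' => if k' == k then T else setT)).
  by split => [||k'] /=; [exact: measurableT..|case: ifP].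
apply/seteqP; split => w /=.
  by move=> Tw; split=> // k' _; case: eqP => // ->.
by move=> [_ /(_ k (ltnSn k))]; rewrite eqxx.
Qed.

Lemma belief_block i q : block_rv media_system (pred1 (inr i)) (belief i q).
Proof.
apply: (bounded_rv_comp (bounded_clip_tnth q ler01)).
apply: (block_measurable_fun media_blocks (b := inr i)); first by rewrite /= eqxx.
move=> U mU; exists ((setT, setT), (U, 0%N, fun=> setT)).
  by split => [||k'] /=; [exact: measurableT|exact: mU|].
by apply/seteqP; split => w //= -[].
Qed.

Lemma initial_block i q : block_rv initial_system (pred1 (inr i)) (initial i q).
Proof.
apply: (bounded_rv_comp (bounded_clip_tnth q ler01)).
apply: (block_measurable_fun initial_blocks (b := inr i)); first by rewrite /= eqxx.
move=> U mU; exists ((setT, setT), (U, 0%N, fun=> setT)) => //.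
by split => [||k'] /=; [exact: measurableT|exact: mU|].
Qed.

Lemma signal_row i k q : block_rv media_system (@row_blocks n i) (signal i k q).
Proof.
have sub1 : {subset pred1 (inr i) <= @row_blocks n i}.
  by move=> b /eqP ->; rewrite unfold_in /= eqxx.
apply: block_rvD; apply: block_rvZ.
  exact: (block_rv_sub media_blocks sub1 (media_signal_block i k q)).
apply: block_rvM.
  exact: (block_rv_sub media_blocks sub1 (belief_block i q)).
apply: (block_rv_sub media_blocks _ (isolated_block i)).
by case=> [e|i']; rewrite !unfold_in.
Qed.

Lemma signal_bnd i k q w : `|signal i k q w| <= 3.
Proof.
have /andP[d0 _] := p_d01 p; have /andP[c0 c1] := p_c01 p.
have hz := clip_norm (tnth (x_Z X i k w) q) media_bound_ge0.
have hq := clip_norm (tnth (x_Q X i w) q) ler01.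
have -> : (3 : R) = 2 + 1 by ring.
apply: le_trans (ler_normD _ _) _; apply: lerD.
  rewrite normrM gtr0_norm//; apply: (@le_trans _ _ (dd * media_bound)).
    by rewrite ler_wpM2l// ltW.
  by rewrite /media_bound mulrCA divff ?mulr1// gt_eqF.
rewrite !normrM ger0_norm// -[leRHS]mulr1 ler_pM//.
rewrite -[leRHS]mulr1 ler_pM// /isolated.
by case: (_ == _); rewrite ?normr1 ?normr0.
Qed.

Lemma initial_bnd i q w : `|initial i q w| <= 1.
Proof. exact: clip_norm. Qed.

Lemma eq_Q_law (f : vec R l -> R) i i' : bounded_rv f -> j i = j i' ->
  Ex cP (f \o x_Q X i) = Ex cP (f \o x_Q X i').
Proof.
move=> bf jj; apply: eq_law_Ex.
- exact: (bounded_rv_comp bf (measurable_funPT (x_Q X i))).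
- exact: (bounded_rv_comp bf (measurable_funPT (x_Q X i'))).
move=> A mA; have mfA : measurable (f @^-1` A).
  by rewrite -[_ @^-1` _]setTI; case: bf => mf _; exact: mf.
by have /= := Q_marginal i mfA; rewrite jj -(Q_marginal i' mfA).
Qed.

(** The law of a media signal is the mixture of the kernel over the law of the
    belief, which is the same within a community and at all times. *)
Lemma eq_Z_law (f : vec R l -> R) i i' k k' : bounded_rv f -> j i = j i' ->
  Ex cP (f \o x_Z X i k) = Ex cP (f \o x_Z X i' k').
Proof.
move=> bf jj; apply: eq_law_Ex.
- exact: (bounded_rv_comp bf (measurable_funPT (x_Z X i k))).
- exact: (bounded_rv_comp bf (measurable_funPT (x_Z X i' k'))).
move=> A mA; have mfA : measurable (f @^-1` A).
  by rewrite -[_ @^-1` _]setTI; case: bf => mf _; exact: mf.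
have /= -> := Z_marginal i k mfA; have /= -> := Z_marginal i' k' mfA.
congr EFin; rewrite -jj.
exact: (eq_Q_law (bounded_media (j i) mfA) jj).
Qed.

Lemma eq_R0_law (f : vec R l -> R) i i' : bounded_rv f -> j i = j i' ->
  Ex cP (f \o x_R0 X i) = Ex cP (f \o x_R0 X i').
Proof.
move=> bf jj; apply: eq_law_Ex.
- exact: (bounded_rv_comp bf (measurable_funPT (x_R0 X i))).
- exact: (bounded_rv_comp bf (measurable_funPT (x_R0 X i'))).
move=> A mA; have mfA : measurable (f @^-1` A).
  by rewrite -[_ @^-1` _]setTI; case: bf => mf _; exact: mf.
have m1 := measurable_funPTI (x_R0 X i) mfA.
have m2 := measurable_funPTI (x_R0 X i') mfA.
have /= -> := cond_probE atom_measurable At0 m1.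
have /= -> := cond_probE atom_measurable At0 m2.
by congr (fine _ / _)%:E; have /= := R0_ident hX mfA jj.
Qed.

Lemma Ex_signal i i' k k' q : j i = j i' ->
  Ex cP (signal i k q) = Ex cP (signal i' k' q).
Proof.
move=> jj.
have ExS i1 k1 : Ex cP (signal i1 k1 q) =
    dd * Ex cP (media_signal i1 k1 q) + c * (Ex cP (belief i1 q) * Ex cP (isolated i1)).
  have bz := block_rvW media_blocks (media_signal_block i1 k1 q).
  have bb := belief_block i1 q; have bi := isolated_block i1.
  have bbi := bounded_rvM (block_rvW media_blocks bb) (block_rvW media_blocks bi).
  rewrite (ExD cP (bounded_rvZ dd bz) (bounded_rvZ c bbi)) (ExZ cP dd bz) (ExZ cP c bbi).
  congr (_ + _ * _); apply: (Ex_block_mul media_blocks _ bb bi).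
  by case=> [e|i2]; rewrite //= => /eqP.
rewrite !ExS; congr (_ * _ + _ * (_ * _)).
- exact: (eq_Z_law k k' (bounded_clip_tnth q media_bound_ge0) jj).
- exact: (eq_Q_law (bounded_clip_tnth q ler01) jj).
- by rewrite !Ex_isolated; apply: eq_bigr => i1 _; rewrite /edge_prob jj.
Qed.

Lemma Ex_initial i i' q : j i = j i' -> Ex cP (initial i q) = Ex cP (initial i' q).
Proof. by move=> jj; exact: (eq_R0_law (bounded_clip_tnth q ler01) jj). Qed.

Lemma Q_cube (i : 'I_n) : {ae cP, forall w, cube (x_Q X i w)}.
Proof.
have mC : measurable (@cube R l).
  apply: measurable_forall => q.
  rewrite (_ : (fun x => _) = (fun x : vec R l => tnth x q) @^-1` `[-1, 1]%classic).
    rewrite -[_ @^-1` _]setTI; apply: measurable_tnth => //; exact: measurable_itv.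
  by apply/seteqP; split => x /=; rewrite in_itv/= ler_norml.
have mC' := measurableC mC.
have := @cP_null (x_Q X i @^-1` (~` cube)) (measurable_funPTI (x_Q X i) mC').
have /= -> := Q_marginal i mC'.
have /= -> := @probability_setC _ _ _ (p_F p (j i)) _ mC.
have /= -> := p_F_supp p (j i); rewrite subee//= => /(_ erefl).
by apply: filterS => w /= /contrapT.
Qed.

Lemma initial_ae i : {ae cP, forall w, forall q, initial i q w = tnth (x_R0 X i w) q}.
Proof.
apply: filterS (cond_prob_ae atom_measurable At0 (R0_bounded hX i)) => w [_ Rw] q.
by apply: clip_id; rewrite -ler_norml; exact: Rw.
Qed.

(** The media signal itself is only controlled through the bound on the
    external signal: d Z is the difference of two terms bounded by 1. *)
Lemma signal_ae i k : {ae cP, forall w, forall q, signal i k q w = Wmx p X n k w i q}.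
Proof.
have /andP[d0 _] := p_d01 p; have /andP[c0 c1] := p_c01 p.
apply: filterS2 (cond_prob_ae atom_measurable At0 (W_bounded hX i k)) (Q_cube i).
move=> w [_ Ww] Qw q; have Qwq := Qw q.
rewrite mxE /signal /belief clip_id -?ler_norml// mulrA /isolated.
congr (dd * _ + _); apply: clip_id; rewrite -ler_norml.
have := Ww q; rewrite mxE -/(isolated i w) => Wq.
rewrite /media_bound ler_pdivlMr// mulrC -[X in X * `|_|](gtr0_norm d0) -normrM.
set z := dd * _ in Wq *; set y := c * _ * _ in Wq.
have y1 : `|y| <= 1.
  rewrite /y !normrM ger0_norm// -[leRHS]mulr1 ler_pM ?mulr_ge0//; last first.
    by rewrite /isolated; case: (_ == _); rewrite ?normr1 ?normr0.
  by rewrite -[leRHS]mulr1 ler_pM.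
rewrite -[z](addrK y); apply: le_trans (ler_normB _ _) _.
have -> : (2 : R) = 1 + 1 by ring.
by rewrite lerD.
Qed.

Lemma cond_prob_aeW (Q : Omega -> Prop) : {ae cP, forall w, Q w} ->
  {ae P, forall w, At w -> Q w}.
Proof.
move=> [N [mN N0 QN]]; exists (At `&` N); split.
- by apply: measurableI => //; exact: atom_measurable.
- have qP := fine_P_gt0 atom_measurable At0.
  have := cond_probE atom_measurable At0 mN; rewrite /= N0 => -[/esym/eqP].
  rewrite mulf_eq0 invr_eq0 [X in _ || X]gt_eqF// orbF => /eqP PN.
  rewrite -[LHS]fineK ?PN// fin_num_measure//.
  by apply: measurableI => //; exact: atom_measurable.
- move=> w /= /not_implyP[Aw nQ]; split=> //; exact: QN.
Qed.

(** The conditional mean on an atom is an expectation under the conditional law,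
    where a variable may be replaced by an almost surely equal bounded one. *)
Lemma En_Ex (f g : Omega -> R) w : At w -> measurable_fun setT f -> bounded_rv g ->
  {ae cP, forall w, f w = g w} -> En X n f w = (Ex cP g)%:E.
Proof.
move=> Aw mf bg fg; rewrite /En (_ : labels X n w = j)//.
rewrite -(Ex_cond_prob atom_measurable At0 bg); congr (_ * _)%E.
apply: ae_eq_integral.
- exact: atom_measurable.
- by apply/measurable_EFinP; exact: measurable_funTS.
- by apply/measurable_EFinP; apply: measurable_funTS; case: bg.
- by apply: filterS (cond_prob_aeW fg) => w' fgw' Aw'; rewrite fgw'.
Qed.

Lemma measurable_isolated i : measurable_fun setT (isolated i).
Proof. by have [] := block_rvW media_blocks (isolated_block i). Qed.

Lemma measurable_tnth_rv (Y : {RV P >-> vec R l}) q :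
  measurable_fun setT (fun w => tnth (Y w) q : R).
Proof.
move=> _ B mB; rewrite setTI.
have mT : measurable ((fun x : vec R l => tnth x q) @^-1` B).
  by rewrite -[_ @^-1` _]setTI; apply: measurable_tnth.
exact: (measurable_funPTI Y mT).
Qed.

Lemma measurable_Wmx k i q : measurable_fun setT (fun w => Wmx p X n k w i q).
Proof.
rewrite (_ : (fun w => _) = fun w => dd * tnth (x_Z X i k w) q +
    c * tnth (x_Q X i w) q * isolated i w); last first.
  by apply/funext => w; rewrite mxE.
apply: measurable_funD; apply: measurable_funM => //.
- exact: measurable_tnth_rv.
- by apply: measurable_funM => //; exact: measurable_tnth_rv.
- exact: measurable_isolated.
Qed.

Definition signal_mean : 'M[R]_(K, l) := \matrix_(r, q)
  if [pick i | j i == r] is Some i then Ex cP (signal i 0 q) else 0.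
Definition initial_mean : 'M[R]_(K, l) := \matrix_(r, q)
  if [pick i | j i == r] is Some i then Ex cP (initial i q) else 0.

Lemma signal_meanE i k q : signal_mean (j i) q = Ex cP (signal i k q).
Proof.
rewrite mxE; case: pickP => [i' /eqP jj|/(_ i)]; last by rewrite eqxx.
exact: Ex_signal.
Qed.

Lemma initial_meanE i q : initial_mean (j i) q = Ex cP (initial i q).
Proof.
rewrite mxE; case: pickP => [i' /eqP jj|/(_ i)]; last by rewrite eqxx.
exact: Ex_initial.
Qed.

Lemma Ex_norm_le (f : Omega -> R) M : bounded_rv f -> (forall w, `|f w| <= M) ->
  `|Ex cP f| <= M.
Proof.
move=> bf fM; rewrite ler_norml; apply/andP; split.
  rewrite -[leLHS](Ex_cst cP); apply: le_Ex => //; first exact: bounded_rv_cst.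
  by move=> w; have /ler_normlP[] := fM w; rewrite lerNl.
rewrite -[leRHS](Ex_cst cP); apply: le_Ex => //; first exact: bounded_rv_cst.
by move=> w; exact: le_trans (ler_norm _) (fM w).
Qed.

Lemma signal_mean_bnd r q : `|signal_mean r q| <= 3.
Proof.
rewrite mxE; case: pickP => [i _|_]; last by rewrite normr0.
apply: Ex_norm_le (signal_bnd i 0 q).
exact: (block_rvW media_blocks (signal_row i 0 q)).
Qed.

Lemma initial_mean_bnd r q : `|initial_mean r q| <= 1.
Proof.
rewrite mxE; case: pickP => [i _|_]; last by rewrite normr0.
apply: Ex_norm_le (initial_bnd i q).
exact: (block_rvW initial_blocks (initial_block i q)).
Qed.

(** The community means chosen through an arbitrary representative do not depend
    on it, since signals within a community have the same mean. *)
Lemma WbarE w : At w -> Wbar p X n w = signal_mean.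
Proof.
move=> Aw; apply/matrixP => r q; rewrite !mxE (_ : labels X n w = j)//.
case: pickP => [i _|//].
rewrite (@En_Ex _ (signal i 0 q) w Aw (measurable_Wmx 0 i q))//.
  exact: (block_rvW media_blocks (signal_row i 0 q)).
by apply: filterS (signal_ae i 0) => w' ->.
Qed.

Lemma RbarE w : At w -> Rbar X n w = initial_mean.
Proof.
move=> Aw; apply/matrixP => r q; rewrite !mxE (_ : labels X n w = j)//.
case: pickP => [i _|//].
rewrite (@En_Ex _ (initial i q) w Aw)//.
- rewrite (_ : (fun w => _) = fun w => tnth (x_R0 X i w) q); last first.
    by apply/funext => w'; rewrite mxE.
  exact: measurable_tnth_rv.
- exact: (block_rvW initial_blocks (initial_block i q)).
- by apply: filterS (initial_ae i) => w' ->; rewrite mxE.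
Qed.

Local Notation a := (1 - c - dd).

Fixpoint signal_noise q k i w : R :=
  if k is k'.+1 then (signal i k q w - signal_mean (j i) q) + a * signal_noise q k' i w
  else 0.

Definition initial_noise q k i w : R :=
  a ^+ k * (initial i q w - initial_mean (j i) q).

Definition mean_path q k s : R :=
  mean_opinion a c (Mmx p) signal_mean initial_mean k s q.

(** The solution of the error recursion driven by the fluctuations [Y] and the
    mean path [y].  The recursion is linear in the pair, which allows the total
    error to be split according to the two systems of blocks. *)
Fixpoint error_process (Y : nat -> 'I_n -> Omega -> R) (y : nat -> 'I_K -> R)
    k i w : R :=
  if k is k'.+1 then
    a * error_process Y y k' i w +
    c * \sum_i' weight_mx weight i i' w * error_process Y y k' i' w +
    c * (noise weight Y k' i w + avg_error j weight (fun r s => Mmx p r s) y k' i w)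
  else 0.

Definition total_error q k i w : R :=
  error_process (signal_noise q) (mean_path q) k i w +
  error_process (initial_noise q) (fun _ _ => 0) k i w.

Definition approx_form k w : 'M[R]_(n, l) :=
  fluctuation j a signal_mean initial_mean (fun k => Wmx p X n k w) (R0mx X n w) k +
  lift_rows j (mean_opinion a c (Mmx p) signal_mean initial_mean k).

Lemma approx_atomE k w : At w -> approx_process p X n k w = approx_form k w.
Proof.
move=> Aw; have jE : labels X n w = j by [].
rewrite /approx_form -approx_split /approx_process WbarE// RbarE//; case: k => // k.
by apply/matrixP => i q; rewrite !mxE jE.
Qed.

(** Subtracting the two recursions: the opinions of the neighbours are replaced
    by their error, their fluctuation and their community mean; the second gives
    [noise], the third minus its mean-field value gives [avg_error]. *)
Lemma error_decomposition w k i q : At w ->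
  (forall i i', weight i i' w = x_B X i i' w * (x_edge X i' i w)%:R) ->
  (forall i k q, signal i k q w = Wmx p X n k w i q) ->
  (forall i q, initial i q w = tnth (x_R0 X i w) q) ->
  opinion_process p X n k w i q - approx_process p X n k w i q = total_error q k i w.
Proof.
move=> Aw wE sE rE.
set fl := fluctuation j a signal_mean initial_mean (fun k => Wmx p X n k w) (R0mx X n w).
set mo := mean_opinion a c (Mmx p) signal_mean initial_mean.
have apE k' : approx_process p X n k' w = fl k' + lift_rows j (mo k').
  exact: approx_atomE.
have flE k' i1 q1 : fl k' i1 q1 = signal_noise q1 k' i1 w + initial_noise q1 k' i1 w.
  elim: k' => [|k' IH] /=.
    by rewrite !mxE /initial_noise expr0 mul1r add0r -rE mxE.
  rewrite mxE [X in X + _]mxE [X in _ + X]mxE -/(fl k') IH.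
  by rewrite sE [(- lift_rows _ _) _ _]mxE [lift_rows _ _ _ _]mxE /initial_noise exprS; ring.
have CE i1 i2 : Cmx X n w i1 i2 = weight_mx weight i1 i2 w.
  rewrite mxE /weight_mx -wE.
  have -> // : inweight X i1 w = total_weight weight i1 w.
  by apply: eq_bigr => i3 _; rewrite wE.
elim: k i => [|k IH] i.
  by rewrite /= subrr /total_error /= addr0.
have opE i1 : opinion_process p X n k w i1 q =
    total_error q k i1 w + (signal_noise q k i1 w + initial_noise q k i1 w +
      mean_path q k (j i1)).
  apply/eqP; rewrite -subr_eq; apply/eqP; rewrite -IH apE.
  by rewrite [in RHS]mxE flE [lift_rows _ _ _ _]mxE.
have -> : approx_process p X n k.+1 w i q = fl k.+1 i q +
    (c * \sum_s Mmx p (j i) s * mean_path q k s + signal_mean (j i) q + a * mean_path q k (j i)).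
  rewrite apE mxE; congr (_ + _); rewrite [LHS]mxE /= -/mo.
  rewrite mxE [X in X + _]mxE [X in X + _ + _]mxE [X in _ + X]mxE.
  by congr (_ * _ + _ + _); rewrite mxE.
have -> : opinion_process p X n k.+1 w i q =
    c * \sum_i' weight_mx weight i i' w * opinion_process p X n k w i' q +
    signal i k.+1 q w + a * opinion_process p X n k w i q.
  rewrite sE [LHS]mxE [X in X + _]mxE [X in _ + X]mxE; congr (_ + _ + _).
  by rewrite [LHS]mxE mxE; congr (_ * _); apply: eq_bigr => i' _; rewrite CE.
rewrite (eq_bigr (fun i' => weight_mx weight i i' w * total_error q k i' w +
    weight_mx weight i i' w * signal_noise q k i' w +
    weight_mx weight i i' w * initial_noise q k i' w +
    weight_mx weight i i' w * mean_path q k (j i'))); last first.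
  by move=> i' _; rewrite opE; ring.
rewrite flE opE !big_split/=.
rewrite [initial_noise q k.+1 i w]/initial_noise exprS -mulrA -/(initial_noise q k i w).
have av0 : avg_error j weight (fun r s => Mmx p r s) (fun _ _ => 0) k i w = 0.
  by rewrite /avg_error !big1 ?subr0// => s _; rewrite mulr0.
rewrite [total_error q k.+1 i w]/total_error /= av0 /noise /avg_error.
have -> : \sum_i' weight_mx weight i i' w * total_error q k i' w =
    \sum_i' weight_mx weight i i' w * error_process (signal_noise q) (mean_path q) k i' w +
    \sum_i' weight_mx weight i i' w * error_process (initial_noise q) (fun _ _ => 0) k i' w.
  by rewrite -big_split; apply: eq_bigr => i1 _; rewrite /total_error mulrDr.
rewrite /total_error.
ring.
Qed.

End JointLaw.

(** * Constants and the rate of a single error process *)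

Section RateConstants.
Context (R : realType) (K l : nat) (p : params R K l).
Local Notation c := (p_c p).
Local Notation dd := (p_d p).
Local Notation H := (p_H p).
Local Notation kappa := (p_kappa p).

(** Limit of the mean weight that a vertex of community [r] gives to community
    [s], at the scale theta; the entries of M are its normalized values. *)
Definition limit_weight r s : R := p_pi p s * beta p r s * kappa s r.

Definition least_denom : R :=
  \big[Num.min/1]_(r | 0 < M_denom p r) M_denom p r.

(** Common bound on the signals, their sums weighted by the powers of
    1 - c - d, and the mean path; the constant 6 bounds a clipped signal minus its
    mean. *)
Definition process_bound : R := 6 / dd.

Definition weight_cap : R := H * \sum_r \sum_s kappa r s.

(** Lower bound on the empirical normalization as soon as the empirical weights
    are close to their limits. *)
Definition half_denom : R := least_denom / 2.

Definition error_cap : R := Delta_bound dd process_bound.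

Definition small_rate : R :=
  (step_coef K H weight_cap half_denom process_bound +
   process_bound * K%:R * ((K%:R + 1) / least_denom)) / dd +
  2 * (1 + cdev K H weight_cap) / half_denom * ((error_cap + process_bound) / dd / dd).

(** The first term is the rate of the bounds of the network part; the second one
    makes the rate trivially sufficient, through [error_cap], whenever one of the
    smallness conditions of that part fails. *)
Definition error_rate : R := small_rate + error_cap *
  (2 * H + 4 * H * process_bound / half_denom + 2 * K%:R / least_denom).

Lemma dd_gt0 : 0 < dd. Proof. by have /andP[] := p_d01 p. Qed.
Lemma process_bound_gt0 : 0 < process_bound.
Proof. by rewrite /process_bound divr_gt0 ?dd_gt0. Qed.

Lemma least_denom_gt0 : 0 < least_denom.
Proof. by apply: lt_bigmin => // r. Qed.

Lemma least_denom_le r : 0 < M_denom p r -> least_denom <= M_denom p r.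
Proof. by move=> r0; rewrite /least_denom (bigminD1 r)// ge_min lexx. Qed.

Lemma limit_weight_ge0 r s : 0 <= limit_weight r s.
Proof.
by rewrite /limit_weight !mulr_ge0 ?p_kappa_ge0 ?beta_ge0// ltW// p_pi_gt0.
Qed.

Lemma M_denomE r : M_denom p r = \sum_s limit_weight r s. Proof. by []. Qed.

Lemma MmxE r s : Mmx p r s = limit_weight r s / M_denom p r * (0 < M_denom p r)%R%:R.
Proof. by rewrite mxE. Qed.

Lemma Mmx_ge0 r s : 0 <= Mmx p r s.
Proof.
rewrite MmxE mulr_ge0// mulr_ge0 ?limit_weight_ge0// invr_ge0 M_denomE.
by apply: sumr_ge0 => t _; exact: limit_weight_ge0.
Qed.

Lemma Mmx_sum r : \sum_s Mmx p r s <= 1.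
Proof.
under eq_bigr do rewrite MmxE.
rewrite -!mulr_suml -M_denomE; case: ltP => [r0|_]; last by rewrite mulr0.
by rewrite mulr1 divff// gt_eqF.
Qed.

Lemma kappa_le_sum r s : kappa r s <= \sum_r \sum_s kappa r s.
Proof.
apply: (@le_trans _ _ (\sum_s' kappa r s')).
  rewrite [leRHS](bigD1 s)//= lerDl; apply: sumr_ge0 => *; exact: p_kappa_ge0.
rewrite [leRHS](bigD1 r)//= lerDl; apply: sumr_ge0 => *.
by apply: sumr_ge0 => *; exact: p_kappa_ge0.
Qed.

Lemma ksum_ge0 : 0 <= \sum_r \sum_s kappa r s.
Proof. by apply: sumr_ge0 => *; apply: sumr_ge0 => *; exact: p_kappa_ge0. Qed.

Lemma weight_cap_ge0 : 0 <= weight_cap.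
Proof. by rewrite /weight_cap mulr_ge0 ?ksum_ge0// ltW// p_H_gt0. Qed.

Lemma half_denom_gt0 : 0 < half_denom.
Proof. by rewrite /half_denom divr_gt0// least_denom_gt0. Qed.

Lemma a_ge0 : 0 <= 1 - c - dd.
Proof. by have /andP[_ h] := p_cd p; lra. Qed.

Lemma a_le1 : 1 - c - dd <= 1.
Proof. by have /andP[h _] := p_c01 p; have := dd_gt0; lra. Qed.

End RateConstants.

Lemma mean_opinion_bnd (R : realType) (K l : nat) (p : params R K l)
    (Wb Rb : 'M[R]_(K, l)) (B : R) :
  (forall r q, `|Wb r q| <= p_d p * B) -> (forall r q, `|Rb r q| <= B) ->
  forall k r q, `|mean_opinion (1 - p_c p - p_d p) (p_c p) (Mmx p) Wb Rb k r q| <= B.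
Proof.
move=> WB RB; elim=> [|k IH] r q; first exact: RB.
have /andP[c0 _] := p_c01 p; have aa := a_ge0 p.
have B0 : 0 <= B := le_trans (normr_ge0 _) (RB r q).
rewrite /= mxE [X in X + _]mxE [X in X + _ + _]mxE [X in _ + X]mxE.
apply: le_trans (ler_normD _ _) _.
have -> : B = p_c p * B + p_d p * B + (1 - p_c p - p_d p) * B by ring.
apply: lerD; last by rewrite normrM ger0_norm// ler_wpM2l.
apply: le_trans (ler_normD _ _) _; apply: lerD => //.
rewrite normrM ger0_norm// ler_wpM2l// mxE.
apply: le_trans (ler_norm_sum _ _ _) _.
apply: (@le_trans _ _ (\sum_s Mmx p r s * B)).
  by apply: ler_sum => s _; rewrite normrM ger0_norm ?Mmx_ge0// ler_wpM2l ?Mmx_ge0.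
by rewrite -mulr_suml ler_piMl// Mmx_sum.
Qed.

Section ErrorBounds.
Context (R : realType) (K l : nat) (p : params R K l).
Context (dO : measure_display) (Omega : measurableType dO).
Context (P : probability Omega R) (X : data K l P) (hX : is_model p X).
Context (n : nat) (j : {ffun 'I_n -> 'I_K}).
Local Notation At := (atom X j).
Hypothesis At0 : P At != 0%E.
Hypothesis n_gt0 : (0 < n)%N.
Local Notation cP := (cond_prob P (atom_measurable X j)).
Local Notation theta := (p_theta p n).
Local Notation wt := (weight p X j).
Local Notation c := (p_c p).
Local Notation dd := (p_d p).
Local Notation a := (1 - c - dd).

(** The kernel seen through the edge probabilities: n / theta times the edge
    probability, equal to the kernel as long as no edge probability is cut at 1. *)
Definition sparse_kernel n' (s r : 'I_K) : R :=
  n'%:R / p_theta p n' * Num.min (p_kappa p s r * p_theta p n' / n'%:R) 1.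

(** The counterpart of [limit_weight] at size [n], given the labels. *)
Definition empirical_weight r s : R := pin j s * beta p r s * sparse_kernel n s r.

Lemma sparse_kernel_ge0 s r : 0 <= sparse_kernel n s r.
Proof.
have t0 := ltW (p_theta_gt0 p n).
rewrite /sparse_kernel mulr_ge0 ?divr_ge0// le_min ler01 andbT.
by rewrite divr_ge0// mulr_ge0// p_kappa_ge0.
Qed.

Lemma sparse_kernel_le s r : sparse_kernel n s r <= p_kappa p s r.
Proof.
have t0 := p_theta_gt0 p n; have n0 : (0 : R) < n%:R by rewrite ltr0n.
apply: (@le_trans _ _ (n%:R / theta * (p_kappa p s r * theta / n%:R))).
  by rewrite /sparse_kernel ler_wpM2l ?ge_min ?lexx// divr_ge0// ltW.
by rewrite le_eqVlt; apply/orP; left; apply/eqP; field; rewrite !gt_eqF.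
Qed.

Lemma pin_ge0 r : 0 <= (pin j r : R).
Proof. by rewrite /pin divr_ge0. Qed.

Lemma pin_le1 r : (pin j r : R) <= 1.
Proof.
rewrite /pin ler_pdivrMr ?ltr0n// mul1r ler_nat.
by apply: leq_trans (max_card _) _; rewrite card_ord.
Qed.

Lemma empirical_weight_ge0 r s : 0 <= empirical_weight r s.
Proof.
apply: mulr_ge0; last exact: sparse_kernel_ge0.
by apply: mulr_ge0; [exact: pin_ge0|exact: beta_ge0].
Qed.

Lemma empirical_weight_le r s : empirical_weight r s <= weight_cap p.
Proof.
rewrite /empirical_weight /weight_cap; apply: ler_pM.
- by apply: mulr_ge0; [exact: pin_ge0|exact: beta_ge0].
- exact: sparse_kernel_ge0.
- rewrite -[leRHS]mul1r; apply: ler_pM.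
  + exact: pin_ge0.
  + exact: beta_ge0.
  + exact: pin_le1.
  + exact: beta_le.
- exact: le_trans (sparse_kernel_le _ _) (kappa_le_sum _ _ _).
Qed.

Lemma mean_weightE i s : mean_weight cP j wt i s = theta * empirical_weight (j i) s.
Proof.
have t0 := p_theta_gt0 p n; have n0 : (0 : R) < n%:R by rewrite ltr0n.
have bw i' : bounded_rv (wt i i').
  apply: (block_rvW (media_blocks hX At0)).
  exact: (weight_block p (media_blocks hX At0)).
rewrite /mean_weight /community_weight Ex_sum//.
rewrite (eq_bigr (fun=> beta p (j i) s * Num.min (p_kappa p s (j i) * theta / n%:R) 1)).
  rewrite sumr_const /empirical_weight /pin /sparse_kernel -mulr_natr.
  by field; rewrite !gt_eqF.
by move=> i' /eqP <-; rewrite Ex_weight.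
Qed.

Context (gam0 : R).
Hypothesis gam0_ge0 : 0 <= gam0.
Hypothesis empirical_limit : forall r s,
  `|empirical_weight r s - limit_weight p r s| <= gam0.

Lemma mean_totalE i : mean_total cP j wt i = theta * \sum_s empirical_weight (j i) s.
Proof. by rewrite mulr_sumr; apply: eq_bigr => s _; exact: mean_weightE. Qed.

Lemma empirical_total r :
  `|\sum_s empirical_weight r s - M_denom p r| <= K%:R * gam0.
Proof.
rewrite M_denomE -sumrB; apply: le_trans (ler_norm_sum _ _ _) _.
apply: (@le_trans _ _ (\sum_(s < K) gam0)); first exact: ler_sum.
by rewrite sumr_const card_ord mulr_natl.
Qed.

Lemma inactive_weight i i' w : ~~ (0 < M_denom p (j i)) -> wt i i' w = 0.
Proof.
move=> nact; rewrite /weight (_ : keep p j i i' = false) ?mulr0//.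
apply/negbTE; rewrite /keep -leNgt -(pmulr_rle0 _ (p_pi_gt0 p (j i'))) mulrA.
apply: le_trans (_ : M_denom p (j i) <= 0); last by rewrite leNgt.
rewrite M_denomE (bigD1 (j i'))//= lerDl.
by apply: sumr_ge0 => s _; exact: limit_weight_ge0.
Qed.

(** Normalization is Lipschitz where the limit has a positive total, by
    [ratio_deviation]. *)
Lemma active_share r s : 0 < M_denom p r ->
  `|empirical_weight r s / (\sum_t empirical_weight r t) - Mmx p r s| <=
  (K%:R + 1) / least_denom p * gam0.
Proof.
move=> act; have l0 := least_denom_gt0 p; have ll := least_denom_le act.
have e0 : 0 <= empirical_weight r s <= \sum_t empirical_weight r t.
  rewrite empirical_weight_ge0 (bigD1 s)//= lerDl.
  by apply: sumr_ge0 => t _; exact: empirical_weight_ge0.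
have t0 : 0 <= limit_weight p r s <= M_denom p r.
  rewrite limit_weight_ge0 M_denomE (bigD1 s)//= lerDl.
  by apply: sumr_ge0 => t _; exact: limit_weight_ge0.
have := ratio_deviation e0 t0 act.
have -> : empirical_weight r s / (\sum_t empirical_weight r t) *
    (0 < \sum_t empirical_weight r t)%R%:R =
    empirical_weight r s / (\sum_t empirical_weight r t).
  case: ltP => [_|tle]; first by rewrite mulr1.
  have -> : empirical_weight r s = 0; last by rewrite !mul0r.
  by apply/le_anti; case/andP: e0 => -> /le_trans ->.
rewrite MmxE act mulr1 => /le_trans; apply.
have h : `|\sum_t empirical_weight r t - M_denom p r| +
    `|empirical_weight r s - limit_weight p r s| <= (K%:R + 1) * gam0.
  by have h1 := empirical_total r; have h2 := empirical_limit r s; lra.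
rewrite [leRHS]mulrAC; apply: ler_pM h _.
- exact: addr_ge0.
- by rewrite invr_ge0 ltW.
- by rewrite lef_pV2.
Qed.

Section System.
Context (G : 'I_n * 'I_n + 'I_n -> set (set Omega)) (GI : independent_blocks cP G).
Hypothesis GE : forall q, G (inl q) = [set A | exists2 th, ok_param th & A = edge_event X q th].
Context (Y : nat -> 'I_n -> Omega -> R) (y : nat -> 'I_K -> R).
Local Notation L := (process_bound p).
Hypothesis y_bnd : forall k s, `|y k s| <= L.
Hypothesis Y_row : forall k i, block_rv G (@row_blocks n i) (Y k i).
Hypothesis Y_bnd : forall k i x, `|Y k i x| <= L.
Hypothesis Y_mean : forall k i, Ex cP (Y k i) = 0.
Context (rho : R).
Hypothesis rho_gt0 : 0 < rho.
Hypothesis rho_theta : 2^-1 <= rho ^+ 2 * theta.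
Local Notation err := (error_process p X j Y y).

Let w_block i i' : block_rv G (pred1 (inl (i, i'))) (wt i i').
Proof. exact: (weight_block p GI GE). Qed.

Let acdd : a + c + dd = 1. Proof. by ring. Qed.

Let c_ge0 : 0 <= c. Proof. by have /andP[] := p_c01 p. Qed.

Lemma error_process_rv k i : bounded_rv (err k i).
Proof.
apply: (Delta_rv GI w_block (weight_bnd p X j) (lab := j)
  (m := fun r s => Mmx p r s) (Y := Y) (y := y) (a := a) (c := c)) => //.
Qed.

Lemma error_process_bnd k i x : `|err k i x| <= error_cap p.
Proof.
apply: (Delta_bnd (weight_bnd p X j) (lab := j)
  (m := fun r s => Mmx p r s) (Y := Y) (y := y) (a := a) (c := c)) => //.
- exact: a_ge0.
- exact: dd_gt0.
- exact: Mmx_ge0.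
- exact: Mmx_sum.
- exact: ltW (process_bound_gt0 p).
Qed.

Let gamma := (K%:R + 1) / least_denom p * gam0.

(** Instantiation of the network bounds; the three hypotheses make the
    exponential moments available and keep the normalizations bounded below. *)
Lemma small_regime : rho * p_H p <= 2^-1 ->
  4 * p_H p * L * rho <= half_denom p -> K%:R * gam0 <= half_denom p ->
  (forall k i, Ex cP (fun x => `|err k i x|) <=
    one_step_error K (p_H p) (half_denom p) (weight_cap p) gamma rho L / dd +
    return_error K (p_H p) (half_denom p) (weight_cap p) rho *
      ((Delta_bound dd L + L) / dd / dd)) /\
  (forall k, ln n%:R <= rho ^+ 2 * theta ->
    Ex cP (fun x => \big[Num.max/0]_i `|err k i x|) <=
    one_step_error K (p_H p) (half_denom p) (weight_cap p) gamma rho L / dd).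
Proof.
move=> rhoH rhoL Kgam.
have l0 := least_denom_gt0 p.
have h0 := half_denom_gt0 p.
have t0 := p_theta_gt0 p n.
have b0 := weight_cap_ge0 p.
have g0 : 0 <= gamma by rewrite /gamma mulr_ge0// divr_ge0 ?addr_ge0// ltW.
pose act r := 0 < M_denom p r.
have inw i i' w : ~~ act (j i) -> wt i i' w = 0 by exact: inactive_weight.
have inm r s : ~~ act r -> Mmx p r s = 0.
  by rewrite MmxE /act => /negbTE ->; rewrite mulr0.
have at_ i : act (j i) -> theta * half_denom p <= mean_total cP j wt i.
  move=> ai; rewrite mean_totalE ler_wpM2l ?(ltW t0)//.
  have /ler_normlP[h1 _] := empirical_total (j i).
  have := least_denom_le ai; have : least_denom p = half_denom p + half_denom p.
    by rewrite /half_denom; lra.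
  by lra.
have ar i s : act (j i) ->
    `|mean_weight cP j wt i s / mean_total cP j wt i - Mmx p (j i) s| <= gamma.
  move=> ai; rewrite mean_weightE mean_totalE -mulf_div divff ?gt_eqF// mul1r.
  exact: active_share.
have mw i s : mean_weight cP j wt i s <= theta * weight_cap p.
  by rewrite mean_weightE ler_wpM2l ?(ltW t0)// empirical_weight_le.
have L0 := ltW (process_bound_gt0 p).
split=> [k i|k nln].
  apply: (Ex_Delta GI w_block (p_H_gt0 p) (weight_bnd p X j) t0 h0 b0 g0
    inw inm at_ ar mw rho_gt0 rhoH rho_theta (a_ge0 p) c_ge0 (dd_gt0 p) acdd
    _ _ L0 rhoL y_bnd Y_row Y_bnd Y_mean) => //.
  - exact: Mmx_ge0.
  - exact: Mmx_sum.
apply: (Ex_max_Delta GI w_block (p_H_gt0 p) (weight_bnd p X j) t0 h0 b0 g0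
    inw inm at_ ar mw rho_gt0 rhoH rho_theta (a_ge0 p) c_ge0 (dd_gt0 p) acdd
    L0 rhoL y_bnd Y_row Y_bnd Y_mean) => //.
Qed.

(** Outside the regime of [small_regime], rho or gam0 is bounded below by a
    constant, and the deterministic bound on the error is at most a multiple of
    rho + gam0. *)
Theorem error_process_rate :
  (forall k i, Ex cP (fun x => `|err k i x|) <= error_rate p * (rho + gam0)) /\
  (forall k, ln n%:R <= rho ^+ 2 * theta ->
    Ex cP (fun x => \big[Num.max/0]_i `|err k i x|) <= error_rate p * (rho + gam0)).
Proof.
have l0 := least_denom_gt0 p.
have h0 := half_denom_gt0 p.
have b0 := weight_cap_ge0 p.
have L0 := ltW (process_bound_gt0 p); have dd0 := dd_gt0 p.
have H0 := ltW (p_H_gt0 p).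
have cd0 : 0 <= cdev K (p_H p) (weight_cap p).
  by rewrite /cdev; nonneg.
have ec0 : 0 <= error_cap p by rewrite /error_cap /Delta_bound; nonneg.
have step0 : 0 <= step_coef K (p_H p) (weight_cap p) (half_denom p) L.
  rewrite /step_coef; nonneg.
set lin := process_bound p * K%:R * ((K%:R + 1) / least_denom p).
set ret := 2 * (1 + cdev K (p_H p) (weight_cap p)) / half_denom p *
  ((error_cap p + L) / dd / dd).
have lin0 : 0 <= lin by rewrite /lin; nonneg.
have ret0 : 0 <= ret by rewrite /ret; nonneg.
have sr0 : 0 <= small_rate p.
  by rewrite /small_rate -/lin -/ret; nonneg.
set cut := 2 * p_H p + 4 * p_H p * L / half_denom p + 2 * K%:R / least_denom p.
have c1 : 0 <= 2 * p_H p by nonneg.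
have c2 : 0 <= 4 * p_H p * L / half_denom p by nonneg.
have c3 : 0 <= 2 * K%:R / least_denom p by nonneg.
have rE : error_rate p = small_rate p + error_cap p * cut by [].
have rg0 : 0 <= rho + gam0 by rewrite addr_ge0// ltW.
have rle : small_rate p * (rho + gam0) <= error_rate p * (rho + gam0).
  by rewrite ler_wpM2r// rE lerDl; nonneg.
have rho0 := ltW rho_gt0.
have one : one_step_error K (p_H p) (half_denom p) (weight_cap p) gamma rho L / dd =
    step_coef K (p_H p) (weight_cap p) (half_denom p) L / dd * rho + lin / dd * gam0.
  by rewrite one_step_errorE /lin /gamma; field; rewrite !gt_eqF.
have rett : return_error K (p_H p) (half_denom p) (weight_cap p) rho *
      ((Delta_bound dd L + L) / dd / dd) = ret * rho.
  by rewrite /return_error /ret -/(error_cap p); ring.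
have srE : small_rate p * (rho + gam0) =
    (step_coef K (p_H p) (weight_cap p) (half_denom p) L / dd * rho + lin / dd * gam0) +
    ret * rho + (step_coef K (p_H p) (weight_cap p) (half_denom p) L / dd * gam0 +
    lin / dd * rho + ret * gam0).
  by rewrite /small_rate -/lin -/ret; ring.
have x1 : 0 <= step_coef K (p_H p) (weight_cap p) (half_denom p) L / dd * gam0 by nonneg.
have x2 : 0 <= lin / dd * rho by nonneg.
have x3 : 0 <= ret * gam0 by nonneg.
have x4 : 0 <= ret * rho by nonneg.
have [/and3P[h1 h2 h3]|large] := boolP [&& rho * p_H p <= 2^-1,
    4 * p_H p * L * rho <= half_denom p & K%:R * gam0 <= half_denom p].
  have [e1 e2] := small_regime h1 h2 h3; rewrite one rett in e1; rewrite one in e2.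
  split=> [k i|k /e2]; last by move=> /(_ k) hk; apply: le_trans rle; lra.
  by apply: le_trans rle; have := e1 k i; lra.
have cutle : error_cap p <= error_rate p * (rho + gam0).
  apply: (@le_trans _ _ (error_cap p * (cut * (rho + gam0)))).
    rewrite ler_peMr//; move: large; rewrite !negb_and -!ltNge.
    have y1 : 0 <= 2 * p_H p * (rho + gam0) by nonneg.
    have y2 : 0 <= 4 * p_H p * L / half_denom p * (rho + gam0) by nonneg.
    have y3 : 0 <= 2 * K%:R / least_denom p * (rho + gam0) by nonneg.
    have -> : cut * (rho + gam0) = 2 * p_H p * (rho + gam0) +
       4 * p_H p * L / half_denom p * (rho + gam0) +
       2 * K%:R / least_denom p * (rho + gam0) by rewrite /cut; ring.
    case/or3P => lg.
    - suff : 1 <= 2 * p_H p * (rho + gam0) by lra.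
      by have : 0 <= p_H p * gam0 by [nonneg]; lra.
    - suff : 1 <= 4 * p_H p * L / half_denom p * (rho + gam0) by lra.
      rewrite mulrAC ler_pdivlMr// mul1r.
      have : 0 <= 4 * p_H p * L * gam0 by nonneg.
      by lra.
    - suff : 1 <= 2 * K%:R / least_denom p * (rho + gam0) by lra.
      rewrite mulrAC ler_pdivlMr// mul1r.
      have : 0 <= K%:R * rho by nonneg.
      by move: lg; rewrite /half_denom; lra.
  by rewrite mulrA ler_wpM2r// rE lerDr.
have cst f : bounded_rv f -> (forall x, f x <= error_cap p) ->
    Ex cP f <= error_rate p * (rho + gam0).
  move=> bf fM; apply: le_trans cutle; rewrite -[leRHS](Ex_cst cP).
  by apply: le_Ex => //; exact: bounded_rv_cst.
split=> [k i|k _]; apply: cst.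
- by apply: bounded_rv_norm; exact: error_process_rv.
- by move=> x; exact: error_process_bnd.
- by apply: bounded_rv_bigmax => i _; apply: bounded_rv_norm; exact: error_process_rv.
- by move=> x; apply: bigmax_le => // i _; exact: error_process_bnd.
Qed.

End System.
End ErrorBounds.

(** * Conditional means of the errors given the labels *)

Lemma sub_mxE (V : zmodType) m n (A B : 'M[V]_(m, n)) i q : (A - B) i q = A i q - B i q.
Proof. by rewrite !mxE. Qed.

Lemma sub_rowE (V : zmodType) m n (A B : 'M[V]_(m, n)) i q :
  (row i A - row i B) 0 q = A i q - B i q.
Proof. by rewrite !mxE. Qed.

Section AtomBounds.
Context (R : realType) (K l : nat) (p : params R K l).
Context (dO : measure_display) (Omega : measurableType dO).
Context (P : probability Omega R) (X : data K l P) (hX : is_model p X).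
Context (n : nat) (j : {ffun 'I_n -> 'I_K}).
Local Notation At := (atom X j).
Hypothesis At0 : P At != 0%E.
Hypothesis n_gt0 : (0 < n)%N.
Local Notation cP := (cond_prob P (atom_measurable X j)).
Local Notation theta := (p_theta p n).
Local Notation c := (p_c p).
Local Notation dd := (p_d p).
Local Notation a := (1 - c - dd).
Context (gam0 rho : R).
Hypothesis gam0_ge0 : 0 <= gam0.
Hypothesis empirical_limit : forall r s,
  `|empirical_weight p j r s - limit_weight p r s| <= gam0.
Hypothesis rho_gt0 : 0 < rho.
Hypothesis rho_theta : 2^-1 <= rho ^+ 2 * theta.

Let a0 : 0 <= a. Proof. exact: a_ge0. Qed.
Let dd0 : 0 < dd. Proof. exact: dd_gt0. Qed.
Let L0 : 6 <= process_bound p.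
Proof.
have /andP[_ d1] := p_d01 p.
by rewrite /process_bound ler_pdivlMr// -[leRHS]mulr1 ler_wpM2l.
Qed.

Lemma signal_centered q i k :
  Ex cP (fun x => signal p X i k q x - signal_mean p X j (j i) q) = 0.
Proof.
have b := block_rvW (media_blocks hX At0) (signal_row hX At0 i k q).
rewrite (ExD cP b (bounded_rv_cst _ _)) Ex_cst (signal_meanE hX At0 i k q).
exact: subrr.
Qed.

Lemma signal_noise_row q k i :
  block_rv (media_system X (n := n)) (@row_blocks n i) (signal_noise p X j q k i).
Proof.
elim: k => [|k IH]; first exact: block_rv_cst.
apply: block_rvD; last exact: block_rvZ.
by apply: block_rvB; [exact: (signal_row hX At0)|exact: block_rv_cst].
Qed.

(** The bound 6/d is preserved: 6 + (1 - c - d) 6/d <= 6/d. *)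
Lemma signal_noise_bnd q k i x : `|signal_noise p X j q k i x| <= process_bound p.
Proof.
elim: k => [|k IH] /=; first by rewrite normr0 (le_trans _ L0).
apply: le_trans (ler_normD _ _) _.
have h1 : `|signal p X i k.+1 q x - signal_mean p X j (j i) q| <= 6.
  apply: le_trans (ler_normB _ _) _.
  have -> : (6 : R) = 3 + 3 by ring.
  by rewrite lerD ?(signal_mean_bnd hX At0)// signal_bnd.
have h2 : `|a * signal_noise p X j q k i x| <= a * process_bound p.
  by rewrite normrM ger0_norm// ler_wpM2l.
have : 6 = dd * process_bound p by rewrite /process_bound mulrCA divff ?mulr1// gt_eqF.
have : 0 <= c * process_bound p.
  by rewrite mulr_ge0 ?(le_trans _ L0)//; have /andP[] := p_c01 p.
by lra.
Qed.

Lemma Ex_signal_noise q k i : Ex cP (signal_noise p X j q k i) = 0.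
Proof.
have bs k' := block_rvW (media_blocks hX At0) (signal_noise_row q k' i).
elim: k => [|k IH]; first exact: Ex_cst.
have b : bounded_rv (fun x => signal p X i k.+1 q x - signal_mean p X j (j i) q).
  apply: bounded_rvB; last exact: bounded_rv_cst.
  exact: (block_rvW (media_blocks hX At0) (signal_row hX At0 i k.+1 q)).
by rewrite /= (ExD cP b (bounded_rvZ a (bs k))) (ExZ cP a (bs k)) IH mulr0 addr0 signal_centered.
Qed.

Lemma initial_noise_row q k i :
  block_rv (initial_system X (n := n)) (@row_blocks n i) (initial_noise p X j q k i).
Proof.
apply: block_rvZ; apply: block_rvB; last exact: block_rv_cst.
apply: (block_rv_sub (initial_blocks hX At0) _ (initial_block hX At0 i q)).
by move=> b /eqP ->; rewrite unfold_in /= eqxx.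
Qed.

Lemma initial_noise_bnd q k i x : `|initial_noise p X j q k i x| <= process_bound p.
Proof.
rewrite /initial_noise normrM normrX ger0_norm//.
have h1 : `|initial X i q x - initial_mean X j (j i) q| <= 2.
  apply: le_trans (ler_normB _ _) _.
  have -> : (2 : R) = 1 + 1 by ring.
  by rewrite lerD ?(initial_mean_bnd hX At0)// initial_bnd.
apply: (@le_trans _ _ (1 * 2)); last by have := L0; lra.
apply: ler_pM => //; first exact: exprn_ge0.
exact: exprn_ile1 (a_le1 p).
Qed.

Lemma Ex_initial_noise q k i : Ex cP (initial_noise p X j q k i) = 0.
Proof.
have b := block_rvW (initial_blocks hX At0) (initial_block hX At0 i q).
rewrite /initial_noise ExZ; last by apply: bounded_rvB => //; exact: bounded_rv_cst.
rewrite (ExD cP b (bounded_rv_cst _ _)) Ex_cst (initial_meanE hX At0 i q).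
by rewrite subrr mulr0.
Qed.

Lemma mean_path_bnd q k s : `|mean_path p X j q k s| <= process_bound p.
Proof.
apply: mean_opinion_bnd => r q'.
  rewrite /process_bound mulrCA divff ?mulr1 ?gt_eqF//.
  by apply: le_trans (signal_mean_bnd hX At0 r q') _; lra.
by apply: le_trans (initial_mean_bnd hX At0 r q') _; have := L0; lra.
Qed.

Let terr := total_error p X j.

Let signal_err q := error_process p X j (signal_noise p X j q) (mean_path p X j q).
Let initial_err q := error_process p X j (initial_noise p X j q) (fun _ _ => 0).

Let bs q k i : bounded_rv (signal_err q k i).
Proof.
exact: (error_process_rv p (media_blocks hX At0) (fun=> erefl) _ (signal_noise_row q)).
Qed.

Let bi q k i : bounded_rv (initial_err q k i).
Proof.
exact: (error_process_rv p (initial_blocks hX At0) (fun=> erefl) _ (initial_noise_row q)).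
Qed.

Lemma total_error_rv q k i : bounded_rv (terr q k i).
Proof. exact: (bounded_rvD (bs q k i) (bi q k i)). Qed.

Let rate := error_rate p * (rho + gam0).

Let signal_rate q := error_process_rate hX At0 n_gt0 gam0_ge0 empirical_limit
  (media_blocks hX At0) (fun=> erefl) (mean_path_bnd q) (signal_noise_row q)
  (signal_noise_bnd q) (Ex_signal_noise q) rho_gt0 rho_theta.

Let zero_bnd (k : nat) (s : 'I_K) : `|0 : R| <= process_bound p.
Proof. by rewrite normr0 (le_trans _ L0). Qed.

Let initial_rate q := error_process_rate hX At0 n_gt0 gam0_ge0 empirical_limit
  (initial_blocks hX At0) (fun=> erefl) zero_bnd (initial_noise_row q)
  (initial_noise_bnd q) (Ex_initial_noise q) rho_gt0 rho_theta.

Lemma Ex_total_error q k i : Ex cP (fun x => `|terr q k i x|) <= 2 * rate.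
Proof.
have b1 := bounded_rv_norm (bs q k i); have b2 := bounded_rv_norm (bi q k i).
have [/(_ k i) s1 _] := signal_rate q; have [/(_ k i) s2 _] := initial_rate q.
apply: (@le_trans _ _ (Ex cP (fun x => `|signal_err q k i x| + `|initial_err q k i x|))).
  apply: le_Ex; [exact: (bounded_rv_norm (total_error_rv q k i))|exact: bounded_rvD|].
  by move=> x; exact: ler_normD.
by rewrite (ExD cP b1 b2) mulr2n mulrDl mul1r lerD.
Qed.

Lemma Ex_max_total_error q k : ln n%:R <= rho ^+ 2 * theta ->
  Ex cP (fun x => \big[Num.max/0]_i `|terr q k i x|) <= 2 * rate.
Proof.
move=> nln.
have bm (f : 'I_n -> Omega -> R) : (forall i, bounded_rv (f i)) ->
    bounded_rv (fun x => \big[Num.max/0]_(i < n) `|f i x|).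
  by move=> bf; apply: bounded_rv_bigmax => i _; exact: bounded_rv_norm.
have b1 := bm _ (bs q k); have b2 := bm _ (bi q k).
have [_ /(_ k nln) s1] := signal_rate q; have [_ /(_ k nln) s2] := initial_rate q.
apply: (@le_trans _ _ (Ex cP (fun x => \big[Num.max/0]_i `|signal_err q k i x| +
    \big[Num.max/0]_i `|initial_err q k i x|))).
  apply: le_Ex; [exact: bm (total_error_rv q k)|exact: bounded_rvD|].
  move=> x; apply: bigmax_le; first by rewrite addr_ge0// bigmax_ge_id.
  move=> i _; apply: le_trans (ler_normD _ _) _; apply: lerD.
    exact: (le_bigmax 0 (fun i => `|signal_err q k i x|)).
  exact: (le_bigmax 0 (fun i => `|initial_err q k i x|)).
by rewrite (ExD cP b1 b2) mulr2n mulrDl mul1r lerD.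
Qed.

(** On the atom, all clipped variables coincide almost surely with the original
    ones, at all times simultaneously. *)
Lemma total_error_ae k : {ae cP, forall w, forall i q,
  opinion_process p X n k w i q - approx_form p X j k w i q = terr q k i w}.
Proof.
have wE : {ae cP, forall w, forall i i',
    weight p X j i i' w = x_B X i i' w * (x_edge X i' i w)%:R}.
  apply: filter_forall => i; apply: filter_forall => i'.
  exact: (weight_ae hX At0 i i').
have sE : {ae cP, forall w, forall i k q, signal p X i k q w = Wmx p X n k w i q}.
  apply: filter_forall => i; apply: ae_foralln => k'.
  exact: (signal_ae hX At0 i k').
have rE : {ae cP, forall w, forall (i : 'I_n) q, initial X i q w = tnth (x_R0 X i w) q}.
  apply: (filter_forall (f := fun (i : 'I_n) w => forall q, initial X i q w = tnth (x_R0 X i w) q)).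
  by move=> i; exact: (initial_ae hX At0 i).
have AE : {ae cP, forall w, At w}.
  have aeT : {ae P, forall w : Omega, True} by exact: aeW.
  by apply: filterS (cond_prob_ae (atom_measurable X j) At0 aeT) => w [].
apply: filterS2 (filterI AE wE) (filterI sE rE) => w [Aw wEw] [sEw rEw] i q.
by rewrite -(approx_atomE hX At0 k Aw); exact: (error_decomposition hX At0).
Qed.

Lemma measurable_opinion k i q :
  measurable_fun setT (fun w => opinion_process p X n k w i q).
Proof.
have mB i1 i2 : measurable_fun setT (fun w => x_B X i1 i2 w * (x_edge X i2 i1 w)%:R : R).
  apply: measurable_funM.
    by move=> _ B mB; rewrite setTI; exact: (measurable_funPTI (x_B X i1 i2) mB).
  by have [] := bounded_rv_bool R (measurable_funPT (x_edge X i2 i1)).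
have mC i1 i2 : measurable_fun setT (fun w => Cmx X n w i1 i2).
  rewrite (_ : (fun w => _) = fun w => x_B X i1 i2 w * (x_edge X i2 i1 w)%:R /
      inweight X i1 w * (0 < inweight X i1 w)%R%:R * (i1 != i2)%:R); last first.
    apply/funext => w; rewrite mxE; case: (0 < _); case: (i1 != i2) => //=;
      by rewrite ?(mulr1, mulr0).
  apply: measurable_funM; last exact: measurable_cst.
  apply: measurable_fun_ratio; first exact: mB.
  by apply: measurable_sum => i3; exact: mB.
elim: k i => [|k IH] i.
  rewrite (_ : (fun w => _) = fun w => tnth (x_R0 X i w) q); last first.
    by apply/funext => w; rewrite mxE.
  exact: measurable_tnth_rv.
rewrite (_ : (fun w => _) = fun w =>
    c * \sum_i' Cmx X n w i i' * opinion_process p X n k w i' q +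
    Wmx p X n k.+1 w i q + a * opinion_process p X n k w i q); last first.
  apply/funext => w; rewrite [LHS]mxE [X in X + _]mxE [X in _ + X]mxE.
  by congr (_ + _ + _); rewrite [LHS]mxE mxE.
apply: measurable_funD; first apply: measurable_funD.
- apply: measurable_funM; first exact: measurable_cst.
  by apply: measurable_sum => i'; apply: measurable_funM.
- exact: (measurable_Wmx hX At0).
- by apply: measurable_funM; first exact: measurable_cst.
Qed.

Lemma measurable_approx_form k i q :
  measurable_fun setT (fun w => approx_form p X j k w i q).
Proof.
rewrite /approx_form; set mo := lift_rows _ _.
rewrite (_ : (fun w => _) = fun w => fluctuation j a (signal_mean p X j)
    (initial_mean X j) (fun k => Wmx p X n k w) (R0mx X n w) k i q + mo i q); last first.
  by apply/funext => w; rewrite mxE.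
apply: measurable_funD; last exact: measurable_cst.
elim: k {mo} => [|k IH].
  rewrite (_ : (fun w => _) = fun w => tnth (x_R0 X i w) q -
      initial_mean X j (j i) q); last by apply/funext => w; rewrite !mxE.
  by apply: measurable_funB; [exact: measurable_tnth_rv|exact: measurable_cst].
rewrite (_ : (fun w => _) = fun w => Wmx p X n k.+1 w i q - signal_mean p X j (j i) q +
    a * fluctuation j a (signal_mean p X j) (initial_mean X j)
      (fun k => Wmx p X n k w) (R0mx X n w) k i q); last first.
  apply/funext => w; rewrite [LHS]mxE [X in X + _]mxE [X in _ + X]mxE.
  by rewrite [X in _ + X + _]mxE [X in _ - X + _]mxE.
apply: measurable_funD.
  by apply: measurable_funB; [exact: (measurable_Wmx hX At0)|exact: measurable_cst].
by apply: measurable_funM; first exact: measurable_cst.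
Qed.

Lemma eq_En (f g : Omega -> R) w : At w -> (forall w', At w' -> f w' = g w') ->
  En X n f w = En X n g w.
Proof.
move=> Aw fg; have jE : labels X n w = j by [].
rewrite /En jE; congr (_ * _)%E; apply: eq_integral => w'.
by rewrite inE => Aw'; rewrite fg.
Qed.

(** Summation of [Ex_total_error] over the [l] topics. *)
Lemma En_row_error k i w : At w ->
  (En X n (fun w' => norm1 (row i (opinion_process p X n k w') -
     row i (approx_process p X n k w'))) w <= (l%:R * (2 * rate))%:E)%E.
Proof.
move=> Aw.
rewrite (@eq_En _ (fun w' => \sum_q `|opinion_process p X n k w' i q -
    approx_form p X j k w' i q|) w Aw); last first.
  move=> w' Aw'; rewrite /norm1; apply: eq_bigr => q _.
  by rewrite (approx_atomE hX At0 k Aw') sub_rowE.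
rewrite (En_Ex At0 (g := fun w' => \sum_q `|terr q k i w'|) Aw).
- rewrite lee_fin Ex_sum; last by move=> q _; apply: bounded_rv_norm; exact: total_error_rv.
  apply: (@le_trans _ _ (\sum_(q < l) 2 * rate)).
    by apply: ler_sum => q _; exact: Ex_total_error.
  by rewrite sumr_const card_ord -[leLHS]mulr_natl.
- apply: measurable_sum => q; apply: measurableT_comp => //.
  by apply: measurable_funB; [exact: measurable_opinion|exact: measurable_approx_form].
- by apply: bounded_rv_sum => q _; apply: bounded_rv_norm; exact: total_error_rv.
- by apply: filterS (total_error_ae k) => w' e; apply: eq_bigr => q _; rewrite e.
Qed.

(** The maximal row sum is at most the sum over topics of the maximal
    entries. *)
Lemma En_max_error k w : ln n%:R <= rho ^+ 2 * theta -> At w ->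
  (En X n (fun w' => mxnorm_oo (opinion_process p X n k w' -
     approx_process p X n k w')) w <= (l%:R * (2 * rate))%:E)%E.
Proof.
move=> nln Aw.
rewrite (@eq_En _ (fun w' => \big[Num.max/0]_i \sum_q `|opinion_process p X n k w' i q -
    approx_form p X j k w' i q|) w Aw); last first.
  move=> w' Aw'; rewrite /mxnorm_oo; apply: eq_bigr => i _; apply: eq_bigr => q _.
  by rewrite (approx_atomE hX At0 k Aw') sub_mxE.
have bt q i : bounded_rv (fun w' => `|terr q k i w'|).
  by apply: bounded_rv_norm; exact: total_error_rv.
have bm (f : 'I_n -> Omega -> R) : (forall i, bounded_rv (f i)) ->
    bounded_rv (fun x => \big[Num.max/0]_(i < n) f i x).
  by move=> bf; apply: bounded_rv_bigmax => i _.
have bT : bounded_rv (fun w' => \big[Num.max/0]_i \sum_q `|terr q k i w'|).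
  by apply: bm => i; apply: bounded_rv_sum => q _.
rewrite (En_Ex At0 (g := fun w' => \big[Num.max/0]_i \sum_q `|terr q k i w'|) Aw) => //.
- rewrite lee_fin; apply: (@le_trans _ _
      (Ex cP (fun w' => \sum_q \big[Num.max/0]_i `|terr q k i w'|))).
    apply: le_Ex => //; first by apply: bounded_rv_sum => q _; exact: bm.
    move=> x; apply: bigmax_le; first by apply: sumr_ge0 => q _; exact: bigmax_ge_id.
    move=> i _; apply: ler_sum => q _.
    exact: (le_bigmax 0 (fun i => `|terr q k i x|)).
  rewrite Ex_sum; last by move=> q _; exact: bm.
  apply: (@le_trans _ _ (\sum_(q < l) 2 * rate)).
    by apply: ler_sum => q _; exact: Ex_max_total_error.
  by rewrite sumr_const card_ord -[leLHS]mulr_natl.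
- rewrite (_ : (fun w' => _) = fun w' => \big[Num.max/0]_(i <- index_enum 'I_n)
     (\sum_q `|opinion_process p X n k w' i q - approx_form p X j k w' i q|)); last by [].
  elim: (index_enum _) => [|i s IH].
    by under eq_fun do rewrite big_nil; exact: measurable_cst.
  under eq_fun do rewrite big_cons; apply: measurable_maxr => //.
  apply: measurable_sum => q; apply: measurableT_comp => //.
  by apply: measurable_funB; [exact: measurable_opinion|exact: measurable_approx_form].
- apply: filterS (total_error_ae k) => w' e; apply: eq_bigr => i _.
  by apply: eq_bigr => q _; rewrite e.
Qed.

End AtomBounds.

(** * Empirical and limiting community weights *)

Section Limits.
Context (R : realType) (K l : nat) (p : params R K l).
Local Notation H := (p_H p).
Local Notation kappa := (p_kappa p).
Local Notation ksum := (\sum_r \sum_s kappa r s).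

Lemma ln2_ge : 2^-1 <= ln (2 : R).
Proof.
have : expR (2^-1 : R) <= 2.
  have := expR_ge1Dx (- 2^-1 : R); rewrite expRN => h.
  rewrite -[leLHS]invrK -[leRHS]invrK lef_pV2 ?posrE ?invr_gt0 ?expR_gt0//.
  by lra.
by move=> h; rewrite -[leLHS]expRK ler_ln ?posrE ?expR_gt0.
Qed.

Lemma pi_le1 s : p_pi p s <= 1.
Proof.
rewrite -(p_pi_sum p) (bigD1 s)//= lerDl; apply: sumr_ge0 => r _.
exact: ltW (p_pi_gt0 p r).
Qed.

Context (n : nat) (j : {ffun 'I_n -> 'I_K}).
Hypothesis n_gt0 : (0 < n)%N.

Lemma sum_pin : \sum_r pin j r = 1 :> R.
Proof.
rewrite /pin -mulr_suml -natr_sum.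
have -> : (\sum_r #|[pred i | j i == r]| = n)%N.
  rewrite -[RHS](card_ord n) -sum1_card (partition_big j predT)//=.
  by apply: eq_bigr => r _; rewrite sum1_card.
by rewrite divff// pnatr_eq0 -lt0n.
Qed.

(** Summing the cross differences pin_s pi_r - pi_s pin_r over r gives
    pin_s - pi_s, and each of them is at most calE pin_r. *)
Lemma pin_deviation s : (forall r, 0 < pin j r :> R) ->
  `|pin j s - p_pi p s| <= calEn p j.
Proof.
move=> pin0; have pi0 := p_pi_gt0 p.
have -> : pin j s - p_pi p s = \sum_r (pin j s * p_pi p r - p_pi p s * pin j r).
  by rewrite sumrB -!mulr_sumr (p_pi_sum p) sum_pin !mulr1.
apply: le_trans (ler_norm_sum _ _ _) _.
rewrite -[leRHS]mulr1 -sum_pin mulr_sumr; apply: ler_sum => r _.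
have d0 : 0 < pin j r * p_pi p s by rewrite mulr_gt0.
apply: (@le_trans _ _ (calEn p j * (pin j r * p_pi p s))).
  rewrite -ler_pdivrMr// -[X in _ / X](gtr0_norm d0) -normf_div.
  rewrite /calEn; apply: le_trans (le_bigmax 0 (fun r => \big[Num.max/0]_s _) r).
  exact: (le_bigmax 0 (fun s => `|(pin j s * p_pi p r - p_pi p s * pin j r) / (pin j r * p_pi p s)|)).
rewrite ler_wpM2l//; first by rewrite /calEn bigmax_ge_id.
by rewrite -[leRHS]mulr1 ler_wpM2l ?pi_le1// ltW.
Qed.

Lemma empirical_deviation r s (del eta : R) :
  `|pin j s - p_pi p s| <= del -> `|sparse_kernel p n s r - kappa s r| <= eta ->
  `|empirical_weight p j r s - limit_weight p r s| <= H * (del * ksum + eta).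
Proof.
move=> hd he; have b0 := beta_ge0 p r s; have bH := beta_le p r s.
have k0 : 0 <= sparse_kernel p n s r by exact: sparse_kernel_ge0.
have k1 := le_trans (sparse_kernel_le p n_gt0 s r) (kappa_le_sum p s r).
have -> : empirical_weight p j r s - limit_weight p r s =
  beta p r s * ((pin j s - p_pi p s) * sparse_kernel p n s r +
    p_pi p s * (sparse_kernel p n s r - kappa s r)).
  by rewrite /empirical_weight /limit_weight; ring.
rewrite normrM (ger0_norm b0); apply: ler_pM => //.
apply: le_trans (ler_normD _ _) _; apply: lerD; rewrite normrM.
  by rewrite (ger0_norm k0) ler_pM.
rewrite (gtr0_norm (p_pi_gt0 p s)) -[leRHS]mul1r ler_pM ?pi_le1//.
exact: ltW (p_pi_gt0 p s).
Qed.

(** Both weights lie in [0, weight_cap]. *)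
Lemma trivial_deviation r s :
  `|empirical_weight p j r s - limit_weight p r s| <= weight_cap p.
Proof.
have e0 := empirical_weight_ge0 p j r s; have e1 := empirical_weight_le p j n_gt0 r s.
have l0 := limit_weight_ge0 p r s.
have l1 : limit_weight p r s <= weight_cap p.
  rewrite /limit_weight /weight_cap; apply: ler_pM.
  - by apply: mulr_ge0; [exact: ltW (p_pi_gt0 p s)|exact: beta_ge0].
  - exact: p_kappa_ge0.
  - rewrite -[leRHS]mul1r; apply: ler_pM; [|exact: beta_ge0|exact: pi_le1|exact: beta_le].
    exact: ltW (p_pi_gt0 p s).
  - exact: kappa_le_sum.
by rewrite ler_norml; lra.
Qed.

End Limits.

Section Atoms.
Context (R : realType) (K l : nat).
Context (dO : measure_display) (Omega : measurableType dO).
Context (P : probability Omega R) (X : data K l P) (n : nat).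

(** There are finitely many label configurations, and each atom is
    measurable. *)
Lemma label_event_measurable (A : {ffun 'I_n -> 'I_K} -> Prop) :
  measurable [set w | A (labels X n w)].
Proof.
rewrite (_ : [set w | _] = \bigcup_(j in [set j | A j]) atom X j).
  apply: fin_bigcup_measurable; first exact: finite_finset.
  by move=> j _; exact: atom_measurable.
apply/seteqP; split => [w Aw|w /= [j Aj wj]]; first by exists (labels X n w).
by have -> : labels X n w = j by [].
Qed.

Lemma charged_atom_ae : {ae P, forall w, P (atom X (labels X n w)) != 0%E}.
Proof.
have : {ae P, forall w, forall j : {ffun 'I_n -> 'I_K}, P (atom X j) = 0%E -> ~ atom X j w}.
  apply: filter_forall => j.
  have [Pj|Pj] := eqVneq (P (atom X j)) 0%E; last first.
    by apply: aeW => w P0; move: Pj; rewrite P0 eqxx.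
  exists (atom X j); split => //; first exact: atom_measurable.
  by move=> w /= /not_implyP[_ /contrapT].
by apply: filterS => w h; apply/eqP => /h; apply.
Qed.

End Atoms.

(** * The uniform and the vertexwise error bounds *)

Lemma measure_exists_le d (T : measurableType d) (R : realType)
    (P : probability T R) (I : finType) (A : I -> set T) :
  (forall i, measurable (A i)) -> (P [set x | exists i, A i x] <= \sum_i P (A i))%E.
Proof.
move=> mA.
have step s : measurable [set x | exists2 i, i \in s & A i x] /\
    (P [set x | exists2 i, i \in s & A i x] <= \sum_(i <- s) P (A i))%E.
  elim: s => [|i s [ms IH]].
    rewrite (_ : [set x | _] = set0); last by apply/seteqP; split => x // [].
    by rewrite measure0 big_nil; split.
  rewrite (_ : [set x | _] = A i `|` [set x | exists2 i, i \in s & A i x]).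
    split; first exact: measurableU.
    rewrite big_cons; apply: le_trans (leeD2l _ IH).
    have /= := measureU2 P (mA i) ms; exact.
  apply/seteqP; split => x /=.
    by move=> [i']; rewrite inE => /orP[/eqP ->|i's] Ax; [left|right; exists i'].
  by move=> [Ax|[i' i's Ax]]; [exists i|exists i'] => //; rewrite inE ?eqxx ?i's ?orbT.
have [_] := step (index_enum I); apply: le_trans.
rewrite (_ : [set x | exists i, A i x] =
  [set x | exists2 i, i \in index_enum I & A i x])//.
apply/seteqP; split => x /= [i]; last by exists i.
by move=> Ax; exists i => //; rewrite mem_index_enum.
Qed.

(** The limit superior is the infimum of the tail suprema, so one of these is
    below the bound. *)
Lemma limn_esup_lt (R : realType) (u : nat -> \bar R) (b : \bar R) :
  (limn_esup u < b)%E -> \forall n \near \oo, (u n < b)%E.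
Proof.
rewrite limn_esup_lim (cvg_lim _ (@cvg_esups_inf R u))// => /ereal_inf_lt[_ [N _ <-]] Nb.
exists N => // n Nn /=; apply: le_lt_trans Nb.
by apply: ereal_sup_ubound; exists n.
Qed.

Section MainTheorem.
Context (R : realType) (K l : nat) (p : params R K l).
Context (dO : measure_display) (Omega : measurableType dO).
Context (P : probability Omega R) (X : data K l P) (hX : is_model p X).
Local Notation H := (p_H p).
Local Notation kappa := (p_kappa p).
Local Notation ksum := (\sum_r \sum_s kappa r s).

Let C : R := `|l%:R * (2 * error_rate p)|.

Let rate_le (x : R) : 0 <= x -> l%:R * (2 * (error_rate p * x)) <= C * x.
Proof. by move=> x0; rewrite !mulrA -[_ * 2 * _]mulrA ler_wpM2r// ler_norm. Qed.

(** With rho^2 = ln n / theta the maximum over all vertices is covered by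
    [En_max_error].  When all kappa theta / n <= 1, the empirical weights differ
    from their limits by a multiple of calE; for the finitely many other sizes
    they differ by at most [weight_cap], which is absorbed by enlarging Gamma by
    multiples of 1 / rho. *)
Lemma uniform_rate :
  (\forall n \near \oo, forall r s, kappa r s * p_theta p n / n%:R <= 1) ->
   exists Gamma : R, forall n : nat, (2 <= n)%N ->
     {ae P, forall w : Omega,
       (forall r, (0 : R) < pin (labels X n w) r) ->
       (ereal_sup (range (fun k : nat =>
           En X n (fun w' => mxnorm_oo (opinion_process p X n k w' - approx_process p X n k w'))
              w))
        <= (Gamma * (Num.sqrt (ln n%:R / p_theta p n)
                     + calEn p (labels X n w)))%:E)%E}.
Proof.
move=> [N _ kN].
pose rho n := Num.sqrt (ln n%:R / p_theta p n) : R.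
have C0 : 0 <= C by exact: normr_ge0.
have wc0 := weight_cap_ge0 p.
have rho0 n : (0 <= rho n) by exact: sqrtr_ge0.
have small0 n : 0 <= C * weight_cap p / rho n by nonneg.
exists (C * (1 + weight_cap p) + \sum_(n < N) C * weight_cap p / rho n) => n n2.
have n0 : (0 < n)%N by exact: ltn_trans n2.
have t0 := p_theta_gt0 p n.
have ln0 : 2^-1 <= ln n%:R :> R.
  apply: le_trans (ln2_ge R) _; rewrite ler_ln ?posrE ?ltr0n//.
  by rewrite ler_nat.
have lt0 : 0 < ln n%:R / p_theta p n by rewrite divr_gt0//; lra.
have rn0 : 0 < rho n by rewrite sqrtr_gt0.
have rhoE : rho n ^+ 2 * p_theta p n = ln n%:R.
  by rewrite sqr_sqrtr ?(ltW lt0)// divfK// gt_eqF.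
apply: filterS (charged_atom_ae X n) => w At0 pin0.
have Aw : atom X (labels X n w) w by [].
have cE0 : 0 <= calEn p (labels X n w) by rewrite /calEn bigmax_ge_id.
set G := _ + \sum_(n' < N) _.
have main (g : R) : 0 <= g ->
    (forall r s, `|empirical_weight p (labels X n w) r s - limit_weight p r s| <= g) ->
    C * (rho n + g) <= G * (rho n + calEn p (labels X n w)) ->
    (ereal_sup (range (fun k : nat =>
       En X n (fun w' => mxnorm_oo (opinion_process p X n k w' - approx_process p X n k w')) w))
     <= (G * (rho n + calEn p (labels X n w)))%:E)%E.
  move=> g0 dev gG; apply: ge_ereal_sup => _ [k _ <-].
  have := @En_max_error _ _ _ _ _ _ _ X hX n _ At0 n0 g (rho n) g0 dev rn0 _ k w _ Aw.
  rewrite rhoE => /(_ ln0 (lexx _)) /le_trans; apply.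
  by rewrite lee_fin; apply: le_trans gG; apply: rate_le; rewrite addr_ge0.
have s0 : 0 <= \sum_(n' < N) C * weight_cap p / rho n' by apply: sumr_ge0.
have [Nn|nN] := leqP N n.
  apply: (main (H * (calEn p (labels X n w) * ksum + 0))).
  - by rewrite mulr_ge0 ?(ltW (p_H_gt0 p))// addr0 mulr_ge0 ?ksum_ge0.
  - move=> r s; apply: empirical_deviation => //; first exact: pin_deviation.
    rewrite /sparse_kernel min_l; last exact: kN.
    rewrite (_ : n%:R / _ * _ = kappa s r) ?subrr ?normr0//.
    by field; rewrite !gt_eqF// ltr0n.
  rewrite addr0 mulrCA -/(weight_cap p) mulrDr.
  have h1 : 0 <= C * weight_cap p * rho n by nonneg.
  have h2 : 0 <= C * calEn p (labels X n w) by nonneg.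
  have h3 : 0 <= (\sum_(n' < N) C * weight_cap p / rho n') * (rho n + calEn p (labels X n w)).
    by rewrite mulr_ge0// addr_ge0.
  by rewrite /G; lra.
apply: (main (weight_cap p)) => //; first by move=> r s; exact: trivial_deviation.
have sG : C * weight_cap p / rho n <= \sum_(n' < N) C * weight_cap p / rho n'.
  by rewrite (bigD1 (Ordinal nN))//= lerDl; apply: sumr_ge0.
have h1 : C * weight_cap p / rho n * rho n = C * weight_cap p.
  by rewrite divfK// gt_eqF.
have h2 : 0 <= C * weight_cap p * rho n by nonneg.
have h3 : 0 <= G * calEn p (labels X n w) by rewrite /G; nonneg.
have h4 := ler_wpM2r (rho0 n) sG; rewrite h1 in h4.
by rewrite [leRHS]mulrDr mulrDr; move: h3; rewrite /G; lra.
Qed.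

(** The kernel is only cut where kappa theta / n exceeds 1, and there it
    eventually does so by little, by the condition on the limit superior. *)
Lemma sparse_kernel_cvg (eta : R) : 0 < eta ->
  \forall n \near \oo, (0 < n)%N ->
    forall s r, `|sparse_kernel p n s r - kappa s r| <= eta.
Proof.
move=> eta0; have k0 := ksum_ge0 p.
pose e := eta / (ksum + 1).
have e0 : 0 < e by rewrite divr_gt0//; lra.
have := @limn_esup_lt R _ (1 + e)%:E
  (le_lt_trans (p_theta_limsup p) (_ : (1 < (1 + e)%:E)%E)).
move=> /(_ _)[|N _ HN]; first by rewrite lte_fin; lra.
exists N => // n Nn n0 s r; have := HN n Nn; rewrite /= lte_fin => hn.
have t0 := p_theta_gt0 p n; have n0' : (0 : R) < n%:R by rewrite ltr0n.
set t := kappa s r * p_theta p n / n%:R.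
have te : t <= 1 + e.
  apply: le_trans (ltW hn).
  apply: le_trans (le_bigmax 0 (fun r => \big[Num.max/0]_s _) s).
  exact: (le_bigmax 0 (fun s' => kappa s s' * p_theta p n / n%:R)).
have kE : kappa s r = n%:R / p_theta p n * t by rewrite /t; field; rewrite !gt_eqF.
have nt0 : 0 < n%:R / p_theta p n by rewrite divr_gt0.
rewrite /sparse_kernel -/t [X in _ - X]kE -mulrBr normrM (gtr0_norm nt0).
case: (lerP t 1) => t1; first by rewrite subrr normr0 mulr0 ltW.
rewrite ltr0_norm; last by lra.
apply: (@le_trans _ _ (n%:R / p_theta p n * (t * e))).
  rewrite ler_wpM2l ?(ltW nt0)//; apply: (@le_trans _ _ e); first by lra.
  by rewrite ler_peMl// ltW.
rewrite mulrA -kE /e mulrCA ler_piMr ?(ltW eta0)// ler_pdivrMr ?mul1r; last by lra.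
by have := kappa_le_sum p s r; lra.
Qed.

Let row_error n w := ereal_sup (range (fun k : nat => (\big[maxe/0]_(i < n)
  En X n (fun w' => norm1 (row i (opinion_process p X n k w') -
    row i (approx_process p X n k w'))) w)%E)).

(** With rho = theta^(-1/2) and labels whose frequencies are close to their
    limits, [En_row_error] bounds the error of every vertex by [eps].  Up to a
    null set, a larger error thus requires some frequency to be far from its
    limit, an event whose probability tends to 0. *)
Lemma row_error_cvg : p_theta p @ \oo --> +oo -> cvg_in_probability P row_error 0.
Proof.
move=> thoo eps eps0; have k0 := ksum_ge0 p; have H0 := p_H_gt0 p.
have C0 : 0 <= C by exact: normr_ge0.
pose g0 : R := eps / (2 * (C + 1)).
have g00 : 0 < g0 by rewrite divr_gt0//; lra.
(* C (rho + g0) is at most eps as soon as rho <= g0, and del is the precision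
   on the frequencies and on the kernel that yields g0 *)
pose del : R := g0 / (H * (ksum + 1)).
have del0 : 0 < del by rewrite divr_gt0// mulr_gt0//; lra.
have delE : H * (del * ksum + del) = g0.
  by rewrite /del; field; rewrite !gt_eqF//; lra.
pose dev n r := [set w | (del%:E < `|(pin (labels X n w) r)%:E - (p_pi p r)%:E|)%E].
have mdev n r : measurable (dev n r).
  exact: (label_event_measurable X
    (fun j => (del%:E < `|(pin j r)%:E - (p_pi p r)%:E|)%E : Prop)).
have row0 n w : (0 <= row_error n w)%E.
  apply: (@le_trans _ _ (\big[maxe/0]_(i < n)
    En X n (fun w' => norm1 (row i (opinion_process p X n 0 w') -
      row i (approx_process p X n 0 w'))) w)%E); first exact: bigmax_ge_id.
  by apply: ereal_sup_ubound; exists 0%N.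
apply: (@squeeze_cvge _ _ _ _ (fun=> 0%E) _ (fun n => \sum_r P (dev n r))%E).
- have [N1 _ hN1] := sparse_kernel_cvg del0.
  have [N2 _ hN2] := (cvgryPge _).1 thoo (g0 ^- 2).
  exists (maxn N1 N2).+1 => // n /= Nn; have n0 : (0 < n)%N by exact: leq_trans Nn.
  move: Nn; rewrite gtn_max => /andP[/ltnW n1 /ltnW n2'].
  apply/andP; split; first exact: measure_ge0.
  apply: le_trans (measure_exists_le P (mdev n)).
  have t0 := p_theta_gt0 p n.
  pose rho : R := (Num.sqrt (p_theta p n))^-1.
  have rho0 : 0 < rho by rewrite invr_gt0 sqrtr_gt0.
  have rhoE : rho ^+ 2 * p_theta p n = 1.
    by rewrite /rho exprVn sqr_sqrtr ?(ltW t0)// mulVf// gt_eqF.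
  have rhog : rho <= g0.
    rewrite -(@ler_pXn2r _ 2) ?nnegrE ?(ltW rho0) ?(ltW g00)//.
    rewrite /rho exprVn sqr_sqrtr ?(ltW t0)// -[leRHS]invrK.
    by rewrite lef_pV2 ?posrE// ?invr_gt0 ?exprn_gt0//; exact: hN2.
  have rhoh : 2^-1 <= rho ^+ 2 * p_theta p n by rewrite rhoE; lra.
  have good w : P (atom X (labels X n w)) != 0%E -> ~ (exists r, dev n r w) ->
      (row_error n w <= eps%:E)%E.
    move=> At0 ndev; apply: ge_ereal_sup => _ [k _ <-].
    have dev_le r : `|pin (labels X n w) r - p_pi p r| <= del.
      rewrite leNgt; apply/negP => h; apply: ndev; exists r.
      by rewrite /dev /= lte_fin.
    have emp r s : `|empirical_weight p (labels X n w) r s - limit_weight p r s| <= g0.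
      by rewrite -delE; apply: empirical_deviation => //; exact: hN1.
    apply: bigmax_le; first by rewrite lee_fin ltW.
    move=> i _.
    have := @En_row_error _ _ _ _ _ _ _ X hX n _ At0 n0 g0 rho (ltW g00) emp rho0 rhoh k i w erefl.
    move=> /le_trans; apply; rewrite lee_fin.
    apply: (@le_trans _ _ (C * (rho + g0))); first by apply: rate_le; lra.
    apply: (@le_trans _ _ ((C + 1) * (g0 + g0))); first by rewrite ler_pM//; lra.
    by rewrite le_eqVlt; apply/orP; left; apply/eqP; rewrite /g0; field; rewrite gt_eqF//; lra.
  rewrite -/(row_error _ _).
  set bad := [set w | _].
  have [Z [mZ PZ hZ]] := charged_atom_ae X n.
  (* the conditional means depend on the labels only *)
  have mbad : measurable bad.
    pose S (j : {ffun 'I_n -> 'I_K}) := exists2 w, labels X n w = j & bad w.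
    rewrite (_ : bad = [set w | S (labels X n w)]); first exact: label_event_measurable.
    apply/seteqP; split => w /=; first by exists w.
    by move=> [w' lw]; rewrite /bad /= /row_error /En lw.
  have mex : measurable [set w | exists r, dev n r w].
    rewrite (_ : [set w | _] = \bigcup_(r in [set: 'I_K]) dev n r).
      by apply: fin_bigcup_measurable => //; exact: finite_finset.
    by apply/seteqP; split => w /= [r]; [exists r|move=> _; exists r].
  apply: (@le_trans _ _ (P (Z `|` [set w | exists r, dev n r w]))).
    apply: le_measure; rewrite ?inE//; first exact: measurableU.
    move=> w bw; have [|ndev] := pselect (exists r, dev n r w); first by right.
    left; apply: hZ => /= At0; move: bw; rewrite /bad /= sube0 gee0_abs//.
    by rewrite ltNge (good w At0 ndev).
  have /= := measureU2 P mZ mex; rewrite PZ add0e; exact.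
- exact: cvg_cst.
- suff : (\sum_r P (dev n r))%E @[n --> \oo] --> (\sum_(r < K) (0 : \bar R))%E by rewrite big1.
  apply: cvg_nnesum => r _; first by apply: nearW => n; exact: measure_ge0.
  exact: (pin_cvg hX r del0).
Qed.

End MainTheorem.

Theorem theorem3p1 (R : realType) (K l : nat) (hK : (1 <= K)%N)
    (hl : (1 <= l)%N) (p : params R K l) (dO : measure_display)
    (Omega : measurableType dO) (P : probability Omega R)
    (X : data K l P) (hX : is_model p X) :
  ((\forall n \near \oo, forall r s, p_kappa p r s * p_theta p n / n%:R <= 1) ->
   exists Gamma : R, forall n : nat, (2 <= n)%N ->
     {ae P, forall w : Omega,
       (forall r, (0 : R) < pin (labels X n w) r) ->
       (6%:R * p_H p * Lambdan p (labels X n w)) ^+ 2 * Deltan p (labels X n w)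
         * ln n%:R <= p_theta p n ->
       (ereal_sup (range (fun k : nat =>
           En X n (fun w' => mxnorm_oo (opinion_process p X n k w' - approx_process p X n k w'))
              w))
        <= (Gamma * (Num.sqrt (ln n%:R / p_theta p n)
                     + calEn p (labels X n w)))%:E)%E})
  /\
  (p_theta p @ \oo --> +oo ->
   cvg_in_probability P
     (fun n w => ereal_sup (range (fun k : nat =>
        (\big[maxe/0]_(i < n)
           En X n (fun w' =>
             norm1 (row i (opinion_process p X n k w') - row i (approx_process p X n k w')))
             w)%E)))
     0).
Proof.
split=> [kappa_small|theta_oo]; last exact: row_error_cvg.
have [Gamma hG] := uniform_rate hX kappa_small.
exists Gamma => n n2; apply: filterS (hG n n2) => w hw pin_gt0 _.
exact: hw.
Qed.
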